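(* Let $\ell\ge1$, let $A$ be the affine generalized Cartan matrix of type $A_\ell^{(1)}$ with nodes $0,1,\dots,\ell$ numbered in cyclic order around the Dynkin diagram, let $\mathfrak g=\mathfrak g(A)$, let $\rho=(0,1,\dots,\ell)\in\mathrm{Aut}(A)$, and let $q\in\mathbb Z$. Then $$L(\overline{\mathfrak g'},\rho^q)\simeq L\big(\mathfrak{sl}_{\ell+1}(R_1),P_{\ell+1}(t_1)^q\big),$$ $$L(\overline{\mathfrak g'},\rho^q)\simeq L\big(\mathfrak{sl}_{\ell+1}(k),(D_{\ell+1}(\zeta_{\ell+1}),P_{\ell+1}(1)^q)\big),$$ and $$L(\overline{\mathfrak g'},\rho^q)\simeq \mathfrak{sl}_{\gcd(q,\ell+1)}\big(Q(\zeta_{\ell+1}^{\iota_{\ell+1}(\bar q)})\big).$$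
   Context: $k$ is an algebraically closed field of characteristic $0$; algebras are over $k$ and $\simeq$ means (ungraded) isomorphism of $k$-algebras. Fix primitive $m$-th roots of unity $\zeta_m\in k$ with $\zeta_{mn}^n=\zeta_m$ for all $m,n\ge1$. $R_1=k[t_1^{\pm1}]$. Loop algebras: if $\mathfrak s$ is an algebra and $\sigma\in\mathrm{Aut}(\mathfrak s)$ with $\sigma^m=1$, then $L(\mathfrak s,\sigma)=\sum_{j\in\mathbb Z}\{u\in\mathfrak s:\sigma u=\zeta_m^ju\}\otimes z^j\subseteq \mathfrak s\otimes k[z^{\pm1}]$; if $\sigma_1,\sigma_2$ are commuting automorphisms with $\sigma_i^{m_i}=1$, then $L(\mathfrak s,(\sigma_1,\sigma_2))=\sum_{(j_1,j_2)\in\mathbb Z^2}\{u:\sigma_iu=\zeta_{m_i}^{j_i}u,\ i=1,2\}\otimes z_1^{j_1}z_2^{j_2}\subseteq\mathfrak s\otimes k[z_1^{\pm1},z_2^{\pm1}]$. Up to isomorphism these do not depend on the chosen periods. $\mathfrak g'$ is the derived algebra of $\mathfrak g$ and $\overline{\mathfrak g'}=\mathfrak g'/Z(\mathfrak g')$. An element $\sigma\in\mathrm{Aut}(A)$ is identified with the automorphism of $\overline{\mathfrak g'}$ sending the images of the Chevalley generators $e_i,f_i$ to those of $e_{\sigma(i)},f_{\sigma(i)}$. For a unital associative algebra $\mathcal A$ and $g\ge1$, $\mathfrak{gl}_g(\mathcal A)$ is the matrix algebra $M_g(\mathcal A)$ under the commutator, and $\mathfrak{sl}_g(\mathcal A)=[\mathfrak{gl}_g(\mathcal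 A),\mathfrak{gl}_g(\mathcal A)]$. For a unit $u$ in a commutative $k$-algebra $F$ and $m\ge1$, $d_m(u)=\mathrm{diag}(1,u,\dots,u^{m-1})$ and $p_m(u)=\sum_{i=1}^{m-1}E_{i+1,i}+uE_{1,m}$ in $M_m(F)$ (with $p_1(u)=[u]$); $D_m(u)$ and $P_m(u)$ denote conjugation $x\mapsto axa^{-1}$ by $a=d_m(u)$ and $a=p_m(u)$ respectively, as automorphisms of $M_m(F)$ or of $\mathfrak{sl}_m(F)$. For $\theta\in k^\times$, the quantum torus $Q(\theta)$ is the unital associative $k$-algebra generated by $x_1^{\pm1},x_2^{\pm1}$ subject to the inverse relations and $x_1x_2=\theta x_2x_1$. For $m\ge1$, $\iota_m:\mathbb Z/m\to\mathbb Z/m$ is defined as follows: for $\bar q\in\mathbb Z/m$ let $g=\gcd(q,m)$ (with $\gcd(0,m)=m$) and write $q=gr$; then $\iota_m(\bar q)=\overline{gs}$, where $s\in\mathbb Z$ satisfies $rs\equiv1\pmod{m/g}$. For $\theta$ with $\theta^m=1$, $\theta^{\bar a}:=\theta^a$. *)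

(* Defs.v *)
From HB Require Import structures.
From mathcomp Require Import all_boot all_order perm all_algebra finmap.
From mathcomp Require Import boolp classical_sets functions cardinality fsbigop.

Set Implicit Arguments.
Unset Strict Implicit.
Unset Printing Implicit Defensive.

Import Order.TTheory GRing.Theory Num.Theory.

Local Open Scope classical_set_scope.
Local Open Scope ring_scope.
Local Open Scope quotient_scope.

(* No identity or symmetry is assumed of the product. *)

HB.mixin Record isNalgebra (k : fieldType) V of GRing.Lmodule k V := {
  amul : V -> V -> V;
  amul_linl : forall (a : k) (x y z : V),
    amul (a *: x + y) z = a *: amul x z + amul y z;
  amul_linr : forall (a : k) (x y z : V),
    amul z (a *: x + y) = a *: amul z x + amul z y }.

#[short(type="nalgType")]
HB.structure Definition Nalgebra (k : fieldType) :=
  {V of GRing.Lmodule k V & isNalgebra k V}.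

HB.mixin Record isLieAlgebra (k : fieldType) V of Nalgebra k V := {
  amulxx : forall x : V, amul x x = 0;
  amul_jacobi : forall x y z : V,
    amul x (amul y z) + amul y (amul z x) + amul z (amul x y) = 0 }.

#[short(type="lieAlgType")]
HB.structure Definition LieAlgebra (k : fieldType) :=
  {V of Nalgebra k V & isLieAlgebra k V}.

Section NalgebraTheory.
Variables (k : fieldType) (S : nalgType k).
Implicit Types (x y z : S) (a : k).

Lemma amulDl x y z : amul (x + y) z = amul x z + amul y z.
Proof. by have := amul_linl 1 x y z; rewrite !scale1r. Qed.

Lemma amulDr z x y : amul z (x + y) = amul z x + amul z y.
Proof. by have := amul_linr 1 x y z; rewrite !scale1r. Qed.

Lemma amul0l z : amul 0 z = 0.
Proof. by apply: (addrI (amul 0 z)); rewrite -amulDl !addr0. Qed.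

Lemma amul0r z : amul z 0 = 0.
Proof. by apply: (addrI (amul z 0)); rewrite -amulDr !addr0. Qed.

Lemma amulZl a x z : amul (a *: x) z = a *: amul x z.
Proof. by have := amul_linl a x 0 z; rewrite !addr0 amul0l addr0. Qed.

Lemma amulZr a x z : amul z (a *: x) = a *: amul z x.
Proof. by have := amul_linr a x 0 z; rewrite !addr0 amul0r addr0. Qed.

Lemma amulNl x z : amul (- x) z = - amul x z.
Proof. by rewrite -scaleN1r amulZl scaleN1r. Qed.

Lemma amulNr x z : amul z (- x) = - amul z x.
Proof. by rewrite -scaleN1r amulZr scaleN1r. Qed.

Lemma amulBl x y z : amul (x - y) z = amul x z - amul y z.
Proof. by rewrite amulDl amulNl. Qed.

Lemma amulBr z x y : amul z (x - y) = amul z x - amul z y.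
Proof. by rewrite amulDr amulNr. Qed.

End NalgebraTheory.

Lemma lieC (k : fieldType) (L : lieAlgType k) (x y : L) :
  amul x y = - amul y x.
Proof.
apply/eqP; rewrite -addr_eq0; have := amulxx (x + y).
by rewrite amulDl !amulDr !amulxx addr0 add0r => /eqP.
Qed.

Definition isoalg (k : fieldType) (S T : nalgType k) : Prop :=
  exists f : {linear S -> T},
    bijective f /\ forall x y, f (amul x y) = amul (f x) (f y).

Notation "S ≃ T" := (isoalg S T) (at level 70, no associativity) : type_scope.

Record aut (k : fieldType) (S : nalgType k) := Aut {
  aut_fun :> S -> S;
  aut_inv : S -> S;
  autK : cancel aut_fun aut_inv;
  autVK : cancel aut_inv aut_fun;
  aut_linear : linear aut_fun;
  aut_mul : forall x y, aut_fun (amul x y) = amul (aut_fun x) (aut_fun y) }.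

HB.instance Definition _ (k : fieldType) (S : nalgType k) :=
  gen_eqMixin (aut S).
HB.instance Definition _ (k : fieldType) (S : nalgType k) :=
  gen_choiceMixin (aut S).

Section Automorphisms.
Variables (k : fieldType) (S : nalgType k).
Implicit Types s t : aut S.

HB.instance Definition _ s :=
  GRing.isLinear.Build k S S *:%R (aut_fun s) (@aut_linear _ _ s).

Lemma aut0 s : s 0 = 0. Proof. exact: linear0. Qed.
Lemma autD s x y : s (x + y) = s x + s y. Proof. exact: linearD. Qed.
Lemma autZ s (a : k) x : s (a *: x) = a *: s x. Proof. exact: linearZ. Qed.

Definition aut_id : aut S.
Proof. exact: (@Aut k S id id (fun _ => erefl) (fun _ => erefl)
  (fun _ _ _ => erefl) (fun _ _ => erefl)). Defined.

Definition aut_comp s t : aut S.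
Proof.
refine (@Aut k S (s \o t) (aut_inv t \o aut_inv s) _ _ _ _).
- exact: (can_comp (autK s) (autK t)).
- exact: (can_comp (autVK t) (autVK s)).
- by move=> a x y /=; rewrite !linearP.
- by move=> x y /=; rewrite !aut_mul.
Defined.

Definition aut_V s : aut S.
Proof.
refine (@Aut k S (aut_inv s) s _ _ _ _);
  [exact: autVK | exact: autK | move=> a x y | move=> x y].
- by apply: (can_inj (autK s)); rewrite aut_linear !autVK.
- by apply: (can_inj (autK s)); rewrite aut_mul !autVK.
Defined.

Definition autn s (n : nat) : aut S := iter n (aut_comp s) aut_id.

Definition autz s (q : int) : aut S :=
  match q with Posz n => autn s n | Negz n => autn (aut_V s) n.+1 end.

Definition has_period s (m : nat) : Prop :=
  (0 < m)%N /\ forall x, autn s m x = x.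

End Automorphisms.

HB.mixin Record isIdealClosed (k : fieldType) (S : nalgType k) (I : {pred S}) :=
  { ideal_mull : forall x y : S, y \in I -> amul x y \in I;
    ideal_mulr : forall x y : S, x \in I -> amul x y \in I }.

#[short(type="idealClosed")]
HB.structure Definition IdealClosed (k : fieldType) (S : nalgType k) :=
  {I of GRing.SubmodClosed k I & isIdealClosed k S I}.

Section QuotientAlgebra.
Variables (k : fieldType) (S : nalgType k) (I : idealClosed S).

Fact ideal_opp : oppr_closed I.
Proof. by move=> x xI; rewrite -scaleN1r rpredZ. Qed.
HB.instance Definition _ := GRing.isOppClosed.Build S I ideal_opp.

Definition qalg : Type := (Quotient.quot (I : {pred S})).
HB.instance Definition _ := GRing.Zmodule.on qalg.

Definition qproj (x : S) : qalg := \pi_(Quotient.quot (I : {pred S})) x.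

Lemma qproj_eq x y : (qproj x = qproj y) <-> (x - y \in I).
Proof.
by rewrite /qproj (Quotient.idealrBE I); split=> [/eqP //|/eqP].
Qed.

Lemma qproj_repr (x : qalg) : qproj (repr x) = x.
Proof. exact: reprK. Qed.

Lemma qprojB x y : qproj (x - y) = qproj x - qproj y.
Proof. exact: (raddfB (\pi_(Quotient.quot (I : {pred S})))). Qed.

Lemma qprojD x y : qproj (x + y) = qproj x + qproj y.
Proof. exact: (raddfD (\pi_(Quotient.quot (I : {pred S})))). Qed.

Lemma qproj0 : qproj 0 = 0.
Proof. exact: (raddf0 (\pi_(Quotient.quot (I : {pred S})))). Qed.

Definition qscale (a : k) (x : qalg) : qalg := qproj (a *: repr x).

Lemma qscaleE a x : qscale a (qproj x) = qproj (a *: x).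
Proof.
apply/qproj_eq; rewrite -scalerBr rpredZ //.
by apply/qproj_eq; rewrite qproj_repr.
Qed.

Lemma qind (P : qalg -> Prop) : (forall x, P (qproj x)) -> forall x, P x.
Proof. by move=> h x; rewrite -(qproj_repr x). Qed.

Fact qscaleA a b x : qscale a (qscale b x) = qscale (a * b) x.
Proof. by elim/qind: x => x; rewrite !qscaleE scalerA. Qed.

Fact qscale1 : left_id 1 qscale.
Proof. by elim/qind=> x; rewrite qscaleE scale1r. Qed.

Fact qscaleDr : right_distributive qscale +%R.
Proof.
move=> a; elim/qind=> x; elim/qind=> y.
by rewrite -qprojD !qscaleE -qprojD scalerDr.
Qed.

Fact qscaleDl x : {morph qscale^~ x : a b / a + b}.
Proof. by elim/qind: x => x a b; rewrite !qscaleE -qprojD scalerDl. Qed.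

HB.instance Definition _ :=
  GRing.Zmodule_isLmodule.Build k qalg qscaleA qscale1 qscaleDr qscaleDl.

Lemma qprojZ a x : qproj (a *: x) = a *: qproj x.
Proof. by rewrite [RHS]qscaleE. Qed.

Definition qmul (x y : qalg) : qalg := qproj (amul (repr x) (repr y)).

Lemma qmulE x y : qmul (qproj x) (qproj y) = qproj (amul x y).
Proof.
apply/qproj_eq; set x' := repr _; set y' := repr _.
have -> : amul x' y' - amul x y = amul (x' - x) y' + amul x (y' - y).
  by rewrite amulBl amulBr addrA subrK.
have rI z : repr (qproj z) - z \in I by apply/qproj_eq; rewrite qproj_repr.
by apply: rpredD; [apply: ideal_mulr | apply: ideal_mull]; apply: rI.
Qed.

Fact qmul_linl a x y z : qmul (a *: x + y) z = a *: qmul x z + qmul y z.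
Proof.
elim/qind: x => x; elim/qind: y => y; elim/qind: z => z.
by rewrite -qprojZ -qprojD !qmulE -qprojZ -qprojD amul_linl.
Qed.

Fact qmul_linr a x y z : qmul z (a *: x + y) = a *: qmul z x + qmul z y.
Proof.
elim/qind: x => x; elim/qind: y => y; elim/qind: z => z.
by rewrite -qprojZ -qprojD !qmulE -qprojZ -qprojD amul_linr.
Qed.

HB.instance Definition _ := isNalgebra.Build k qalg qmul_linl qmul_linr.

Lemma qprojM x y : qproj (amul x y) = amul (qproj x) (qproj y).
Proof. by rewrite [RHS]qmulE. Qed.

End QuotientAlgebra.

Section QuotientLie.
Variables (k : fieldType) (L : lieAlgType k) (I : idealClosed L).

Fact qalg_amulxx (x : qalg I) : amul x x = 0.
Proof. by elim/qind: x => x; rewrite -qprojM amulxx qproj0. Qed.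

Fact qalg_jacobi (x y z : qalg I) :
  amul x (amul y z) + amul y (amul z x) + amul z (amul x y) = 0.
Proof.
elim/qind: x => x; elim/qind: y => y; elim/qind: z => z.
by rewrite -!qprojM -!qprojD amul_jacobi qproj0.
Qed.

HB.instance Definition _ :=
  isLieAlgebra.Build k (qalg I) qalg_amulxx qalg_jacobi.
End QuotientLie.

Section Derived.
Variables (k : fieldType) (S : nalgType k).

Definition derived_pred : {pred S} := fun x =>
  `[< exists s : seq (S * S), x = \sum_(p <- s) amul p.1 p.2 >].

Lemma derivedP x :
  x \in derived_pred <-> exists s : seq (S * S), x = \sum_(p <- s) amul p.1 p.2.
Proof. by split=> [/asboolP|h] //; apply/asboolP. Qed.

Lemma amul_derived x y : amul x y \in derived_pred.
Proof. by apply/derivedP; exists [:: (x, y)]; rewrite big_seq1. Qed.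

Fact derived_submod : subsemimod_closed derived_pred.
Proof.
split; [split|].
- by apply/derivedP; exists [::]; rewrite big_nil.
- move=> x y /derivedP[s ->] /derivedP[t ->].
  by apply/derivedP; exists (s ++ t); rewrite big_cat.
- move=> a x /derivedP[s ->]; apply/derivedP.
  exists [seq (a *: p.1, p.2) | p <- s]; rewrite big_map scaler_sumr.
  by apply: eq_bigr => p _; rewrite amulZl.
Qed.
HB.instance Definition _ := GRing.isSubmodClosed.Build k S derived_pred
  derived_submod.

Record derived := Derived {
  derived_val : S; derived_valP : derived_val \in derived_pred }.
HB.instance Definition _ := [isSub for derived_val].
HB.instance Definition _ := [Choice of derived by <:].
HB.instance Definition _ := [SubChoice_isSubLmodule of derived by <:].

Definition derived_mul (x y : derived) : derived :=
  Derived (amul_derived (val x) (val y)).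

Fact derived_linl a x y z :
  derived_mul (a *: x + y) z = a *: derived_mul x z + derived_mul y z.
Proof. by apply: val_inj; rewrite /= amul_linl. Qed.

Fact derived_linr a x y z :
  derived_mul z (a *: x + y) = a *: derived_mul z x + derived_mul z y.
Proof. by apply: val_inj; rewrite /= amul_linr. Qed.

HB.instance Definition _ := isNalgebra.Build k derived derived_linl derived_linr.

Lemma aut_derived_in (s : aut S) x : x \in derived_pred -> s x \in derived_pred.
Proof.
move=> /derivedP[r ->]; rewrite linear_sum /=; apply: rpred_sum => p _.
by rewrite aut_mul amul_derived.
Qed.

Definition aut_derived (s : aut S) : aut derived.
Proof.
refine (@Aut k derived (fun x => Derived (aut_derived_in s (valP x)))
  (fun x => Derived (aut_derived_in (aut_V s) (valP x))) _ _ _ _).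
- by move=> x; apply: val_inj; rewrite /= autK.
- by move=> x; apply: val_inj; rewrite /= autVK.
- by move=> a x y; apply: val_inj; rewrite /= linearP.
- by move=> x y; apply: val_inj; rewrite /= aut_mul.
Defined.

End Derived.
Arguments derived {k} S.
Arguments derived_pred {k} S.

Section DerivedLie.
Variables (k : fieldType) (L : lieAlgType k).

Fact derived_amulxx (x : derived L) : amul x x = 0.
Proof. by apply: val_inj; rewrite /= amulxx. Qed.

Fact derived_jacobi (x y z : derived L) :
  amul x (amul y z) + amul y (amul z x) + amul z (amul x y) = 0.
Proof. by apply: val_inj; rewrite /= amul_jacobi. Qed.

HB.instance Definition _ :=
  isLieAlgebra.Build k (derived L) derived_amulxx derived_jacobi.

End DerivedLie.

Section Center.
Variables (k : fieldType) (L : lieAlgType k).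

Definition center : {pred L} := fun x => `[< forall y, amul x y = 0 >].

Lemma centerP x : x \in center <-> forall y, amul x y = 0.
Proof. by split=> [/asboolP|h] //; apply/asboolP. Qed.

Fact center_submod : subsemimod_closed center.
Proof.
split; [split|].
- by apply/centerP => y; rewrite amul0l.
- by move=> x y /centerP hx /centerP hy; apply/centerP => z;
    rewrite amulDl hx hy addr0.
- by move=> a x /centerP hx; apply/centerP => z; rewrite amulZl hx scaler0.
Qed.
HB.instance Definition _ := GRing.isSubmodClosed.Build k L center center_submod.

Fact center_mulr (x y : L) : x \in center -> amul x y \in center.
Proof. by move=> /centerP ->; exact: rpred0. Qed.

Fact center_mull (x y : L) : y \in center -> amul x y \in center.
Proof. by move=> yZ; rewrite lieC rpredN center_mulr. Qed.

HB.instance Definition _ :=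
  isIdealClosed.Build k L center center_mull center_mulr.

End Center.
Arguments center {k} L.

(* [pres E] is the free nonassociative [k]-algebra on [X] modulo the ideal
   generated by the relations [s = t], for [E s t]; Lie and unital associative
   presentations are obtained by adding the corresponding laws to [E]. *)

Inductive term (k X : Type) :=
  | TGen of X
  | TZero
  | TAdd of term k X & term k X
  | TScale of k & term k X
  | TMul of term k X & term k X.

Arguments TGen {k X} _.
Arguments TZero {k X}.

HB.instance Definition _ (k X : Type) := gen_eqMixin (term k X).
HB.instance Definition _ (k X : Type) := gen_choiceMixin (term k X).

Section Presentation.
Variables (k : fieldType) (X : Type).
Local Notation term := (term k X).

Inductive cong (E : term -> term -> Prop) : term -> term -> Prop :=
  | cong_rel s t of E s t : cong E s t
  | cong_refl s : cong E s s
  | cong_sym s t of cong E s t : cong E t s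
  | cong_trans s t u of cong E s t & cong E t u : cong E s u
  | cong_add s s' t t' of cong E s s' & cong E t t' :
      cong E (TAdd s t) (TAdd s' t')
  | cong_scale a s s' of cong E s s' : cong E (TScale a s) (TScale a s')
  | cong_mul s s' t t' of cong E s s' & cong E t t' :
      cong E (TMul s t) (TMul s' t')
  | cong_addA s t u : cong E (TAdd s (TAdd t u)) (TAdd (TAdd s t) u)
  | cong_addC s t : cong E (TAdd s t) (TAdd t s)
  | cong_add0 s : cong E (TAdd TZero s) s
  | cong_addN s : cong E (TAdd (TScale (-1) s) s) TZero
  | cong_scaleA a b s : cong E (TScale a (TScale b s)) (TScale (a * b) s)
  | cong_scale1 s : cong E (TScale 1 s) s
  | cong_scaleDr a s t :
      cong E (TScale a (TAdd s t)) (TAdd (TScale a s) (TScale a t))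
  | cong_scaleDl a b s :
      cong E (TScale (a + b) s) (TAdd (TScale a s) (TScale b s))
  | cong_linl a s t u :
      cong E (TMul (TAdd (TScale a s) t) u)
             (TAdd (TScale a (TMul s u)) (TMul t u))
  | cong_linr a s t u :
      cong E (TMul u (TAdd (TScale a s) t))
             (TAdd (TScale a (TMul u s)) (TMul u t)).

Variable E : term -> term -> Prop.

Definition congb (s t : term) : bool := `[< cong E s t >].

Fact congb_equiv : equiv_class_of congb.
Proof.
split=> [s|s t|t s u].
- exact/asboolP/cong_refl.
- by apply/asboolP/asboolP; apply: cong_sym.
- by move=> /asboolP st /asboolP tu; apply/asboolP/(cong_trans st tu).
Qed.

Canonical congb_equivRel := EquivRelPack congb_equiv.
Canonical congb_encModRel := defaultEncModRel congb.

Definition pres : Type := {eq_quot congb}.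
HB.instance Definition _ := Choice.on pres.

Definition pclass (s : term) : pres := \pi_{eq_quot congb} s.

Lemma pclass_eq s t : pclass s = pclass t <-> cong E s t.
Proof.
by split=> [/eqP|st]; [rewrite eqmodE => /asboolP | apply/eqP; rewrite eqmodE;
  apply/asboolP].
Qed.

Lemma pclass_repr (x : pres) : pclass (repr x) = x.
Proof. exact: reprK. Qed.

Lemma cong_repr s : cong E (repr (pclass s)) s.
Proof. by apply/pclass_eq; rewrite pclass_repr. Qed.

Lemma pind (P : pres -> Prop) : (forall s, P (pclass s)) -> forall x, P x.
Proof. by move=> h x; rewrite -(pclass_repr x). Qed.

Definition padd (x y : pres) := pclass (TAdd (repr x) (repr y)).
Definition pscale (a : k) (x : pres) := pclass (TScale a (repr x)).
Definition pmul (x y : pres) := pclass (TMul (repr x) (repr y)).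
Definition pzero := pclass TZero.
Definition popp := pscale (-1).

Lemma paddE s t : padd (pclass s) (pclass t) = pclass (TAdd s t).
Proof. by apply/pclass_eq/cong_add; apply: cong_repr. Qed.

Lemma pscaleE a s : pscale a (pclass s) = pclass (TScale a s).
Proof. by apply/pclass_eq/cong_scale/cong_repr. Qed.

Lemma pmulE s t : pmul (pclass s) (pclass t) = pclass (TMul s t).
Proof. by apply/pclass_eq/cong_mul; apply: cong_repr. Qed.

Fact paddA : associative padd.
Proof.
elim/pind=> s; elim/pind=> t; elim/pind=> u.
by rewrite !paddE; apply/pclass_eq/cong_addA.
Qed.

Fact paddC : commutative padd.
Proof.
by elim/pind=> s; elim/pind=> t; rewrite !paddE; apply/pclass_eq/cong_addC.
Qed.

Fact padd0 : left_id pzero padd.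
Proof. by elim/pind=> s; rewrite paddE; apply/pclass_eq/cong_add0. Qed.

Fact paddN : left_inverse pzero popp padd.
Proof.
by elim/pind=> s; rewrite /popp pscaleE paddE; apply/pclass_eq/cong_addN.
Qed.

HB.instance Definition _ := GRing.isZmodule.Build pres paddA paddC padd0 paddN.

Fact pscaleA a b x : pscale a (pscale b x) = pscale (a * b) x.
Proof. by elim/pind: x => s; rewrite !pscaleE; apply/pclass_eq/cong_scaleA. Qed.

Fact pscale1 : left_id 1 pscale.
Proof. by elim/pind=> s; rewrite !pscaleE; apply/pclass_eq/cong_scale1. Qed.

Fact pscaleDr : right_distributive pscale padd.
Proof.
move=> a; elim/pind=> s; elim/pind=> t.
by rewrite !(paddE, pscaleE); apply/pclass_eq/cong_scaleDr.
Qed.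

Fact pscaleDl x : {morph pscale^~ x : a b / a + b >-> padd a b}.
Proof.
elim/pind: x => s a b.
by rewrite !pscaleE paddE; apply/pclass_eq/cong_scaleDl.
Qed.

HB.instance Definition _ :=
  GRing.Zmodule_isLmodule.Build k pres pscaleA pscale1 pscaleDr pscaleDl.

Fact pmul_linl a (x y z : pres) : pmul (a *: x + y) z = a *: pmul x z + pmul y z.
Proof.
elim/pind: x => s; elim/pind: y => t; elim/pind: z => u.
by rewrite [_ *: pclass s]pscaleE [_ + pclass t]paddE !pmulE
  [_ *: pclass _]pscaleE [RHS]paddE; apply/pclass_eq/cong_linl.
Qed.

Fact pmul_linr a (x y z : pres) : pmul z (a *: x + y) = a *: pmul z x + pmul z y.
Proof.
elim/pind: x => s; elim/pind: y => t; elim/pind: z => u.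
by rewrite [_ *: pclass s]pscaleE [_ + pclass t]paddE !pmulE
  [_ *: pclass _]pscaleE [RHS]paddE; apply/pclass_eq/cong_linr.
Qed.

HB.instance Definition _ := isNalgebra.Build k pres pmul_linl pmul_linr.

Definition pgen (x : X) : pres := pclass (TGen x).

End Presentation.

Section LiePresentation.
Variables (k : fieldType) (X : Type) (E : term k X -> term k X -> Prop).

Inductive lie_rel : term k X -> term k X -> Prop :=
  | lie_base s t of E s t : lie_rel s t
  | lie_alt s : lie_rel (TMul s s) TZero
  | lie_jac s t u :
      lie_rel (TAdd (TAdd (TMul s (TMul t u)) (TMul t (TMul u s)))
                    (TMul u (TMul s t))) TZero.

Definition lie_pres : Type := pres lie_rel.
HB.instance Definition _ := Nalgebra.on lie_pres.

Fact lie_pres_amulxx (x : lie_pres) : amul x x = 0.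
Proof.
by elim/pind: x => s; rewrite [LHS]pmulE; apply/pclass_eq/cong_rel/lie_alt.
Qed.

Fact lie_pres_jacobi (x y z : lie_pres) :
  amul x (amul y z) + amul y (amul z x) + amul z (amul x y) = 0.
Proof.
elim/pind: x => s; elim/pind: y => t; elim/pind: z => u.
rewrite /amul /= !pmulE [X in X + _]paddE [LHS]paddE.
exact/pclass_eq/cong_rel/lie_jac.
Qed.

HB.instance Definition _ :=
  isLieAlgebra.Build k lie_pres lie_pres_amulxx lie_pres_jacobi.
End LiePresentation.

Section AssocPresentation.
Variables (k : fieldType) (X : Type).

(* The generator [None] is the unit element. *)
Local Notation term := (term k (option X)).
Variable E : term -> term -> Prop.

Inductive assoc_rel : term -> term -> Prop :=
  | assoc_base s t of E s t : assoc_rel s t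
  | assoc_A s t u : assoc_rel (TMul s (TMul t u)) (TMul (TMul s t) u)
  | assoc_1l s : assoc_rel (TMul (TGen None) s) s
  | assoc_1r s : assoc_rel (TMul s (TGen None)) s.

Definition assoc_pres : Type := pres assoc_rel.
HB.instance Definition _ := Nalgebra.on assoc_pres.

Lemma assoc_presA : associative (@amul k assoc_pres).
Proof.
elim/pind=> s; elim/pind=> t; elim/pind=> u.
by rewrite /amul /= !pmulE; apply/pclass_eq/cong_rel/assoc_A.
Qed.

Definition assoc_one : assoc_pres := pgen assoc_rel None.

Lemma assoc_pres1l : left_id assoc_one (@amul k assoc_pres).
Proof.
by elim/pind=> s; rewrite [LHS]pmulE; apply/pclass_eq/cong_rel/assoc_1l.
Qed.

Lemma assoc_pres1r : right_id assoc_one (@amul k assoc_pres).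
Proof.
by elim/pind=> s; rewrite [LHS]pmulE; apply/pclass_eq/cong_rel/assoc_1r.
Qed.

End AssocPresentation.

(* The rank is computed over [k]; in characteristic 0 it is the rank of [A]. *)
Record realization (k : fieldType) (n : nat) (A : 'M[int]_n) := Realization {
  cartan : vectType k;
  coroot : 'I_n -> cartan;
  root : 'I_n -> 'Hom(cartan, k^o);
  coroot_free : free [seq coroot i | i : 'I_n];
  root_free : free [seq root i | i : 'I_n];
  root_coroot : forall i j, root j (coroot i) = (A i j)%:~R :> k;
  cartan_dim : (\dim {: cartan} + \rank (map_mx intr A : 'M[k]_n) = n.*2)%N }.

Inductive km_gen (h : Type) (n : nat) :=
  | KH of h
  | KE of 'I_n
  | KF of 'I_n.

Arguments KE {h n} _.
Arguments KF {h n} _.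
Arguments KH {h n} _.

Section KacMoody.
Variables (k : fieldType) (n : nat) (A : 'M[int]_n) (R : realization k A).
Local Notation h := (cartan R).
Local Notation X := (km_gen h n).
Local Notation H x := (TGen (KH x) : term k X).
Local Notation e i := (TGen (KE i) : term k X).
Local Notation f i := (TGen (KF i) : term k X).

Inductive km_rel : term k X -> term k X -> Prop :=
  | km_lin (a : k) (x y : h) : km_rel (H (a *: x + y)) (TAdd (TScale a (H x)) (H y))
  | km_hh x y : km_rel (TMul (H x) (H y)) TZero
  | km_ef i j : km_rel (TMul (e i) (f j)) (if i == j then H (coroot R i) else TZero)
  | km_he x i : km_rel (TMul (H x) (e i)) (TScale (root R i x) (e i))
  | km_hf x i : km_rel (TMul (H x) (f i)) (TScale (- root R i x) (f i)).

Definition km_tilde : Type := lie_pres km_rel.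
HB.instance Definition _ := LieAlgebra.on km_tilde.

Definition kmt_gen (x : X) : km_tilde := pgen (lie_rel km_rel) x.

(* The sum of all ideals of [km_tilde] meeting the Cartan subalgebra trivially;
   this is the largest such ideal. *)
Definition km_rad : {pred km_tilde} := fun x =>
  `[< exists2 s : seq km_tilde, x = \sum_(y <- s) y &
        forall y, y \in s -> exists2 I : idealClosed km_tilde,
          y \in I & forall z, kmt_gen (KH z) \in I -> kmt_gen (KH z) = 0 >].

Fact km_rad_map (g : {additive km_tilde -> km_tilde}) :
    (forall (I : idealClosed km_tilde) x, x \in I -> g x \in I) ->
  forall x, x \in km_rad -> g x \in km_rad.
Proof.
move=> gI x /asboolP[s -> sI]; apply/asboolP; exists [seq g y | y <- s].
  by rewrite big_map raddf_sum.
by move=> _ /mapP[y /sI[I yI hI] ->]; exists I => //; apply: gI.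
Qed.

Fact km_rad_submod : subsemimod_closed km_rad.
Proof.
split; [split|].
- by apply/asboolP; exists [::] => //; rewrite big_nil.
- move=> x y /asboolP[s -> sI] /asboolP[t -> tI]; apply/asboolP.
  exists (s ++ t); first by rewrite big_cat.
  by move=> z; rewrite mem_cat => /orP[/sI|/tI].
- move=> a; apply: (km_rad_map (g := GRing.scale a)) => I x.
  exact: rpredZ.
Qed.
HB.instance Definition _ :=
  GRing.isSubmodClosed.Build k km_tilde km_rad km_rad_submod.

Fact km_rad_mull (x y : km_tilde) : y \in km_rad -> amul x y \in km_rad.
Proof.
move=> /asboolP[s -> sI]; apply/asboolP; exists [seq amul x y | y <- s].
  by rewrite big_map; elim/big_rec2: _ => [|z u v _ <-];
    rewrite ?amul0r ?amulDr.
move=> _ /mapP[z /sI[I zI hI] ->]; exists I => //.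
exact: (@ideal_mull _ _ I).
Qed.

Fact km_rad_mulr (x y : km_tilde) : x \in km_rad -> amul x y \in km_rad.
Proof. by move=> xr; rewrite lieC rpredN km_rad_mull. Qed.

HB.instance Definition _ :=
  isIdealClosed.Build k km_tilde km_rad km_rad_mull km_rad_mulr.

Definition km_alg : lieAlgType k := qalg km_rad.

Definition km_bar : nalgType k := qalg (center (derived km_alg)).

Definition chev_gen (x : X) : km_alg := qproj km_rad (kmt_gen x).

(* [insubd 0] is the corestriction to the derived algebra, in which the
   Chevalley generators lie (lemmas [chev_e_derived], [chev_f_derived]). *)
Definition bar_e (i : 'I_n) : km_bar :=
  qproj (center (derived km_alg)) (insubd (0 : derived km_alg) (chev_gen (KE i))).
Definition bar_f (i : 'I_n) : km_bar :=
  qproj (center (derived km_alg)) (insubd (0 : derived km_alg) (chev_gen (KF i))).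

Definition AutGCM : {pred 'S_n} :=
  fun s => [forall i, forall j, A (s i) (s j) == A i j].

(* The automorphism of [km_bar] identified with the diagram automorphism [s];
   it is unique because the [bar_e i] and [bar_f i] generate [km_bar].  The
   default [aut_id] serves only permutations that are not in [AutGCM]. *)
Definition diag_aut (s : 'S_n) : aut km_bar :=
  xget (aut_id km_bar) [set t : aut km_bar |
    forall i, t (bar_e i) = bar_e (s i) /\ t (bar_f i) = bar_f (s i)].

Lemma km_heE x i : amul (chev_gen (KH x)) (chev_gen (KE i)) =
  (root R i x : k) *: chev_gen (KE i).
Proof.
rewrite /chev_gen -qprojM -qprojZ; congr (qproj _ _).
rewrite [LHS]pmulE [RHS]pscaleE.
exact/pclass_eq/cong_rel/lie_base/km_he.
Qed.

Lemma km_hfE x i : amul (chev_gen (KH x)) (chev_gen (KF i)) =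
  - (root R i x : k) *: chev_gen (KF i).
Proof.
rewrite /chev_gen -qprojM -qprojZ; congr (qproj _ _).
rewrite [LHS]pmulE [RHS]pscaleE.
exact/pclass_eq/cong_rel/lie_base/km_hf.
Qed.

Lemma chev_e_derived i : (A i i)%:~R != 0 :> k ->
  chev_gen (KE i) \in derived_pred km_alg.
Proof.
move=> A0; rewrite -[chev_gen _]scale1r -(mulVf A0) -scalerA rpredZ //.
by rewrite -(root_coroot R) -km_heE amul_derived.
Qed.

Lemma chev_f_derived i : (A i i)%:~R != 0 :> k ->
  chev_gen (KF i) \in derived_pred km_alg.
Proof.
move=> A0; rewrite -[chev_gen _]scale1r -(mulVf A0) -scalerA rpredZ //.
by rewrite -rpredN -scaleNr -(root_coroot R) -km_hfE amul_derived.
Qed.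

End KacMoody.

(* For [ell = 1] both off-diagonal terms coincide, giving -2. *)
Definition affA (ell : nat) : 'M[int]_ell.+1 :=
  \matrix_(i, j) ((i == j).*2%:Z - (j == ordS i)%:Z - (i == ordS j)%:Z).

Definition rho (ell : nat) : 'S_ell.+1 := perm (@ordS_inj ell.+1).

Lemma rho_AutGCM ell : rho ell \in AutGCM (affA ell).
Proof.
apply/forallP => i; apply/forallP => j.
by rewrite !mxE !permE !(inj_eq (@ordS_inj _)).
Qed.

(* Finitely supported functions [G -> V], i.e. [V ⊗ k[G]]: the function [f]
   stands for the sum of the [f j ⊗ z^j].  [G] is [int] for one variable and
   [int * int] for two. *)
Section Laurent.
Variables (G : zmodType) (k : fieldType) (V : lmodType k).

Definition fin_supp : {pred G -> V} := fun f =>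
  `[< finite_set [set i | f i <> 0] >].

Lemma fin_suppP f : f \in fin_supp <-> finite_set [set i | f i <> 0].
Proof. by split=> [/asboolP|h] //; apply/asboolP. Qed.

Fact fin_supp_submod : subsemimod_closed fin_supp.
Proof.
split; [split|].
- apply/fin_suppP; rewrite (_ : [set _ | _] = set0) //.
  by rewrite -subset0 => i /=.
- move=> f g /fin_suppP ff /fin_suppP fg; apply/fin_suppP.
  apply: (@sub_finite_set _ _ ([set i | f i <> 0] `|` [set i | g i <> 0])).
    move=> i /= fgi; apply: contrapT => /not_orP[/contrapT fi /contrapT gi].
    by apply: fgi; rewrite -[LHS]/(f i + g i) fi gi addr0.
  by rewrite finite_setU.
- move=> a f /fin_suppP ff; apply/fin_suppP.
  apply: sub_finite_set ff => i /= afi fi; apply: afi.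
  by rewrite -[LHS]/(a *: f i) fi scaler0.
Qed.
HB.instance Definition _ :=
  GRing.isSubmodClosed.Build k (G -> V) fin_supp fin_supp_submod.

Record laurent := Laurent {
  lcoef :> G -> V; lcoefP : lcoef \in fin_supp }.
HB.instance Definition _ := [isSub for lcoef].
HB.instance Definition _ := [Choice of laurent by <:].
HB.instance Definition _ := [SubChoice_isSubLmodule of laurent by <:].

End Laurent.

Section LaurentAlgebra.
Variables (G : zmodType) (k : fieldType) (S : nalgType k).
Local Notation laurent := (laurent G S).
Implicit Types f g h : laurent.

Definition conv f g : G -> S :=
  fun j => \sum_(i \in [set: G]) amul (f i) (g (j - i)).

Lemma lcoef_fin f : finite_set [set i | f i <> 0].
Proof. exact/fin_suppP/lcoefP. Qed.

Lemma conv_widen (D : set G) f g j : [set i | f i <> 0] `<=` D ->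
  conv f g j = \sum_(i \in D) amul (f i) (g (j - i)).
Proof.
move=> fD; apply/esym/fsbig_widen => // i [_ Di] /=.
have -> : f i = 0 by apply: contrapT => /fD.
by rewrite amul0l.
Qed.

Fact conv_fin f g : conv f g \in @fin_supp G k S.
Proof.
apply/fin_suppP; apply: (@sub_finite_set _ _
  [set (x.1 + x.2) | x in [set i | f i <> 0] `*` [set i | g i <> 0]]).
  move=> j /= fgj; apply: contrapT => nj; apply: fgj; apply: fsbig1 => i _.
  have [->|/eqP fi] := eqVneq (f i) 0; first by rewrite amul0l.
  have [->|/eqP gi] := eqVneq (g (j - i)) 0; first by rewrite amul0r.
  by case: nj; exists (i, j - i) => //=; rewrite addrC subrK.
by apply: finite_image; apply: finite_setX; apply: lcoef_fin.
Qed.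

Definition lmul f g : laurent := Laurent (conv_fin f g).

Lemma lcoefD f g j : (f + g) j = f j + g j. Proof. by []. Qed.
Lemma lcoefZ a f j : (a *: f) j = a *: f j. Proof. by []. Qed.

Fact lmul_linl a f g h : lmul (a *: f + g) h = a *: lmul f h + lmul g h.
Proof.
apply/val_inj/funext => j.
rewrite -[RHS]/(a *: conv f h j + conv g h j) /= .
pose D := [set i | f i <> 0] `|` [set i | g i <> 0].
have finD : finite_set D by rewrite finite_setU; split; apply: lcoef_fin.
rewrite !(@conv_widen D); first last.
- move=> i afgi; apply: contrapT => /not_orP[/contrapT fi /contrapT gi].
  by apply: afgi; rewrite lcoefD lcoefZ fi gi scaler0 addr0.
- by move=> i; left.
- by move=> i; right.
rewrite !fsbig_finite //= scaler_sumr -big_split /=.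
by apply: eq_bigr => i _; exact: amul_linl.
Qed.

Fact lmul_linr a f g h : lmul h (a *: f + g) = a *: lmul h f + lmul h g.
Proof.
apply/val_inj/funext => j.
rewrite -[RHS]/(a *: conv h f j + conv h g j) /= .
have finD := lcoef_fin h.
rewrite !(@conv_widen [set i | h i <> 0]) //.
rewrite !fsbig_finite //= scaler_sumr -big_split /=.
by apply: eq_bigr => i _; exact: amul_linr.
Qed.

HB.instance Definition _ := isNalgebra.Build k laurent lmul_linl lmul_linr.

End LaurentAlgebra.

Record grading (G : zmodType) (k : fieldType) (S : nalgType k) := Grading {
  gr :> G -> S -> Prop;
  gr0 : forall j, gr j 0;
  grD : forall j x y, gr j x -> gr j y -> gr j (x + y);
  grZ : forall j a x, gr j x -> gr j (a *: x);
  grM : forall i j x y, gr i x -> gr j y -> gr (i + j) (amul x y) }.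

(* For subspaces [W j] of [S] with [W i * W j] contained in [W (i + j)], the
   subalgebra of [S ⊗ k[G]] that is the sum of the [W j ⊗ z^j]. *)
Section GradedSubalgebra.
Variables (G : zmodType) (k : fieldType) (S : nalgType k) (W : grading G S).

Definition gsub_pred : {pred laurent G S} := fun f =>
  `[< forall j, W j (f j) >].

Lemma gsubP (f : laurent G S) : f \in gsub_pred <-> forall j, W j (f j).
Proof. by split=> [/asboolP|h] //; apply/asboolP. Qed.

Fact gsub_submod : subsemimod_closed gsub_pred.
Proof.
split; [split|].
- by apply/gsubP => j; apply: gr0.
- by move=> f g /gsubP fW /gsubP gW; apply/gsubP => j; apply: grD.
- by move=> a f /gsubP fW; apply/gsubP => j; apply: grZ.
Qed.
HB.instance Definition _ :=
  GRing.isSubmodClosed.Build k (laurent G S) gsub_pred gsub_submod.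

Record gsub := Gsub { gsub_val : laurent G S; gsub_valP : gsub_val \in gsub_pred }.
HB.instance Definition _ := [isSub for gsub_val].
HB.instance Definition _ := [Choice of gsub by <:].
HB.instance Definition _ := [SubChoice_isSubLmodule of gsub by <:].

Fact gsub_mul_in (f g : gsub) : amul (val f) (val g) \in gsub_pred.
Proof.
case: f g => f /= /gsubP fW [g /= /gsubP gW]; apply/gsubP => j.
rewrite -[lcoef _ j]/(conv f g j) (@conv_widen _ _ _ [set i | f i <> 0]) //.
rewrite fsbig_finite /=; last exact: lcoef_fin.
elim/big_ind: _ => [|x y|i _]; [exact: gr0 | exact: grD|].
by rewrite -[j](subrK i) [_ - _ + _]addrC; apply: grM;
  rewrite // [i + _]addrC subrK.
Qed.

Definition gsub_mul (f g : gsub) : gsub := Gsub (gsub_mul_in f g).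

Fact gsub_linl a f g h :
  gsub_mul (a *: f + g) h = a *: gsub_mul f h + gsub_mul g h.
Proof. by apply: val_inj; exact: amul_linl. Qed.

Fact gsub_linr a f g h :
  gsub_mul h (a *: f + g) = a *: gsub_mul h f + gsub_mul h g.
Proof. by apply: val_inj; exact: amul_linr. Qed.

HB.instance Definition _ := isNalgebra.Build k gsub gsub_linl gsub_linr.

End GradedSubalgebra.

(* In the definitions of loop algebras, [zeta] is the chosen family of roots of
   unity and [m], [m1], [m2] are the chosen periods of the automorphisms. *)
Section Loop.
Variables (k : fieldType) (zeta : nat -> k) (S : nalgType k).

Section Eigenspaces.
Variables (s : aut S) (c : k).

Let eig (j : int) (x : S) : Prop := s x = c ^ j *: x.

Fact eig0 j : eig j 0.
Proof. by rewrite /eig linear0 scaler0. Qed.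

Fact eigD j x y : eig j x -> eig j y -> eig j (x + y).
Proof. by rewrite /eig autD scalerDr => -> ->. Qed.

Fact eigZ j a x : eig j x -> eig j (a *: x).
Proof. by rewrite /eig autZ => ->; rewrite !scalerA mulrC. Qed.

Fact eigM i j x y : eig i x -> eig j y -> eig (i + j) (amul x y).
Proof.
rewrite /eig aut_mul => hx hy; have [c0|c0] := eqVneq c 0; last first.
  by rewrite hx hy amulZl amulZr scalerA expfzDr.
have eig_0 l z : s z = c ^ l *: z -> l != 0 -> z = 0.
  move=> sz /negPf l0; move: sz; rewrite c0 exp0rz l0 scale0r => sz.
  by rewrite -[z](autK s) sz -[RHS](autK s 0) aut0.
have [i0|/(eig_0 _ _ hx) ->] := eqVneq i 0; last first.
  by rewrite aut0 !amul0l scaler0.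
have [j0|/(eig_0 _ _ hy) ->] := eqVneq j 0; last first.
  by rewrite aut0 !amul0r scaler0.
by rewrite hx hy i0 j0 addr0 expr0z !scale1r.
Qed.

Definition eig_grading : grading int S := Grading eig0 eigD eigZ eigM.

End Eigenspaces.

Definition loop (s : aut S) (m : nat) : nalgType k :=
  gsub (eig_grading s (zeta m)).

Section TwoVariables.
Variables (s1 s2 : aut S) (m1 m2 : nat).

Let W1 := eig_grading s1 (zeta m1).
Let W2 := eig_grading s2 (zeta m2).
Let bieig (j : int * int) (x : S) : Prop := W1 j.1 x /\ W2 j.2 x.

Fact bieig0 j : bieig j 0.
Proof. by split; apply: gr0. Qed.

Fact bieigD j x y : bieig j x -> bieig j y -> bieig j (x + y).
Proof. by move=> [? ?] [? ?]; split; apply: grD. Qed.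

Fact bieigZ j a x : bieig j x -> bieig j (a *: x).
Proof. by move=> [? ?]; split; apply: grZ. Qed.

Fact bieigM i j x y : bieig i x -> bieig j y -> bieig (i + j) (amul x y).
Proof. by move=> [? ?] [? ?]; split; apply: grM. Qed.

Definition bieig_grading : grading (int * int)%type S :=
  Grading bieig0 bieigD bieigZ bieigM.

Definition loop2 : nalgType k := gsub bieig_grading.

End TwoVariables.
End Loop.

Section Gl.
Variables (k : fieldType) (n : nat) (A : nalgType k).

Definition gl : Type := 'M[A]_n.
HB.instance Definition _ := GRing.Zmodule.on gl.
Implicit Types x y z : gl.

Definition gl_scale (a : k) x : gl := \matrix_(i, j) (a *: x i j).

Fact gl_scaleA a b x : gl_scale a (gl_scale b x) = gl_scale (a * b) x.
Proof. by apply/matrixP => i j; rewrite !mxE scalerA. Qed.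

Fact gl_scale1 : left_id 1 gl_scale.
Proof. by move=> x; apply/matrixP => i j; rewrite !mxE scale1r. Qed.

Fact gl_scaleDr : right_distributive gl_scale +%R.
Proof. by move=> a x y; apply/matrixP => i j; rewrite !mxE scalerDr. Qed.

Fact gl_scaleDl x : {morph gl_scale^~ x : a b / a + b}.
Proof. by move=> a b; apply/matrixP => i j; rewrite !mxE scalerDl. Qed.

HB.instance Definition _ :=
  GRing.Zmodule_isLmodule.Build k gl gl_scaleA gl_scale1 gl_scaleDr gl_scaleDl.

(* [*m] asks for a ring of coefficients, which excludes [nalgType]. *)
Definition mmul x y : gl := \matrix_(i, j) \sum_l amul (x i l) (y l j).

Definition commutator x y : gl := mmul x y - mmul y x.

Lemma mmul_linl a x y z : mmul (a *: x + y) z = a *: mmul x z + mmul y z.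
Proof.
apply/matrixP => i j; rewrite !mxE scaler_sumr -big_split /=.
by apply: eq_bigr => l _; rewrite !mxE amul_linl.
Qed.

Lemma mmul_linr a x y z : mmul z (a *: x + y) = a *: mmul z x + mmul z y.
Proof.
apply/matrixP => i j; rewrite !mxE scaler_sumr -big_split /=.
by apply: eq_bigr => l _; rewrite !mxE amul_linr.
Qed.

Fact commutator_linl a x y z :
  commutator (a *: x + y) z = a *: commutator x z + commutator y z.
Proof.
by rewrite /commutator mmul_linl mmul_linr scalerBr opprD addrACA.
Qed.

Fact commutator_linr a x y z :
  commutator z (a *: x + y) = a *: commutator z x + commutator z y.
Proof.
by rewrite /commutator mmul_linl mmul_linr scalerBr opprD addrACA.
Qed.

HB.instance Definition _ :=
  isNalgebra.Build k gl commutator_linl commutator_linr.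

Definition sl : nalgType k := derived gl.

End Gl.
Arguments sl {k} n A.

HB.mixin Record Nalgebra_isMul (k : fieldType) A
    of GRing.ComUnitAlgebra k A & Nalgebra k A := {
  amulE : forall x y : A, amul x y = x * y }.

#[short(type="comUnitNalgType")]
HB.structure Definition ComUnitNalgebra (k : fieldType) :=
  {A of GRing.ComUnitAlgebra k A & Nalgebra k A & Nalgebra_isMul k A}.

Section Conjugation.
Variables (k : fieldType) (F : comUnitNalgType k) (n : nat).
Implicit Types (a b : 'M[F]_n) (x y : gl n F).

Lemma mmulE x y : mmul x y = x *m y.
Proof.
by apply/matrixP => i j; rewrite !mxE; apply: eq_bigr => l _; rewrite amulE.
Qed.

Definition conj_fun a x : gl n F := a *m x *m invmx a.

Definition mconj_unit a (ua : a \in unitmx) : aut (gl n F).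
Proof.
refine (@Aut k (gl n F) (conj_fun a) (conj_fun (invmx a)) _ _ _ _).
- by move=> x; rewrite /conj_fun invmxK !mulmxA mulVmx // mul1mx mulmxKV.
- by move=> x; rewrite /conj_fun invmxK !mulmxA mulmxV // mul1mx mulmxK.
- move=> c x y; rewrite /conj_fun mulmxDr mulmxDl; congr (_ + _).
  apply/matrixP => i j; rewrite !mxE scaler_sumr; apply: eq_bigr => l _.
  rewrite !mxE scalerAl; congr (_ * _); rewrite scaler_sumr.
  by apply: eq_bigr => p _; rewrite mxE scalerAr.
- move=> x y; rewrite /amul /= /commutator !mmulE /conj_fun.
  rewrite mulmxBr mulmxBl !mulmxA.
  by rewrite -!(mulmxA _ (invmx a) a) mulVmx // !mulmx1.
Defined.

(* Conjugation by [a]; the identity, by convention, if [a] is not invertible. *)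
Definition mconj a : aut (gl n F) :=
  match @idP (a \in unitmx) with
  | ReflectT ua => mconj_unit ua
  | ReflectF _ => aut_id _
  end.

Lemma mconjE a x : a \in unitmx -> mconj a x = a *m x *m invmx a.
Proof. by rewrite /mconj; case: {-}_ / idP => // ua _. Qed.

Definition d_mx (u : F) : 'M[F]_n := diag_mx (\row_i u ^+ i).

(* Rows and columns are numbered from 0. *)
Definition p_mx (u : F) : 'M[F]_n :=
  \matrix_(i, j) ((i == j.+1 :> nat)%:R + ((i == 0%N :> nat) && (j.+1 == n))%:R * u).

Lemma d_mx_unit u : u \is a GRing.unit -> d_mx u \in unitmx.
Proof.
move=> uu; rewrite unitmxE det_diag rpred_prod // => i _.
by rewrite mxE unitrX.
Qed.

Lemma p_mx_unit u : u \is a GRing.unit -> p_mx u \in unitmx.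
Proof.
move=> uu.
pose b : 'M[F]_n := \matrix_(i, j)
  ((j == i.+1 :> nat)%:R + ((j == 0%N :> nat) && (i.+1 == n))%:R * u^-1).
suff: p_mx u *m b = 1%:M by case/mulmx1_unit.
apply/matrixP => i j; rewrite !mxE.
have [i0|i0] := eqVneq (i : nat) 0%N.
  have ln : (n.-1 < n)%N by rewrite prednK // (leq_ltn_trans _ (ltn_ord i)).
  have nn : n.-1.+1 = n by rewrite prednK // (leq_ltn_trans _ (ltn_ord i)).
  rewrite (bigD1 (Ordinal ln)) //= big1 ?addr0 => [|l].
    rewrite !mxE i0 /= nn !eqxx /= add0r mul1r.
    rewrite (ltn_eqF (ltn_ord j)) add0r andbT -val_eqE /= i0 eq_sym.
    by case: eqP => _; rewrite ?mul1r ?mulrV // !mul0r mulr0.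
  rewrite -val_eqE /= !mxE i0 /= add0r => ll; case: eqP => [ln'|_].
    by move: ll; rewrite -(congr1 predn ln') /= eqxx.
  by rewrite !mul0r.
have pi : (i.-1 < n)%N by rewrite (leq_ltn_trans (leq_pred _) (ltn_ord i)).
have ii : i.-1.+1 = i by rewrite prednK // lt0n.
rewrite (bigD1 (Ordinal pi)) //= big1 ?addr0 => [|l].
  rewrite !mxE ii eqxx (negPf i0) /= mul0r addr0 mul1r (ltn_eqF (ltn_ord i)).
  by rewrite andbF mul0r addr0 -val_eqE eq_sym.
rewrite -val_eqE /= !mxE (negPf i0) /= mul0r addr0 => ll; case: eqP => [il|_].
  by case/negP: ll; apply/eqP; rewrite il.
by rewrite mul0r.
Qed.

Definition aut_D (u : F) : aut (sl n F) := aut_derived (mconj (d_mx u)).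
Definition aut_P (u : F) : aut (sl n F) := aut_derived (mconj (p_mx u)).

End Conjugation.
Arguments aut_D {k F} n u.
Arguments aut_P {k F} n u.

Section ScalarAlgebra.
Variable k : fieldType.

Fact regular_linl (a : k) (x y z : k^o) : (a *: x + y) * z = a *: (x * z) + y * z.
Proof. by rewrite mulrDl scalerAl. Qed.

Fact regular_linr (a : k) (x y z : k^o) : z * (a *: x + y) = a *: (z * x) + z * y.
Proof. by rewrite mulrDr scalerAr. Qed.

HB.instance Definition _ := isNalgebra.Build k k^o regular_linl regular_linr.
HB.instance Definition _ :=
  Nalgebra_isMul.Build k k^o (fun x y => erefl (x * y)).

End ScalarAlgebra.

Section LaurentRing.
Variable k : fieldType.

(* The ring of Laurent polynomials in one variable over [k]. *)
Definition R1 : Type := laurent int k^o.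
HB.instance Definition _ := Nalgebra.on R1.
Implicit Types f g h : R1.

Lemma R1_mulE f g j :
  (amul f g : R1) j = \sum_(i \in [set: int]) (f i : k) * g (j - i).
Proof. by []. Qed.

Definition lmon_fun (l i : int) : k^o := (i == l)%:R.

Fact lmon_fin l : lmon_fun l \in @fin_supp int k k^o.
Proof.
apply/fin_suppP; apply: (@sub_finite_set _ _ [set l]) => // i /=.
by apply: contra_notP => /eqP/negPf il; rewrite /lmon_fun il.
Qed.

(* The monomial [t^l]. *)
Definition lmon (l : int) : R1 := Laurent (lmon_fin l).

Lemma R1_lmonM l f j : (amul (lmon l) f : R1) j = f (j - l).
Proof.
rewrite -[LHS]/(conv (lmon l) f j) (@conv_widen _ _ _ [set l]).
  by rewrite fsbig_set1 amulE /= /lmon_fun eqxx mul1r.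
by move=> i /=; apply: contra_notP => /eqP/negPf il; rewrite /lmon_fun il.
Qed.

Fact R1_mulC : commutative (@amul k R1).
Proof.
move=> f g; apply/val_inj/funext => j.
rewrite -[LHS]/((amul f g : R1) j) -[RHS]/((amul g f : R1) j) !R1_mulE.
rewrite (reindex_fsbigT (fun i : int => j - i)) /=; last first.
  by exists (fun i => j - i) => i; rewrite subKr.
by apply: eq_fsbigr => i _; rewrite subKr mulrC.
Qed.

Lemma R1_mulf f g j : (amul f g : R1) j =
  \sum_(i <- fset_set [set i | f i <> 0]%classic) (f i : k) * g (j - i).
Proof.
rewrite -[LHS]/(conv f g j) (@conv_widen _ _ _ [set i | f i <> 0]) //.
by rewrite fsbig_finite //; apply: lcoef_fin.
Qed.

Fact R1_mulA : associative (@amul k R1).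
Proof.
move=> f g h; rewrite [amul (amul f g) h]R1_mulC [amul g h]R1_mulC.
apply/val_inj/funext => j.
rewrite -[LHS]/((amul f (amul h g : R1) : R1) j).
rewrite -[RHS]/((amul h (amul f g : R1) : R1) j) !R1_mulf.
under eq_bigr do rewrite R1_mulf mulr_sumr.
under [RHS]eq_bigr do rewrite R1_mulf mulr_sumr.
rewrite exchange_big /=; apply: eq_bigr => i _; apply: eq_bigr => l _.
by rewrite mulrCA addrAC.
Qed.

Fact R1_mul1 : left_id (lmon 0) (@amul k R1).
Proof.
move=> f; apply/val_inj/funext => j.
by rewrite -[LHS]/((amul (lmon 0) f : R1) j) R1_lmonM subr0.
Qed.

Fact R1_mulDl : left_distributive (@amul k R1) +%R.
Proof. by move=> f g h; rewrite amulDl. Qed.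

Fact R1_neq0 : lmon 0 != 0.
Proof.
apply/eqP => /(congr1 (fun f : R1 => f 0)) /eqP.
by rewrite /= /lmon_fun eqxx oner_eq0.
Qed.

HB.instance Definition _ := GRing.Zmodule_isComNzRing.Build R1
  R1_mulA R1_mulC R1_mul1 R1_mulDl R1_neq0.

Fact R1_scalerAl (a : k) f g : a *: (f * g) = (a *: f) * g.
Proof. by rewrite [RHS]amulZl. Qed.

HB.instance Definition _ := GRing.Lmodule_isLalgebra.Build k R1 R1_scalerAl.
HB.instance Definition _ := GRing.Lalgebra_isComAlgebra.Build k R1.

Definition R1_unit : {pred R1} := fun f => `[< exists g, g * f = 1 >].
Definition R1_inv f : R1 := if f \in R1_unit then xget 0 [set g | g * f = 1] else f.

Fact R1_mulV : {in R1_unit, left_inverse 1 R1_inv *%R}.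
Proof.
move=> f fu; have /asboolP ex := fu; rewrite /R1_inv fu.
exact: (xgetPex 0 ex).
Qed.

Fact R1_unitP f g : g * f = 1 -> f \in R1_unit.
Proof. by move=> gf; apply/asboolP; exists g. Qed.

Fact R1_inv_out : {in [predC R1_unit], R1_inv =1 id}.
Proof. by move=> f /negPf fu; rewrite /R1_inv fu. Qed.

HB.instance Definition _ :=
  GRing.ComNzRing_hasMulInverse.Build R1 R1_mulV R1_unitP R1_inv_out.

HB.instance Definition _ :=
  Nalgebra_isMul.Build k R1 (fun f g => erefl (f * g)).

Definition t1 : R1 := lmon 1.

Lemma t1_unit : t1 \is a GRing.unit.
Proof.
apply/asboolP; exists (lmon (-1)); apply/val_inj/funext => j.
rewrite -[LHS]/((amul (lmon (-1)) t1 : R1) j) R1_lmonM /= /lmon_fun.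
rewrite -[RHS]/(lmon_fun 0 j) /lmon_fun opprK.
by rewrite -[X in _ + _ == X]add0r (inj_eq (addIr 1)).
Qed.

End LaurentRing.

Variant qt_gen := QX1 | QX1V | QX2 | QX2V.

Section QuantumTorus.
Variables (k : fieldType) (theta : k).
Local Notation T := (term k (option qt_gen)).
Local Notation one := (TGen None : T).
Local Notation "'x1" := (TGen (Some QX1) : T).
Local Notation "'x1V" := (TGen (Some QX1V) : T).
Local Notation "'x2" := (TGen (Some QX2) : T).
Local Notation "'x2V" := (TGen (Some QX2V) : T).

Inductive qt_rel : T -> T -> Prop :=
  | qt_x1V : qt_rel (TMul 'x1 'x1V) one
  | qt_Vx1 : qt_rel (TMul 'x1V 'x1) one
  | qt_x2V : qt_rel (TMul 'x2 'x2V) one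
  | qt_Vx2 : qt_rel (TMul 'x2V 'x2) one
  | qt_comm : qt_rel (TMul 'x1 'x2) (TScale theta (TMul 'x2 'x1)).

Definition qtorus : nalgType k := assoc_pres qt_rel.

End QuantumTorus.

(* A representative of [iota_m (q mod m)], where [iota_m] maps the class of [g * r],
   for [g] the gcd of [g * r] and [m], to that of [g * s] with [r * s = 1] modulo
   [m / g]; see [iota_rep_spec] and [iota_rep_uniq]. *)
Definition iota_rep (m : nat) (q : int) : int :=
  let g := gcdn `|q| m in let r := (q %/ g)%Z in
  g%:Z * (egcdz r (m %/ g)%N).1.

Section IotaRep.
Variables (m : nat) (q r : int).
Hypothesis m_gt0 : (0 < m)%N.
Local Notation g := (gcdn `|q| m).
Local Notation m' := (m %/ g)%N.
Hypothesis qE : q = g%:Z * r.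

Let g_neq0 : g%:Z != 0.
Proof. by rewrite -lt0n gcdn_gt0 m_gt0 orbT. Qed.

Let mE : m = g%:Z * m' :> int.
Proof. by rewrite -PoszM mulnC divnK ?dvdn_gcdr. Qed.

Let rE : (q %/ g)%Z = r.
Proof. by rewrite [X in (X %/ _)%Z]qE mulKz. Qed.

Lemma iota_rep_spec :
  exists2 s : int, (r * s = 1 %[mod m'])%Z & iota_rep m q = g%:Z * s.
Proof.
exists (egcdz r m').1; last by rewrite /iota_rep rE.
have : gcdz r m' = 1.
  apply: (mulfI g_neq0); rewrite mulr1; transitivity (gcdz (g%:Z * r) (g%:Z * m')).
    by rewrite -mulz_gcdr.
  by rewrite -qE -mE.
case: egcdzP => u v <- _ /= uv1.
by rewrite -uv1 mulrC addrC modzMDl.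
Qed.

Lemma iota_rep_uniq (s : int) : (r * s = 1 %[mod m'])%Z ->
  (iota_rep m q = g%:Z * s %[mod m])%Z.
Proof.
have [u ru ->] := iota_rep_spec => rs.
apply/eqP; rewrite eqz_mod_dvd mE -mulrBr dvdz_mul2l ?g_neq0 //=.
rewrite -eqz_mod_dvd; apply/eqP.
have -> : (u = u * (r * s) %[mod m'])%Z.
  by rewrite -[RHS]modzMmr rs modzMmr mulr1.
by rewrite mulrA [u * r]mulrC -modzMml ru modzMml mul1r.
Qed.

End IotaRep.

(* Main.v *)
Require Import Defs.
From HB Require Import structures.
From mathcomp Require Import all_boot all_order perm all_algebra.
From mathcomp Require Import boolp classical_sets cardinality fsbigop functions.
From mathcomp Require Import ring zify.

Set Implicit Arguments.
Unset Strict Implicit.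
Unset Printing Implicit Defensive.

Import GRing.Theory Num.Theory.
Local Open Scope ring_scope.

(* All algebras of the statement have bases in which the bracket is
   [u_a, u_b] = (gamma(a, b) - gamma(b, a)) u_(a + b) for a bimultiplicative
   gamma. Let N = ell + 1, let z = zeta_N, and let d = diag(z^i) and s be the
   inverse of p_N(t), acting on functions of an integer p by z^p and by the
   shift p -> p + 1. The d^i s^j with (i, j) <> (0, 0) modulo N form a basis of
   sl_N(R_1), and conjugation by p_N(t) multiplies d^i s^j by z^-i, so that a
   loop algebra has the basis d^i s^j w^l with z^(-iq) = zeta_m^l. In
   sl_N(k), s^N = 1 and the second loop variable restores the exponent j. The
   admissible (i, j, l) form a group isomorphic to Z/g x Z x Z with
   g = gcd(q, N), which also grades the g x g matrices over the quantum torus.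

   For the Kac-Moody algebra, e_i, f_i and h act on functions on the integers
   by N-periodic shifts and by diagonal operators of linear growth. The
   principal grading shows that the radical acts by zero: an ideal containing
   an element that acts nontrivially contains one of degree 0. Conversely, let
   x have positive degree and act by zero, and let y have the opposite degree.
   By induction on the degree, [x, [f_i, y']] = [[x, f_i], y'] + [f_i, [x, y']]
   vanishes, as [x, y'] has degree 1, where the action is faithful. Thus the
   elements acting by zero are central modulo the radical, and the quotient of
   g' by its center is the span of the d^i s^j, on which rho acts by z^-i. *)

(** * Bases with prescribed structure constants *)

(** No map between the compared algebras is written by hand: each side gets a basis over the same
    index group ['I_g.+1 * (int * int)], with the constants [heis_com] pulled back along
    [torus_phi]. The periods are arbitrary, and the reindexing has to absorb them. The twist of the
    quantum parameter comes from the eigenvalue condition. With N = d g, q = g r and period d m', it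
    reads l = - m' b with b = i r modulo d. Solving for i uses the inverse i0 of r modulo d: i = d a
    + i0 b, with a modulo g. Hence theta = z^(g i0), and g i0 represents iota(q). On the Kac-Moody
    side the Serre relations are avoided: the radical is defined by ideals, and only its image and
    the center modulo it have to be known. The module consists of functions on all integers rather
    than on residues, since the shift must have infinite order and since a Cartan element on which
    the sum of the simple roots is nonzero acts by a function that is not N-periodic. *)

Section AmulSum.
Variables (k : fieldType) (S : nalgType k) (J : Type) (r : seq J) (Q : pred J).

Lemma amul_suml (F : J -> S) y :
  amul (\sum_(j <- r | Q j) F j) y = \sum_(j <- r | Q j) amul (F j) y.
Proof. by apply: (big_morph (fun x => amul x y)) => [u v|]; rewrite ?amulDl ?amul0l. Qed.

Lemma amul_sumr (F : J -> S) y :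
  amul y (\sum_(j <- r | Q j) F j) = \sum_(j <- r | Q j) amul y (F j).
Proof. by apply: (big_morph (amul y)) => [u v|]; rewrite ?amulDr ?amul0r. Qed.

End AmulSum.

Section LinComb.
Variables (k : fieldType) (I : eqType).
Implicit Types (s : seq (k * I)) (i : I).

(** Combinations are lists of weighted indices with repetitions allowed, since the index sets are
    infinite; sums and products become list operations, and only [coef] collects the repetitions. *)
Definition lincomb (V : lmodType k) (b : I -> V) s : V :=
  \sum_(p <- s) p.1 *: b p.2.

Definition coef s i : k := \sum_(p <- s | p.2 == i) p.1.

Lemma lincomb_coef (V : lmodType k) (b : I -> V) s :
  lincomb b s = \sum_(i <- undup [seq p.2 | p <- s]) coef s i *: b i.
Proof.
under eq_bigr do rewrite /coef scaler_suml big_mkcond.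
rewrite exchange_big /= /lincomb; apply: eq_big_seq => p ps.
rewrite (bigD1_seq p.2) ?undup_uniq ?mem_undup ?map_f //= eqxx.
by rewrite big1 ?addr0 // => i /negPf ip; rewrite eq_sym ip.
Qed.

Lemma coef_uniq s p : uniq [seq p.2 | p <- s] -> p \in s -> coef s p.2 = p.1.
Proof.
move=> us ps; rewrite /coef -big_filter.
have -> : [seq q <- s | q.2 == p.2] = [:: p].
  elim: s us ps => //= q s ih /andP[qs us].
  rewrite inE => /orP[/eqP ->|ps].
    rewrite eqxx; congr (_ :: _); apply/eqP; rewrite -size_eq0 size_filter.
    rewrite eqn0Ngt -has_count; apply/hasPn => r rs.
    by apply: contra qs => /eqP <-; apply: map_f.
  by case: eqP => [e|_]; [rewrite e map_f in qs | exact: ih].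
by rewrite big_seq1.
Qed.

Lemma lincomb_cat (V : lmodType k) (b : I -> V) s t :
  lincomb b (s ++ t) = lincomb b s + lincomb b t.
Proof. by rewrite /lincomb big_cat. Qed.

Definition lscale a s := [seq (a * p.1, p.2) | p <- s].

Lemma lincomb_scale (V : lmodType k) (b : I -> V) a s :
  lincomb b (lscale a s) = a *: lincomb b s.
Proof.
rewrite /lincomb big_map scaler_sumr.
by apply: eq_bigr => p _; rewrite scalerA.
Qed.

Lemma lincomb_sum (V : lmodType k) (b : I -> V) (J : Type) (r : seq J) (Q : pred J)
    (x : J -> V) :
  (forall j, Q j -> exists s, x j = lincomb b s) ->
  exists s, \sum_(j <- r | Q j) x j = lincomb b s.
Proof.
move=> h; elim/big_rec: _ => [|j y Qj [s ->]].
  by exists [::]; rewrite /lincomb big_nil.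
by have [t ->] := h j Qj; exists (t ++ s); rewrite lincomb_cat.
Qed.

Lemma lincomb1 (V : lmodType k) (b : I -> V) a i :
  lincomb b [:: (a, i)] = a *: b i.
Proof. by rewrite /lincomb big_seq1. Qed.

Lemma linear_lincomb (V W : lmodType k) (f : {linear V -> W}) (b : I -> V) s :
  f (lincomb b s) = lincomb (fun i => f (b i)) s.
Proof. by rewrite linear_sum; apply: eq_bigr => p _; rewrite linearZ. Qed.

(* The family vanishes outside [P] and is a basis when restricted to [P]. *)
Definition is_basis (P : pred I) (V : lmodType k) (b : I -> V) : Prop :=
  [/\ forall i, ~~ P i -> b i = 0,
      forall x, exists s, x = lincomb b s
    & forall s, lincomb b s = 0 -> forall i, P i -> coef s i = 0].

Section Basis.
Variables (P : pred I) (V : lmodType k) (b : I -> V).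
Hypothesis bP : is_basis P b.

Lemma basis_out i : ~~ P i -> b i = 0. Proof. by case: bP => + _ _; exact. Qed.

Lemma basis_lincomb0 (W : lmodType k) (b' : I -> W) s :
  (forall i, ~~ P i -> b' i = 0) -> lincomb b s = 0 -> lincomb b' s = 0.
Proof.
case: bP => _ _ bfree b'0 /bfree s0; rewrite lincomb_coef big1 // => i _.
by have [/s0 ->|/b'0 ->] := boolP (P i); rewrite ?scale0r ?scaler0.
Qed.

Lemma basis_neq0 i : P i -> b i <> 0.
Proof.
case: bP => _ _ bfree Pi bi0; have := bfree [:: (1, i)].
rewrite lincomb1 bi0 scaler0 => /(_ erefl i Pi).
rewrite /coef big_mkcond big_seq1 eqxx => /eqP.
by rewrite oner_eq0.
Qed.

Lemma basis_normal x : exists s,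
  [/\ x = lincomb b s, uniq [seq p.2 | p <- s] &
      all (fun p => P p.2 && (p.1 != 0)) s].
Proof.
case: bP => bout bspan bfree; have [s ->] := bspan x.
exists [seq (coef s i, i) | i <- undup [seq p.2 | p <- s] & P i && (coef s i != 0)].
split.
- rewrite lincomb_coef /lincomb big_map big_filter /= [RHS]big_mkcond.
  apply: eq_bigr => i _; case: (boolP (P i)) => [Pi|/bout ->] /=.
    by case: eqP => [->|]; rewrite ?scale0r.
  by rewrite scaler0.
- by rewrite -map_comp map_id filter_uniq ?undup_uniq.
- by apply/allP => _ /mapP[i + ->] /=; rewrite mem_filter => /andP[].
Qed.

(** The combination with weights multiplied by [chi i - a] vanishes, so freeness excludes every term
    whose eigenvalue differs from [a]. Eigenspaces are thus spanned by basis vectors, which is what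
    loop algebras need. *)
Lemma basis_eigen (f : {linear V -> V}) (chi : I -> k) (a : k) s :
  (forall i, P i -> f (b i) = chi i *: b i) ->
  uniq [seq p.2 | p <- s] -> all (fun p => P p.2 && (p.1 != 0)) s ->
  f (lincomb b s) = a *: lincomb b s -> all (fun p => chi p.2 == a) s.
Proof.
move=> fb us /allP Ps fx; apply/allP => p ps.
have /andP[Pp p0] := Ps p ps.
pose t := [seq (p.1 * (chi p.2 - a), p.2) | p <- s].
have t0 : lincomb b t = 0.
  transitivity (f (lincomb b s) - a *: lincomb b s); last by rewrite fx subrr.
  rewrite linear_lincomb /lincomb big_map scaler_sumr -sumrB.
  apply: eq_big_seq => q /Ps /andP[Pq _] /=.
  by rewrite fb // !scalerA -scalerBl mulrBr [a * _]mulrC.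
have ut : uniq [seq p.2 | p <- t] by rewrite -map_comp.
have pt : (p.1 * (chi p.2 - a), p.2) \in t by apply/mapP; exists p.
have [_ _ /(_ t t0 p.2 Pp)] := bP.
rewrite (coef_uniq ut pt) => /eqP.
by rewrite mulf_eq0 (negPf p0) subr_eq0.
Qed.

End Basis.
End LinComb.

Lemma basis_reindex (k : fieldType) (I J : eqType) (V : lmodType k)
    (P : pred I) (b : I -> V) (PJ : pred J) (phi : J -> I) :
  is_basis P b -> (forall j, PJ j = P (phi j)) ->
  (forall j j', PJ j -> phi j = phi j' -> j = j') ->
  (forall i, P i -> exists j, phi j = i) ->
  is_basis PJ (b \o phi).
Proof.
move=> [bout bspan bfree] PJE phi_inj phi_onto; split.
- by move=> j; rewrite PJE => /bout.
- move=> x; have [s ->] := bspan x; apply: lincomb_sum => -[a i] _ /=.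
  have [/phi_onto[j <-]|/bout ->] := boolP (P i).
    by exists [:: (a, j)]; rewrite lincomb1.
  by exists [::]; rewrite scaler0 /lincomb big_nil.
- move=> s s0 j Pj; pose t := [seq (p.1, phi p.2) | p <- s].
  have t0 : lincomb b t = 0 by rewrite -s0 /lincomb big_map.
  rewrite -(bfree t t0 (phi j)) -?PJE // /coef big_map /=.
  apply: eq_bigl => p; apply/eqP/eqP => [->//|e].
  by apply/esym/phi_inj.
Qed.

(** By linearity, single-valuedness and injectivity reduce to the fibres over 0, so no coordinates
    have to be chosen. The clause [R x (f x)] is kept to read off the values of [f] on a basis. *)
Lemma graph_iso (k : fieldType) (S T : nalgType k) (R : S -> T -> Prop) :
  (forall x, exists y, R x y) -> (forall y, exists x, R x y) ->
  (forall a x y x' y', R x y -> R x' y' -> R (a *: x + x') (a *: y + y')) ->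
  (forall x y x' y', R x y -> R x' y' -> R (amul x x') (amul y y')) ->
  (forall y, R 0 y -> y = 0) -> (forall x, R x 0 -> x = 0) ->
  exists f : {linear S -> T},
    [/\ bijective f, forall x y, f (amul x y) = amul (f x) (f y) &
        forall x, R x (f x)].
Proof.
move=> tot sur lin mul R0l R0r.
have Rsub x y x' y' : R x y -> R x' y' -> R (x - x') (y - y').
  by move=> h h'; rewrite addrC -scaleN1r [y - y']addrC -[- y']scaleN1r; apply: lin.
have fun_ x y y' : R x y -> R x y' -> y = y'.
  by move=> h h'; apply/subr0_eq/R0l; rewrite -(subrr x); apply: Rsub.
have inj_ x x' y : R x y -> R x' y -> x = x'.
  by move=> h h'; apply/subr0_eq/R0r; rewrite -(subrr y); apply: Rsub.
have [f fR] := choice tot; have [g gR] := choice sur.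
have flin : linear f by move=> a x y; apply: fun_ (fR _) (lin _ _ _ _ _ _ _).
pose F : {linear S -> T} := HB.pack f (GRing.isLinear.Build k S T *:%R f flin).
exists F; split=> //.
- by exists g => x; [exact: inj_ (gR _) (fR _) | exact: fun_ (fR _) (gR _)].
- by move=> x y; apply: fun_ (fR _) (mul _ _ _ _ _ _).
Qed.

Lemma aut_of_linear (k : fieldType) (S : nalgType k) (f : {linear S -> S}) :
  bijective f -> (forall x y, f (amul x y) = amul (f x) (f y)) ->
  exists t : aut S, forall x, t x = f x.
Proof.
move=> [g fK gK] fM.
by exists (Aut fK gK (fun a => linearP f a) fM).
Qed.

Section GradedBasis.
Variables (k : fieldType) (I : eqType) (P : pred I).
Variables (op : I -> I -> I) (c : I -> I -> k).

(** [op i j] may leave [P]; the product is then 0 because [b] vanishes there. So [op] can be a total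
    group law although some indices are removed. *)
Definition graded_basis (S : nalgType k) (b : I -> S) : Prop :=
  is_basis P b /\
  forall i j, P i -> P j -> amul (b i) (b j) = c i j *: b (op i j).

(** Two elements are related when one list of weights represents both. Products of related elements
    are related because the product list is built from [op] and [c] alone. *)
Lemma graded_basis_iso (S T : nalgType k) (b : I -> S) (b' : I -> T) :
  graded_basis b -> graded_basis b' ->
  exists f : {linear S -> T},
    [/\ bijective f, forall x y, f (amul x y) = amul (f x) (f y) &
        forall i, f (b i) = b' i].
Proof.
move=> [bP bM] [bP' bM'].
pose R x y := exists s, x = lincomb b s /\ y = lincomb b' s.
have R0l y : R 0 y -> y = 0.
  by move=> [s [/esym + ->]]; apply: (basis_lincomb0 bP); exact: basis_out.
have R0r x : R x 0 -> x = 0.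
  by move=> [s [-> /esym]]; apply: (basis_lincomb0 bP'); exact: basis_out.
have [] := @graph_iso k S T R; rewrite //.
- by case: bP => _ + _ => h x; have [s ->] := h x; exists (lincomb b' s), s.
- by case: bP' => _ + _ => h x; have [s ->] := h x; exists (lincomb b s), s.
- move=> a x y x' y' [s [-> ->]] [t [-> ->]]; exists (lscale a s ++ t).
  by rewrite !lincomb_cat !lincomb_scale.
- move=> x y x' y' [s [-> ->]] [t [-> ->]].
  (* The weight is set to 0 when an index lies outside [P], where [c] is arbitrary. *)
  have mulE (U : nalgType k) (d : I -> U) : graded_basis d ->
    amul (lincomb d s) (lincomb d t) =
    lincomb d (flatten [seq [seq (if P p.2 && P q.2 then p.1 * q.1 * c p.2 q.2 else 0,
                      op p.2 q.2) | q <- t] | p <- s]).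
    move=> [dP dM]; rewrite /lincomb big_flatten big_map.
    rewrite amul_suml; apply: eq_bigr => p _; rewrite amul_sumr big_map.
    apply: eq_bigr => q _ /=; rewrite amulZl amulZr.
    have [Pp|/(basis_out dP) ->] := boolP (P p.2); last first.
      by rewrite amul0l !scaler0 scale0r.
    have [Pq|/(basis_out dP) ->] := boolP (P q.2); last first.
      by rewrite amul0r !scaler0 scale0r.
    by rewrite dM // !scalerA.
  eexists; split; exact: mulE.
- move=> f [fbij fM fR]; exists f; split=> // i.
  have [s [bi ->]] := fR (b i); apply/esym/subr0_eq.
  rewrite -[b' i]scale1r -lincomb1 -scaleN1r -lincomb_scale -lincomb_cat.
  apply: (basis_lincomb0 bP); first exact: basis_out.
  by rewrite lincomb_cat lincomb_scale lincomb1 -bi scale1r scaleN1r subrr.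
Qed.

Lemma graded_basis_isoalg (S T : nalgType k) (b : I -> S) (b' : I -> T) :
  graded_basis b -> graded_basis b' -> S ≃ T.
Proof.
by move=> h h'; have [f [fb fM _]] := graded_basis_iso h h'; exists f.
Qed.

(** Rescaling by a multiplicative [chi] gives a second basis with the same constants, and
    [graded_basis_iso] compares the two. *)
Lemma graded_basis_aut (S : nalgType k) (b : I -> S) (chi : I -> k) :
  graded_basis b -> (forall i, chi i != 0) ->
  (forall i j, chi (op i j) = chi i * chi j) ->
  exists t : aut S, forall i, t (b i) = chi i *: b i.
Proof.
move=> bb chi0 chiM; have [[bout bspan bfree] bM] := bb.
have bb' : graded_basis (fun i => chi i *: b i).
  split; first split.
  - by move=> i /bout ->; rewrite scaler0.
  - move=> x; have [s ->] := bspan x; apply: lincomb_sum => p _.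
    by exists [:: (p.1 / chi p.2, p.2)]; rewrite lincomb1 scalerA divfK.
  - move=> s s0 i Pi; pose t := [seq (p.1 * chi p.2, p.2) | p <- s].
    have t0 : lincomb b t = 0.
      by rewrite -s0 /lincomb big_map; under [RHS]eq_bigr do rewrite scalerA.
    apply: (mulIf (chi0 i)); rewrite mul0r -(bfree t t0 i Pi) /coef big_map /=.
    by rewrite mulr_suml; apply: eq_bigr => p /eqP ->.
  - move=> i j Pi Pj; rewrite amulZl amulZr bM // !scalerA chiM.
    by rewrite mulrC.
have [f [fbij fM fb]] := graded_basis_iso bb bb'.
have [t tE] := aut_of_linear fbij fM.
by exists t => i; rewrite tE fb.
Qed.

End GradedBasis.

Lemma graded_basis_reindex (k : fieldType) (I J : eqType) (S : nalgType k)
    (P : pred I) (op : I -> I -> I) (c : I -> I -> k) (b : I -> S)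
    (PJ : pred J) (opJ : J -> J -> J) (phi : J -> I) :
  graded_basis P op c b -> (forall j, PJ j = P (phi j)) ->
  (forall j j', PJ j -> phi j = phi j' -> j = j') ->
  (forall i, P i -> exists j, phi j = i) ->
  (forall j j', phi (opJ j j') = op (phi j) (phi j')) ->
  graded_basis PJ opJ (fun j j' => c (phi j) (phi j')) (b \o phi).
Proof.
move=> [bP bM] PJE inj onto phiM; split; first exact: basis_reindex bP PJE inj onto.
by move=> j j'; rewrite !PJE => Pj Pj'; rewrite /= bM // phiM.
Qed.

Lemma graded_basis_eq (k : fieldType) (I : eqType) (S : nalgType k)
    (P P' : pred I) (op : I -> I -> I) (c c' : I -> I -> k) (b : I -> S) :
  graded_basis P op c b -> P =1 P' -> (forall i j, c i j = c' i j) ->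
  graded_basis P' op c' b.
Proof.
move=> [[bout bspan bfree] bM] PP' cc'; split; first split.
- by move=> i; rewrite -PP' => /bout.
- exact: bspan.
- by move=> s /bfree h i; rewrite -PP'; exact: h.
- by move=> i j; rewrite -!PP' -cc'; exact: bM.
Qed.

(** A bracket of basis vectors is a multiple of a single basis vector, so the derived algebra is
    spanned by those reached with a nonzero constant; the hypotheses say that their indices are
    those in [P]. *)
Lemma derived_basis (k : fieldType) (I : eqType) (S : nalgType k)
    (P : pred I) (op : I -> I -> I) (c : I -> I -> k) (b : I -> S) :
  graded_basis predT op c b ->
  (forall i j, c i j != 0 -> P (op i j)) ->
  (forall i, P i -> exists i1 i2, c i1 i2 != 0 /\ op i1 i2 = i) ->
  exists b' : I -> derived S, graded_basis P op c b' /\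
    forall i, P i -> val (b' i) = b i.
Proof.
move=> [bP bM] cP Pc; have [_ bspan bfree] := bP.
pose b' i : derived S := if P i then insubd (0 : derived S) (b i) else 0.
have b'E i : P i -> derived_val (b' i) = b i.
  move=> Pi; rewrite /b' Pi -[LHS]/(val _) insubdK //; have [i1 [i2 [c0 ei]]] := Pc i Pi.
  have -> : b i = (c i1 i2)^-1 *: amul (b i1) (b i2).
    by rewrite bM // scalerA mulVf // scale1r ei.
  by apply: rpredZ; apply: amul_derived.
exists b'; split=> //; split; first split.
- by move=> i /negPf nP; rewrite /b' nP.
- move=> x; have /derivedP[r xE] := valP x.
  have h p : exists s, amul p.1 p.2 = lincomb b s /\ all (fun q => P q.2) s.
    have [s1 ->] := bspan p.1; have [s2 ->] := bspan p.2.
    pose t := [seq (p.1.1 * p.2.1 * c p.1.2 p.2.2, op p.1.2 p.2.2)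
               | p <- [seq (p, q) | p <- s1, q <- s2]].
    have -> : amul (lincomb b s1) (lincomb b s2) = lincomb b t.
      rewrite /lincomb big_map big_allpairs_dep /=.
      elim: s1 {t} => [|p1 s1 ih]; rewrite ?big_nil ?amul0l // !big_cons amulDl ih.
      congr (_ + _); elim: s2 {ih} => [|p2 s2 ih]; rewrite ?big_nil ?amul0r //.
      rewrite !big_cons amulDr ih; congr (_ + _).
      by rewrite amulZl amulZr bM // !scalerA.
    (* The terms dropped have weight 0, by the contrapositive of [cP]. *)
    exists [seq q <- t | P q.2]; split; last exact: filter_all.
    rewrite /lincomb big_filter [RHS]big_mkcond /=; apply: eq_big_seq.
    move=> _ /mapP[q _ ->] /=; have [/cP ->//|] := boolP (c q.1.2 q.2.2 != 0).
    by rewrite negbK => /eqP ->; rewrite mulr0 scale0r if_same.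
  have [s [sE /allP sP]] : exists s, val x = lincomb b s /\ all (fun q => P q.2) s.
    rewrite xE; elim: r {xE} => [|p r [s [ih sP]]].
      by exists [::]; rewrite /lincomb !big_nil.
    have [t [tE tP]] := h p; exists (t ++ s).
    by rewrite big_cons tE ih lincomb_cat all_cat tP sP.
  exists s; apply: val_inj; rewrite sE linear_sum /=.
  by apply: eq_big_seq => p /sP Pp; rewrite b'E.
- move=> s s0 i Pi; pose t := [seq p <- s | P p.2].
  have t0 : lincomb b t = 0.
    rewrite -[RHS](congr1 val s0) linear_sum /= /lincomb big_filter big_mkcond /=.
    apply: eq_bigr => p _.
    by case: ifP => [/b'E ->//|nP]; rewrite /b' nP /= scaler0.
  rewrite -(bfree t t0 i isT) /coef big_filter_cond; apply: eq_bigl => p.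
  by case: eqP => [->|]; rewrite ?Pi ?andbF.
- move=> i j Pi Pj; apply: val_inj.
  rewrite -[LHS]/(amul (derived_val (b' i)) (derived_val (b' j))) /=.
  rewrite (b'E i) // (b'E j) // bM //.
  have [->|/cP Pij] := eqVneq (c i j) 0; first by rewrite !scale0r.
  by rewrite b'E.
Qed.

(** * Loop algebras of algebras with an eigenbasis *)

Section Monomials.
Variables (G : zmodType) (k : fieldType) (S : nalgType k).
Implicit Types (j l : G) (x y : S).

Definition lmono_fun j x l : S := if l == j then x else 0.

Fact lmono_fin j x : lmono_fun j x \in @fin_supp G k S.
Proof.
apply/fin_suppP; apply: (@sub_finite_set _ _ [set j]%classic) => // i /=.
by apply: contra_notP => /eqP/negPf ij; rewrite /lmono_fun ij.
Qed.

Definition lmono j x : laurent G S := Laurent (lmono_fin j x).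

Lemma lmonoE j x l : lmono j x l = if l == j then x else 0. Proof. by []. Qed.

Lemma lmonoM i j x y : amul (lmono i x) (lmono j y) = lmono (i + j) (amul x y).
Proof.
apply/val_inj/funext => l; rewrite -[LHS]/(conv (lmono i x) (lmono j y) l).
rewrite (@conv_widen _ _ _ [set i]%classic); last first.
  by move=> h /=; apply: contra_notP => /eqP/negPf hi; rewrite /lmono_fun hi.
rewrite fsbig_set1 !lmonoE eqxx /= /lmono_fun subr_eq addrC.
by case: eqP => // _; rewrite amul0r.
Qed.

Lemma lcoef_sum (J : Type) (r : seq J) (Q : pred J) (F : J -> laurent G S) l :
  (\sum_(j <- r | Q j) F j) l = \sum_(j <- r | Q j) F j l.
Proof. exact: (big_morph (fun f : laurent G S => f l)). Qed.

Lemma laurent_monoE (f : laurent G S) : exists r : seq G, uniq r /\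
  f = \sum_(j <- r) lmono j (f j).
Proof.
exists (finmap.enum_fset (fset_set [set i | f i <> 0]%classic)).
split; first exact: finmap.fset_uniq.
apply/val_inj/funext => l; rewrite -[RHS]/((\sum_(_ <- _) _ : laurent G S) l).
rewrite lcoef_sum; have [fl|/eqP fl] := eqVneq (f l) 0.
  by rewrite big1 // => j _; rewrite lmonoE; case: eqP => // <-.
rewrite (bigD1_seq l) ?finmap.fset_uniq ?in_fset_set ?mem_set //=; last exact: lcoef_fin.
rewrite /lmono_fun eqxx big1 ?addr0 // => j jl.
by rewrite eq_sym (negPf jl).
Qed.

End Monomials.

Section GsubBasis.
Variables (G : zmodType) (k : fieldType) (S : nalgType k) (W : grading G S).
Variables (I : eqType) (P : pred I) (op : I -> I -> I) (c : I -> I -> k).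
Variables (b : I -> S) (Q : I -> G -> bool).
Hypothesis bb : graded_basis P op c b.
Hypothesis WQ : forall i j, P i -> Q i j -> W j (b i).
Hypothesis QW : forall j x, W j x ->
  exists s, x = lincomb b s /\ all (fun p => P p.2 && Q p.2 j) s.
Hypothesis Qop : forall i i' j j', Q i j -> Q i' j' -> Q (op i i') (j + j').

(** The vectors [b i] with [Q i j] span the component [W j], so their products with the monomial of
    degree [j] form a basis; the degrees do not enter the constants. *)
Lemma gsub_basis : exists b' : I * G -> gsub W,
  graded_basis (fun p => P p.1 && Q p.1 p.2)
    (fun p q => (op p.1 q.1, p.2 + q.2)) (fun p q => c p.1 q.1) b'.
Proof.
have [[bout bspan bfree] bM] := bb.
pose P' (p : I * G) := P p.1 && Q p.1 p.2.
pose b' p : gsub W := if P' p then insubd (0 : gsub W) (lmono p.2 (b p.1)) else 0.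
have b'E p : P' p -> gsub_val (b' p) = lmono p.2 (b p.1).
  move=> P'p; rewrite /b' P'p -[LHS]/(val _) insubdK //; apply/gsubP => j.
  rewrite lmonoE; case: eqP => [->|_]; last exact: gr0.
  by have /andP[] := P'p; apply: WQ.
have b'_sum s : gsub_val (lincomb b' s) = \sum_(p <- s) p.1 *: gsub_val (b' p.2).
  by rewrite -[LHS]/(val _) linear_sum.
exists b'; split; first split.
- by move=> p /negPf nP; rewrite /b' /P' nP.
- move=> f; have [r [ur fE]] := laurent_monoE (val f).
  suff [s sE] : exists s, \sum_(j <- r) lmono j (val f j) = val (lincomb b' s).
    by exists s; apply: val_inj; rewrite -sE.
  have fW j : W j (val f j) by have /gsubP := valP f; exact.
  elim: r {fE ur} => [|j r [s ih]].
    by exists [::]; rewrite /lincomb !big_nil.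
  have [t [tE /allP tP]] := QW (fW j).
  exists ([seq (p.1, (p.2, j)) | p <- t] ++ s).
  rewrite lincomb_cat big_cons ih linearD /=; congr (_ + _).
  rewrite b'_sum big_map tE /lincomb /=.
  transitivity (\sum_(p <- t) p.1 *: lmono j (b p.2)); last first.
    by apply: eq_big_seq => p /tP Pp; rewrite b'E.
  apply/val_inj/funext => l; rewrite -[RHS]/((\sum_(_ <- _) _ : laurent G S) l).
  rewrite lcoef_sum /= /lmono_fun; case: eqP => [->|ljN].
    by apply: eq_bigr => p _; rewrite -[RHS]/(_ *: (lmono j (b p.2)) j) lmonoE eqxx.
  by rewrite big1 // => p _; rewrite -[LHS]/(_ *: (lmono j (b p.2)) l) lmonoE;
    case: eqP => //; rewrite scaler0.
- move=> s s0 [i j] /= /andP[Pi Qij].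
  pose t := [seq (p.1, p.2.1) | p <- s & (p.2.2 == j) && P' p.2].
  have t0 : lincomb b t = 0.
    transitivity ((val (lincomb b' s) : laurent G S) j); last by rewrite s0.
    rewrite /= b'_sum lcoef_sum /lincomb big_map big_filter big_mkcond.
    apply: eq_bigr => p _ /=.
    have [/b'E ->|/negPf nP] := boolP (P' p.2); last first.
      by rewrite andbF /b' nP /= scaler0.
    rewrite andbT -[RHS]/(p.1 *: lmono p.2.2 (b p.2.1) j) lmonoE eq_sym.
    by case: eqP; rewrite ?scaler0.
  rewrite -(bfree t t0 i Pi) /coef big_map big_filter_cond /=.
  apply: eq_bigl => -[a [i' j']] /=; rewrite xpair_eqE.
  case: eqP => [->|]; rewrite ?andbF //; case: eqP => [->|] //.
  by rewrite /P' /= Pi Qij.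
- move=> [i j] [i' j'] /= Pp Pp'; apply: val_inj.
  have /andP[Pi Qij] := Pp; have /andP[Pi' Qij'] := Pp'.
  rewrite -[LHS]/(amul (gsub_val (b' (i, j))) (gsub_val (b' (i', j')))) /=.
  rewrite (b'E (i, j)) // (b'E (i', j')) // lmonoM /= bM //.
  have [Pii|nP] := boolP (P (op i i')); last first.
    rewrite /b' /P' /= (negPf nP) (bout _ nP) /= scaler0 scaler0.
    by apply/val_inj/funext => l /=; rewrite /lmono_fun if_same.
  rewrite b'E /=; last by rewrite /P' /= Pii Qop.
  apply/val_inj/funext => l /=; rewrite /lmono_fun.
  rewrite -[RHS]/(_ *: lmono (j + j') (b (op i i')) l) lmonoE.
  by case: eqP; rewrite ?scaler0.
Qed.

End GsubBasis.

Section LoopBasis.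
Variables (k : fieldType) (zeta : nat -> k) (S : nalgType k).
Variables (I : eqType) (P : pred I) (op : I -> I -> I) (c : I -> I -> k).
Variable b : I -> S.
Hypothesis bb : graded_basis P op c b.

Lemma loop_basis (s : aut S) (m : nat) (chi : I -> k) :
  zeta m != 0 ->
  (forall i, P i -> s (b i) = chi i *: b i) ->
  (forall i j, chi (op i j) = chi i * chi j) ->
  exists b' : I * int -> loop zeta s m,
  graded_basis (fun p => P p.1 && (chi p.1 == zeta m ^ p.2))
    (fun p q => (op p.1 q.1, p.2 + q.2)) (fun p q => c p.1 q.1) b'.
Proof.
move=> z0 sb chiM; have [bP _] := bb.
apply: (gsub_basis (Q := fun i j => chi i == zeta m ^ j) bb).
- by move=> i j Pi /eqP e; have := sb i Pi; rewrite e.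
- move=> j x sx; have [r [xE ur rP]] := basis_normal bP x; exists r; split=> //.
  have := basis_eigen (f := s) bP sb ur rP; rewrite -xE => /(_ _ sx) => /allP chir.
  by apply/allP => p pr; have /andP[-> _] := allP rP p pr; exact: chir.
- by move=> i i' j j' /eqP e /eqP e'; rewrite chiM e e' expfzDr.
Qed.

Lemma loop2_basis (s1 s2 : aut S) (m1 m2 : nat) (chi1 chi2 : I -> k) :
  zeta m1 != 0 -> zeta m2 != 0 ->
  (forall i, P i -> s1 (b i) = chi1 i *: b i) ->
  (forall i, P i -> s2 (b i) = chi2 i *: b i) ->
  (forall i j, chi1 (op i j) = chi1 i * chi1 j) ->
  (forall i j, chi2 (op i j) = chi2 i * chi2 j) ->
  exists b' : I * (int * int) -> loop2 zeta s1 s2 m1 m2,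
  graded_basis (fun p => P p.1 && ((chi1 p.1 == zeta m1 ^ p.2.1) &&
                                   (chi2 p.1 == zeta m2 ^ p.2.2)))
    (fun p q => (op p.1 q.1, p.2 + q.2)) (fun p q => c p.1 q.1) b'.
Proof.
move=> z1 z2 sb1 sb2 chi1M chi2M; have [bP _] := bb.
apply: (gsub_basis (Q := fun i j => (chi1 i == zeta m1 ^ j.1) &&
                                    (chi2 i == zeta m2 ^ j.2)) bb).
- move=> i j Pi /andP[/eqP e1 /eqP e2].
  by split; [have := sb1 i Pi; rewrite e1 | have := sb2 i Pi; rewrite e2].
- move=> j x [sx1 sx2]; have [r [xE ur rP]] := basis_normal bP x.
  exists r; split=> //.
  have := basis_eigen (f := s1) bP sb1 ur rP; rewrite -xE => /(_ _ sx1)/allP chir1.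
  have := basis_eigen (f := s2) bP sb2 ur rP; rewrite -xE => /(_ _ sx2)/allP chir2.
  apply/allP => p pr; have /andP[-> _] := allP rP p pr.
  by rewrite chir1 ?chir2.
- move=> i i' j j' /andP[/eqP e1 /eqP e2] /andP[/eqP e1' /eqP e2'].
  by rewrite chi1M chi2M e1 e2 e1' e2' !expfzDr ?eqxx.
Qed.

End LoopBasis.

Lemma autn_eigen (k : fieldType) (S : nalgType k) (s : aut S) (a : k) x n :
  s x = a *: x -> autn s n x = a ^+ n *: x.
Proof.
move=> sx; elim: n => [|n ih]; first by rewrite scale1r.
by rewrite -[LHS]/(s (autn s n x)) ih autZ sx scalerA -exprSr.
Qed.

Lemma autz_eigen (k : fieldType) (S : nalgType k) (s : aut S) (a : k) x q :
  a != 0 -> s x = a *: x -> autz s q x = a ^ q *: x.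
Proof.
move=> a0 sx; case: q => n; first exact: autn_eigen.
rewrite NegzE -exprz_inv; apply: autn_eigen.
rewrite -[LHS]/(aut_inv s x); apply: (can_inj (autK s)).
by rewrite autVK autZ sx scalerA mulVf // scale1r.
Qed.

(** * Matrix algebras and roots of unity *)

(** In contrast to [basis_reindex], the predicate lives on the new indices and the vectors may be
    rescaled. This yields the hypothesis [e_basis] below, one matrix entry at a time, for Laurent
    and quantum torus coefficients. *)
Lemma basis_pull (k : fieldType) (I J : eqType) (V : lmodType k) (b : I -> V)
    (P : pred J) (phi : J -> I) (a : J -> k) :
  is_basis predT b -> (forall j, a j != 0) ->
  (forall j j', P j -> P j' -> phi j = phi j' -> j = j') ->
  (forall i, exists j, P j /\ phi j = i) ->
  is_basis P (fun j => if P j then a j *: b (phi j) else 0).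
Proof.
move=> [_ bspan bfree] a0 phi_inj phi_onto; split.
- by move=> j /negPf ->.
- move=> x; have [s ->] := bspan x; apply: lincomb_sum => -[c i] _ /=.
  have [j [Pj <-]] := phi_onto i; exists [:: (c / a j, j)].
  by rewrite lincomb1 Pj scalerA divfK.
- move=> s s0 j Pj; pose t := [seq (p.1 * a p.2, phi p.2) | p <- s & P p.2].
  have t0 : lincomb b t = 0.
    rewrite -s0 /lincomb big_map big_filter big_mkcond; apply: eq_bigr => p _.
    by case: ifP; rewrite ?scaler0 // scalerA.
  apply: (mulIf (a0 j)); rewrite mul0r -(bfree t t0 (phi j) isT) /coef big_map.
  rewrite big_filter_cond mulr_suml; apply: eq_big => [p|p /eqP -> //].
  apply/eqP/andP => [->|[Pp /eqP e]]; first by rewrite Pj.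
  exact: phi_inj.
Qed.

Section RootsOfUnity.
Variables (k : fieldType) (n : nat) (z : k).
Hypothesis zP : n.+1.-primitive_root z.

(** The pairing of Z/N with Z, for N = [n.+1]. The second argument stays an integer because
    exponents of the shift are not reduced in general. *)
Definition rchar (i : 'I_n.+1) (j : int) : k := z ^ (i%:Z * j).

Lemma prim_neq0 : z != 0.
Proof.
apply/eqP => z0; have /eqP := prim_expr_order zP.
by rewrite z0 expr0n /= eq_sym oner_eq0.
Qed.

Lemma prim_expz_eq1 (j : int) : (z ^ j == 1) = (n.+1%:Z %| j)%Z.
Proof.
rewrite dvdzE; case: j => m /=; first by rewrite (prim_order_dvd zP).
by rewrite NegzE -exprnN invr_eq1 (prim_order_dvd zP).
Qed.

Lemma prim_expz_eq (i j : int) : (z ^ i == z ^ j) = (i == j %[mod n.+1])%Z.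
Proof.
rewrite eqz_mod_dvd -prim_expz_eq1 expfzDr ?prim_neq0 // -invr_expz.
by rewrite (can2_eq (divfK _) (mulfK _)) ?mul1r // expfz_neq0 ?prim_neq0.
Qed.

Lemma prim_expz_mod (i j : int) : (i = j %[mod n.+1])%Z -> z ^ i = z ^ j.
Proof. by move=> /eqP; rewrite -prim_expz_eq => /eqP. Qed.

Lemma rchar_neq0 i j : rchar i j != 0.
Proof. by rewrite expfz_neq0 ?prim_neq0. Qed.

Lemma rcharDr i j j' : rchar i (j + j') = rchar i j * rchar i j'.
Proof. by rewrite /rchar mulrDr expfzDr ?prim_neq0. Qed.

Lemma rcharDl i i' j : rchar (i + i') j = rchar i j * rchar i' j.
Proof.
rewrite /rchar -expfzDr ?prim_neq0 // -mulrDl; apply: prim_expz_mod.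
by rewrite /= -modz_nat modzMml PoszD.
Qed.

Lemma rchar0l j : rchar 0 j = 1. Proof. by rewrite /rchar mul0r. Qed.
Lemma rchar0r i : rchar i 0 = 1. Proof. by rewrite /rchar mulr0. Qed.

Lemma rcharNr i j : rchar i (- j) = (rchar i j)^-1.
Proof. by rewrite /rchar mulrN -invr_expz. Qed.

Lemma rchar_mod i (j j' : int) : (j = j' %[mod n.+1])%Z -> rchar i j = rchar i j'.
Proof. by move=> e; apply: prim_expz_mod; rewrite -modzMmr e modzMmr. Qed.

(** Orthogonality of characters: the sum is geometric with ratio w = z^(i - j), and w^N = 1. *)
Lemma rchar_sum (i j : 'I_n.+1) :
  \sum_(u < n.+1) rchar i u * rchar j (- u%:Z) = (i == j)%:R * n.+1%:R.
Proof.
pose w := z ^ (i%:Z - j%:Z).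
have E u : rchar i u%:Z * rchar j (- u%:Z) = w ^+ u.
  rewrite /rchar -expfzDr ?prim_neq0 // mulrN -mulrBl.
  by rewrite exprnP -exprz_exp.
under eq_bigr do rewrite E.
have [ij|ij] := eqVneq i j.
  rewrite /w ij subrr expr0z; under eq_bigr do rewrite expr1n.
  by rewrite sumr_const card_ord mul1r.
rewrite mul0r; apply: (@mulfI _ (w - 1)).
  rewrite subr_eq0 prim_expz_eq1 -eqz_mod_dvd !modz_nat !modn_small //.
rewrite mulr0 -subrX1 exprnP exprz_exp mulrC -exprz_exp.
by rewrite -exprnP (prim_expr_order zP) exp1rz subrr.
Qed.

(** Discrete Fourier inversion, for which N must be invertible in [k]. *)
Lemma rchar_free (f : 'I_n.+1 -> k) : n.+1%:R != 0 :> k ->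
  (forall u : 'I_n.+1, \sum_i f i * rchar i u = 0) -> forall i, f i = 0.
Proof.
move=> n0 h j; apply: (mulIf n0); rewrite mul0r.
have E i : \sum_(u < n.+1) f i * rchar i u * rchar j (- u%:Z) =
    f i * ((i == j)%:R * n.+1%:R).
  by under eq_bigr do rewrite -mulrA; rewrite -mulr_sumr rchar_sum.
transitivity (\sum_(u < n.+1) (\sum_i f i * rchar i u) * rchar j (- u%:Z)).
  under [RHS]eq_bigr do rewrite mulr_suml.
  rewrite exchange_big /= (eq_bigr _ (fun i _ => E i)) (bigD1 j) //= eqxx mul1r.
  by rewrite big1 ?addr0 // => i /negPf ->; rewrite mul0r mulr0.
by rewrite big1 // => u _; rewrite h mul0r.
Qed.

End RootsOfUnity.

Section GlBasis.
Variables (k : fieldType) (n : nat) (z : k) (A : nalgType k) (O : eqType).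
Hypothesis zP : n.+1.-primitive_root z.
Hypothesis n0 : n.+1%:R != 0 :> k.
Variables (tau : 'I_n.+1 -> O -> 'I_n.+1) (e : 'I_n.+1 -> O -> A).
Implicit Types (u v : 'I_n.+1) (o : O).
Hypothesis e_basis : forall u v,
  is_basis (fun o => v == tau u o) (fun o => if v == tau u o then e u o else 0).

(** A diagonal matrix of characters times a generalized shift: row [u] has its only entry in column
    [tau u o]. One scheme serves Laurent, scalar and quantum torus coefficients. *)
Definition gl_elt (p : 'I_n.+1 * O) : gl n.+1 A :=
  \matrix_(u, v) (if v == tau u p.2 then rchar z p.1 u *: e u p.2 else 0).

Let unit_mx u v (a : A) : gl n.+1 A :=
  \matrix_(i, j) (if (i == u) && (j == v) then a else 0).

Lemma lincomb_mxE (I : eqType) (B : I -> gl n.+1 A) s u v :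
  lincomb B s u v = \sum_(p <- s) p.1 *: B p.2 u v.
Proof.
rewrite /lincomb; elim/big_rec2: _ => [|p x y _ <-]; rewrite !mxE //.
Qed.

Lemma gl_elt_basis : is_basis predT gl_elt.
Proof.
split=> //.
- move=> x; have -> : x = \sum_u \sum_v unit_mx u v (x u v).
    apply/matrixP => i j; rewrite summxE (bigD1 i) //= summxE (bigD1 j) //=.
    rewrite mxE !eqxx /= !big1 ?addr0 // => [u ui|v vj].
      by rewrite summxE big1 // => v _; rewrite mxE eq_sym (negPf ui).
    by rewrite mxE andbC eq_sym (negPf vj).
  apply: lincomb_sum => u _; apply: lincomb_sum => v _.
  have [_ span _] := e_basis u v; have [s ->] := span (x u v).
  have -> : unit_mx u v (lincomb (fun o => if v == tau u o then e u o else 0) s) =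
      \sum_(p <- s) p.1 *: unit_mx u v (if v == tau u p.2 then e u p.2 else 0).
    apply/matrixP => i j; rewrite summxE !mxE; under eq_bigr do rewrite !mxE.
    case: ifP => // _; rewrite big1 // => p _; exact: scaler0.
  apply: lincomb_sum => -[a o] _ /=.
  have [vu|_] := eqVneq v (tau u o); last first.
    exists [::]; rewrite /lincomb big_nil; apply/matrixP => i j.
    by rewrite !mxE if_same scaler0.
  (* Fourier inversion in the row index: this average over the diagonal factors isolates row [u]. *)
  exists [seq (a * (n.+1%:R^-1 * rchar z l (- u%:Z)), (l, o)) | l <- enum 'I_n.+1].
  apply/matrixP => i j; rewrite lincomb_mxE big_map big_enum /= !mxE.
  under eq_bigr do rewrite mxE /=.
  rewrite vu; have [->|jN] := eqVneq j (tau i o); last first.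
    rewrite big1 => [|l _]; last by rewrite scaler0.
    case: (eqVneq i u) => [iu|_]; last by rewrite scaler0.
    by rewrite -iu (negPf jN) scaler0.
  under eq_bigr do rewrite scalerA -!mulrA [rchar z _ (- _) * _]mulrC.
  rewrite -scaler_suml -!mulr_sumr.
  have -> : \sum_(l < n.+1) rchar z l i * rchar z l (- u%:Z) =
    \sum_(l < n.+1) rchar z i l * rchar z u (- l%:Z).
    by apply: eq_bigr => l _; rewrite /rchar !mulrN ![l%:Z * _]mulrC.
  rewrite rchar_sum // [_ * n.+1%:R]mulrC mulKf //.
  have [->|_] := eqVneq i u; first by rewrite eqxx mulr1.
  by rewrite mulr0 scaler0 scale0r.
- move=> s s0 [i o] _.
  suff h (u : 'I_n.+1) : \sum_j coef s (j, o) * rchar z j u = 0.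
    exact: (rchar_free zP n0 h).
  pose t := [seq (p.1 * rchar z p.2.1 u, p.2.2) | p <- s].
  have t0 : lincomb (fun o' => if tau u o == tau u o' then e u o' else 0) t = 0.
    transitivity (lincomb gl_elt s u (tau u o)); last by rewrite s0 mxE.
    rewrite lincomb_mxE /lincomb big_map; apply: eq_bigr => p _.
    by rewrite mxE /=; case: eqP; rewrite ?scaler0 ?scalerA.
  have [_ _ /(_ t t0 o (eqxx _))] := e_basis u (tau u o).
  rewrite /coef big_map /= => tc; rewrite -[RHS]tc.
  under eq_bigr do rewrite /coef mulr_suml.
  rewrite (exchange_big_dep (fun p => p.2.2 == o)) /=; last first.
    by move=> j p _ /eqP ->.
  apply: eq_bigr => -[a [j o']] /= /eqP ->.
  rewrite (bigD1 j) //= big1 ?addr0 // => l /andP[].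
  by rewrite xpair_eqE => /andP[/eqP -> _] /eqP.
Qed.

Variables (opO : O -> O -> O).
Hypothesis tauM : forall u o o', tau (tau u o) o' = tau u (opO o o').
Variable gamma : 'I_n.+1 * O -> 'I_n.+1 * O -> k.
(** The quotient of characters compensates for the diagonal part of the second element being
    evaluated at the shifted row, so that [gamma] is independent of [u]. *)
Hypothesis eM : forall p q u,
  amul (e u p.2) (e (tau u p.2) q.2) =
  (gamma p q * rchar z q.1 u / rchar z q.1 (tau u p.2)) *: e u (opO p.2 q.2).

Lemma gl_eltM p q :
  mmul (gl_elt p) (gl_elt q) = gamma p q *: gl_elt (p.1 + q.1, opO p.2 q.2).
Proof.
apply/matrixP => u v; rewrite !mxE /=.
rewrite (bigD1 (tau u p.2)) //= !mxE /= eqxx big1 ?addr0; last first.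
  by move=> w /negPf wN; rewrite !mxE /= wN amul0l.
rewrite tauM; case: eqP => [_|_]; last by rewrite amul0r scaler0.
rewrite amulZl amulZr eM !scalerA; congr (_ *: _).
by rewrite rcharDl //; field; exact: rchar_neq0.
Qed.

End GlBasis.

Section OrdZ.
Variable n : nat.

Definition ordz (j : int) : 'I_n.+1 := inord `|(j %% n.+1)%Z|%N.

Lemma ordzE (j : int) : (ordz j)%:Z = (j %% n.+1)%Z.
Proof.
have j0 : 0 <= (j %% n.+1)%Z by rewrite modz_ge0.
rewrite /ordz inordK ?gez0_abs // -ltz_nat gez0_abs //.
exact: ltz_pmod.
Qed.

Lemma ordz_eq (i j : int) : (ordz i == ordz j) = (i == j %[mod n.+1])%Z.
Proof. by rewrite -val_eqE -eqz_nat !ordzE. Qed.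

Lemma ordzK (i : 'I_n.+1) : ordz i = i.
Proof. by apply/val_inj/eqP; rewrite -eqz_nat ordzE modz_nat modn_small. Qed.

Lemma ordz_ord (i : 'I_n.+1) (j : int) : (i == ordz j) = (i%:Z == j %[mod n.+1])%Z.
Proof. by rewrite -[i in LHS]ordzK ordz_eq. Qed.

Lemma ordzDl (i j : int) : ordz ((ordz i)%:Z + j) = ordz (i + j).
Proof. by apply/eqP; rewrite ordz_eq ordzE modzDml. Qed.

Lemma ordzD (i j : int) : ordz (i + j) = ordz i + ordz j.
Proof.
apply/val_inj/eqP; rewrite -eqz_nat ordzE /= -modz_nat PoszD !ordzE.
by rewrite modzDml modzDmr.
Qed.

(** Carries add up along successive shifts; this makes the powers of the wrap-around variable
    multiply correctly. *)
Lemma ordz_divDl (i j : int) :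
  (i %/ n.+1)%Z + (((ordz i)%:Z + j) %/ n.+1)%Z = ((i + j) %/ n.+1)%Z.
Proof. by rewrite ordzE [in RHS](divz_eq i n.+1) -[in RHS]addrA divzMDl. Qed.

Lemma ordz_pred0 : ordz (-1) = n :> nat.
Proof.
apply/eqP; rewrite -eqz_nat ordzE -(modzMDl 1) mul1r.
have -> : n.+1%:Z + -1 = n by lia.
by rewrite modz_nat modn_small.
Qed.

Lemma ordz_predS (i : 'I_n.+1) : i != 0 -> ordz (i%:Z - 1) = i.-1 :> nat.
Proof.
move=> i0; apply/eqP; rewrite -eqz_nat ordzE.
have -> : i%:Z - 1 = i.-1.
  by move: i0; rewrite -val_eqE /=; case: (nat_of_ord i) => // m _; lia.
by rewrite modz_nat modn_small // (leq_ltn_trans (leq_pred _)).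
Qed.

Lemma divz_pred0 : divz (- 1)%R n.+1 = - 1.
Proof.
have eN : - 1 = (- 1) * n.+1%:Z + n :> int by lia.
by rewrite [X in (X %/ _)%Z]eN divzMDl // divz_small ?addr0 //= ltz_nat.
Qed.

Lemma divz_predS (i : 'I_n.+1) : i != 0 -> ((i%:Z - 1) %/ n.+1)%Z = 0.
Proof.
move=> i0; rewrite divz_small //.
by move: i0 (ltn_ord i); rewrite -val_eqE /=; move: (nat_of_ord i) => m; lia.
Qed.

End OrdZ.

(** * The Heisenberg bracket and its derived algebra *)

Section Heisenberg.
Variables (k : fieldType) (n : nat) (z : k).
Hypothesis zP : n.+1.-primitive_root z.
Local Notation I := ('I_n.+1 * int)%type.
Implicit Types p q : I.

(* Structure constants of the commutator bracket on the algebra generated by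
   [d] and [s^±1] with [d ^ n.+1 = 1] and [s d = z d s], in the basis [d^i s^j]. *)
Definition heis_com p q : k := rchar z q.1 p.2 - rchar z p.1 q.2.

(** The indices left out are those of the powers of [s ^ n.+1], which are central. *)
Definition heis_supp p : bool := ~~ ((p.1 == 0) && (n.+1%:Z %| p.2)%Z).

Lemma rcharNl i j : rchar z (- i : 'I_n.+1) j = (rchar z i j)^-1.
Proof.
apply: (mulfI (rchar_neq0 zP i j)).
by rewrite -rcharDl // subrr rchar0l mulfV ?rchar_neq0.
Qed.

Lemma rchar_ordz (i j : int) : rchar z (ordz n i) j = z ^ (i * j).
Proof. by apply: (prim_expz_mod zP); rewrite ordzE modzMml. Qed.

Variables (J : zmodType) (phi : J -> I).
Hypothesis phiD1 : forall x y, (phi (x + y)).1 = (phi x).1 + (phi y).1.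
(** Additivity is asked only modulo N, because [heis_com] sees the shift exponent only modulo N and
    in sl_N(k) this exponent is itself a residue. *)
Hypothesis phiD2 : forall x y,
  ((phi (x + y)).2 = (phi x).2 + (phi y).2 %[mod n.+1])%Z.
Hypothesis phi_onto : forall p, exists x, (phi x).1 = p.1 /\
  ((phi x).2 = p.2 %[mod n.+1])%Z.

(** When two indices add up to an omitted one, the second is minus the first modulo N, and the two
    character values coincide. *)
Lemma heis_com_supp x y :
  heis_com (phi x) (phi y) != 0 -> heis_supp (phi (x + y)).
Proof.
apply: contra; rewrite /heis_com phiD1 => /andP[/eqP e1].
have -> : (phi y).1 = - (phi x).1 by apply/eqP; rewrite -addr_eq0 addrC e1.
rewrite -[(phi (x + y)).2]subr0 -eqz_mod_dvd phiD2 => e2.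
have {}e2 : ((phi y).2 = - (phi x).2 %[mod n.+1])%Z.
  by apply/eqP; rewrite eqz_mod_dvd opprK addrC -[_ + _]subr0 -eqz_mod_dvd.
by rewrite (rchar_mod zP _ e2) rcharNl -rcharNr subrr.
Qed.

(** One summand is taken over (0, 1) if N divides the shift exponent j, with constant 1 - z^i, and
    over (1, 0) otherwise, with constant z^j - 1; the support condition makes it nonzero. *)
Lemma heis_supp_com x : heis_supp (phi x) ->
  exists x1 x2, heis_com (phi x1) (phi x2) != 0 /\ x1 + x2 = x.
Proof.
rewrite /heis_supp negb_and => xs.
have [xj|xj] := boolP (n.+1%:Z %| (phi x).2)%Z.
  rewrite xj orbF in xs; have [y [y1 y2]] := phi_onto (0, 1).
  exists (x - y), y; split; last exact: subrK.
  have e1 := phiD1 (x - y) y; rewrite subrK y1 /= addr0 in e1.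
  rewrite /heis_com -e1 y1 rchar0l (rchar_mod zP _ y2) /= subr_eq0 eq_sym /rchar mulr1.
  by rewrite (prim_expz_eq1 zP) dvdzE /= /dvdn modn_small //.
have [y [y1 y2]] := phi_onto (ordz n 1, 0).
exists (x - y), y; split; last exact: subrK.
have e2 : ((phi (x - y)).2 = (phi x).2 %[mod n.+1])%Z.
  by have := phiD2 (x - y) y; rewrite subrK -modzDmr y2 modzDmr addr0.
rewrite /heis_com y1 (rchar_mod zP _ y2) (rchar_mod zP _ e2) /= rchar0r.
by rewrite rchar_ordz mul1r subr_eq0 (prim_expz_eq1 zP).
Qed.

Lemma heis_derived_basis (S : nalgType k) (B : J -> S) :
  graded_basis predT +%R (fun x y => heis_com (phi x) (phi y)) B ->
  exists B' : J -> derived S,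
    graded_basis (heis_supp \o phi) +%R (fun x y => heis_com (phi x) (phi y)) B' /\
    forall x, heis_supp (phi x) -> val (B' x) = B x.
Proof.
by move=> BB; apply: derived_basis BB _ _; [exact: heis_com_supp | exact: heis_supp_com].
Qed.

End Heisenberg.

Section MatrixConjugation.
Variables (k : fieldType) (F : comUnitNalgType k) (n : nat).

Lemma mconj_eigen (a : 'M[F]_n) (x : gl n F) (c : k) : a \in unitmx ->
  mmul (a : gl n F) x = c *: mmul x (a : gl n F) -> mconj a x = c *: x.
Proof.
move=> ua; rewrite mconjE // !mmulE => ->.
rewrite -[RHS](mulmxK ua); congr (_ *m _).
by apply/matrixP => i j; rewrite !mxE scaler_sumr; apply: eq_bigr => l _;
  rewrite mxE scalerAl.
Qed.

Lemma aut_derived_eigen (S : nalgType k) (s : aut S) (x : derived S) (c : k) :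
  s (val x) = c *: val x -> aut_derived s x = c *: x.
Proof. by move=> e; apply: val_inj. Qed.

End MatrixConjugation.

(** * Special linear algebras over Laurent polynomials and over scalars *)

Section SlLaurent.
Variables (k : fieldType) (n : nat) (z : k).
Hypothesis zP : n.+1.-primitive_root z.
Hypothesis n0 : n.+1%:R != 0 :> k.

Lemma lmon_basis : is_basis predT (fun j : int => lmon k j).
Proof.
have lmonE (a : k) (j : int) : lmono j (a : k^o) = a *: lmon k j.
  apply/val_inj/funext => l /=; rewrite -[RHS]/(a * (l == j)%:R) /lmono_fun.
  by case: eqP; rewrite ?mulr1 ?mulr0.
split=> //.
- move=> f; have [r [_ ->]] := laurent_monoE f.
  by apply: lincomb_sum => j _; exists [:: (f j, j)]; rewrite lincomb1 lmonE.
- move=> s s0 j _; rewrite -[RHS](congr1 (fun f : R1 k => f j) s0).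
  rewrite /lincomb lcoef_sum /coef big_mkcond; apply: eq_bigr => p _.
  rewrite -[RHS]/(p.1 * (j == p.2)%:R) eq_sym.
  by case: eqP; rewrite ?mulr1 ?mulr0.
Qed.

Lemma lmonM (i j : int) : amul (lmon k i) (lmon k j) = lmon k (i + j).
Proof.
apply/val_inj/funext => l; rewrite -[LHS]/((amul (lmon k i) (lmon k j) : R1 k) l).
by rewrite R1_lmonM /= /lmon_fun subr_eq addrC.
Qed.

(** The exponent is minus the number of wraps of the shift, so that (0, -1), and not (0, 1), is the
    index of [p_mx] at [t1]. *)
Definition lgl_elt : 'I_n.+1 * int -> gl n.+1 (R1 k) :=
  gl_elt z (fun u j => ordz n (u%:Z + j))
    (fun u j => lmon k (- ((u%:Z + j) %/ n.+1)%Z)).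

Lemma lgl_eM (p q : 'I_n.+1 * int) (u : 'I_n.+1) :
  rchar z q.1 p.2 * rchar z q.1 u / rchar z q.1 (ordz n (u%:Z + p.2)) = 1.
Proof.
rewrite -(rcharDr zP) (rchar_mod zP _ (j := (ordz n _)%:Z) (j' := p.2 + u%:Z)).
  by rewrite mulfV ?rchar_neq0.
by rewrite ordzE modz_mod addrC.
Qed.

Lemma lgl_mul p q : mmul (lgl_elt p) (lgl_elt q) = rchar z q.1 p.2 *: lgl_elt (p + q).
Proof.
have tM (u : 'I_n.+1) (j j' : int) :
    ordz n ((ordz n (u%:Z + j))%:Z + j') = ordz n (u%:Z + (j + j')).
  by rewrite ordzDl addrA.
apply: (gl_eltM zP tM (gamma := fun p q => rchar z q.1 p.2)) => {}p {}q u.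
rewrite lgl_eM scale1r lmonM -opprD; congr (lmon k (- _)).
by rewrite ordz_divDl addrA.
Qed.

Lemma lgl_basis : graded_basis predT +%R (heis_com z) lgl_elt.
Proof.
split; last first.
  move=> p q _ _; rewrite -[LHS]/(mmul _ _ - mmul _ _) !lgl_mul scalerBl.
  by rewrite [q + p]addrC.
apply: gl_elt_basis => // u v.
have := basis_pull (phi := fun j : int => - ((u%:Z + j) %/ n.+1)%Z)
  (P := fun j => v == ordz n (u%:Z + j)) (a := fun=> 1) lmon_basis.
rewrite (_ : (fun j => if _ then 1 *: _ else _) =
  (fun j => if v == ordz n (u%:Z + j) then lmon k (- ((u%:Z + j) %/ n.+1)%Z) else 0)).
  apply=> [j|j j'|i]; first exact: oner_neq0.
    rewrite !ordz_ord => /eqP e /eqP e' /oppr_inj d.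
    by apply: (addrI u%:Z); rewrite (divz_eq (_ + j) n.+1) d -e e' -divz_eq.
  exists (v%:Z - u%:Z - i * n.+1%:Z); rewrite addrC addrAC subrK -mulNr; split.
    by rewrite ordz_ord addrC modzMDl.
  by rewrite addrC divzMDl // divz_small ?addr0 ?opprK //= ltz_nat ltn_ord.
by apply/funext => j; case: eqP; rewrite ?scale1r.
Qed.

Lemma lgl_elt_p : (p_mx n.+1 (t1 k) : gl n.+1 (R1 k)) = lgl_elt (0, -1).
Proof.
apply/matrixP => i j; rewrite !mxE /= rchar0l scale1r -val_eqE /=.
(* Row 0 is the only one that wraps: it goes to the last column with quotient -1, hence with entry
   t. *)
have [->|i0] := eqVneq i 0.
  rewrite add0r ordz_pred0 /= eqSS add0r; case: eqP => _; rewrite ?mul0r // mul1r.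
  by rewrite divz_pred0.
have -> : (i == 0%N :> nat) = false by apply: negPf i0.
rewrite ordz_predS // divz_predS // oppr0 mul0r addr0.
have -> : (i == j.+1 :> nat) = (j == i.-1 :> nat).
  by move: i0; rewrite -val_eqE /=; case: (nat_of_ord i) => // m _; rewrite eqSS eq_sym.
by case: eqP.
Qed.

Lemma sl_laurent_basis : exists B : 'I_n.+1 * int -> sl n.+1 (R1 k),
  graded_basis (@heis_supp n) +%R (heis_com z) B /\
  forall p, aut_P n.+1 (t1 k) (B p) = rchar z p.1 (-1) *: B p.
Proof.
have [] := @heis_derived_basis k n z zP _ id _ _ _ _ _ lgl_basis => //.
  by move=> p; exists p.
move=> B [BB BE]; exists B; split=> // p.
have [/BE e|/(basis_out BB.1) ->] := boolP (heis_supp p); last first.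
  by rewrite linear0 scaler0.
apply: aut_derived_eigen; rewrite e; apply: mconj_eigen.
  by apply: p_mx_unit; exact: t1_unit.
rewrite lgl_elt_p !lgl_mul scalerA rchar0l mulr1.
by rewrite [in RHS]addrC.
Qed.

End SlLaurent.

Section SlScalar.
Variables (k : fieldType) (n : nat) (z : k).
Hypothesis zP : n.+1.-primitive_root z.
Hypothesis n0 : n.+1%:R != 0 :> k.
Local Notation J := ('I_n.+1 * 'I_n.+1)%type.

Definition ord_pair (p : J) : 'I_n.+1 * int := (p.1, p.2%:Z).

Definition kgl_elt : J -> gl n.+1 k^o :=
  gl_elt z (fun u j => u + j) (fun u j => (1 : k^o)).

Lemma kgl_mul p q : mmul (kgl_elt p) (kgl_elt q) = rchar z q.1 p.2 *: kgl_elt (p + q).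
Proof.
have tM (u j j' : 'I_n.+1) : u + j + j' = u + (j + j') by rewrite addrA.
apply: (gl_eltM zP tM (gamma := fun p q => rchar z q.1 p.2)) => {}p {}q u.
rewrite -(rcharDr zP) (rchar_mod zP _ (j' := (u + p.2)%R%:Z)).
  by rewrite mulfV ?rchar_neq0 // scale1r; exact: mulr1.
by rewrite /= -modz_nat modz_mod PoszD addrC.
Qed.

Lemma kgl_basis :
  graded_basis predT +%R (fun p q => heis_com z (ord_pair p) (ord_pair q)) kgl_elt.
Proof.
split; last first.
  move=> p q _ _; rewrite -[LHS]/(mmul _ _ - mmul _ _) !kgl_mul scalerBl.
  by rewrite [q + p]addrC.
apply: gl_elt_basis => // u v; split.
- by move=> o /negPf ->.
- move=> x; exists [:: (x, v - u)]; rewrite lincomb1 addrC subrK eqxx.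
  exact/esym/mulr1.
- move=> s s0 o /eqP vo; rewrite -[RHS]s0 /coef /lincomb big_mkcond.
  apply: eq_bigr => p _; rewrite vo (inj_eq (addrI u)) eq_sym.
  by case: eqP; rewrite ?scaler0 //; rewrite -[_ *: _]/(_ * _) mulr1.
Qed.

Lemma kgl_elt_p : (p_mx n.+1 (1 : k^o) : gl n.+1 k^o) = kgl_elt (0, ordz n (-1)).
Proof.
apply/matrixP => i j; rewrite !mxE /= rchar0l scale1r -[i in RHS]ordzK -ordzD.
have [->|i0] := eqVneq i 0.
  rewrite -val_eqE [X in ordz n X](_ : _ = -1) // [\val (ordz _ _)]ordz_pred0 /=.
  rewrite eqSS add0r mulr1.
  by case: eqP.
have -> : (i == 0%N :> nat) = false by apply: negPf i0.
rewrite -val_eqE /= ordz_predS // mul0r addr0.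
have -> : (i == j.+1 :> nat) = (j == i.-1 :> nat).
  by move: i0; rewrite -val_eqE /=; case: (nat_of_ord i) => // m _; rewrite eqSS eq_sym.
by case: eqP.
Qed.

Lemma kgl_elt_d : (d_mx n.+1 (z : k^o) : gl n.+1 k^o) = kgl_elt (ordz n 1, 0).
Proof.
apply/matrixP => i j; rewrite !mxE /= addr0 rchar_ordz // mul1r eq_sym.
by case: eqP => _; rewrite ?mulr0n // mulr1n; exact/esym/mulr1.
Qed.

Lemma sl_scalar_basis : exists B : J -> sl n.+1 k^o,
  [/\ graded_basis (@heis_supp n \o ord_pair) +%R
        (fun p q => heis_com z (ord_pair p) (ord_pair q)) B,
      forall p, aut_P n.+1 (1 : k^o) (B p) = rchar z p.1 (-1) *: B p &
      forall p, aut_D n.+1 (z : k^o) (B p) = z ^ (- p.2%:Z) *: B p].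
Proof.
have [] := @heis_derived_basis k n z zP _ ord_pair _ _ _ _ _ kgl_basis => //.
- by move=> x y; rewrite /= -modz_nat modz_mod PoszD.
- by move=> p; exists (p.1, ordz n p.2); rewrite /= ordzE modz_mod.
move=> B [BB BE]; exists B; split=> // p.
- have [/BE e|/(basis_out BB.1) ->] := boolP (heis_supp (ord_pair p)); last first.
    by rewrite linear0 scaler0.
  apply: aut_derived_eigen; rewrite e; apply: mconj_eigen.
    by apply: p_mx_unit; exact: unitr1.
  rewrite kgl_elt_p !kgl_mul scalerA rchar0l mulr1 [in RHS]addrC.
  by rewrite (rchar_mod zP _ (j' := -1)) // ordzE modz_mod.
- have [/BE e|/(basis_out BB.1) ->] := boolP (heis_supp (ord_pair p)); last first.
    by rewrite linear0 scaler0.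
  apply: aut_derived_eigen; rewrite e; apply: mconj_eigen.
    by apply: d_mx_unit; rewrite unitfE (prim_neq0 zP).
  rewrite kgl_elt_d !kgl_mul scalerA rchar0r rchar_ordz // mul1r [in RHS]addrC.
  by rewrite -expfzDr ?(prim_neq0 zP) // addNr expr0z.
Qed.

End SlScalar.

(** * Quantum tori *)

Section PresLift.
Variables (k : fieldType) (X : Type) (E : term k X -> term k X -> Prop).
Variables (L : nalgType k) (f : X -> L).

Fixpoint term_eval (s : term k X) : L :=
  match s with
  | TGen x => f x
  | TZero => 0
  | TAdd s t => term_eval s + term_eval t
  | TScale a s => a *: term_eval s
  | TMul s t => amul (term_eval s) (term_eval t)
  end.

Hypothesis f_rel : forall s t, E s t -> term_eval s = term_eval t.

Lemma cong_eval s t : cong E s t -> term_eval s = term_eval t.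
Proof.
elim=> {s t} //=.
- by move=> s t u _ -> _ ->.
- by move=> s s' t t' _ -> _ ->.
- by move=> a s s' _ ->.
- by move=> s s' t t' _ -> _ ->.
- by move=> s t u; rewrite addrA.
- by move=> s t; rewrite addrC.
- by move=> s; rewrite add0r.
- by move=> s; rewrite scaleN1r addNr.
- by move=> a b s; rewrite scalerA.
- by move=> s; rewrite scale1r.
- by move=> a s t; rewrite scalerDr.
- by move=> a b s; rewrite scalerDl.
- by move=> a s t u; rewrite amul_linl.
- by move=> a s t u; rewrite amul_linr.
Qed.

Lemma pres_lift : exists phi : {linear pres E -> L},
  (forall x y, phi (amul x y) = amul (phi x) (phi y)) /\
  forall x, phi (pgen E x) = f x.
Proof.
pose phi (x : pres E) := term_eval (repr x).
have phiE s : phi (pclass E s) = term_eval s by apply/cong_eval/cong_repr.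
have philin : linear phi.
  move=> a; elim/pind=> s; elim/pind=> t.
  by rewrite [_ *: _]pscaleE [_ + _]paddE !phiE.
pose F : {linear pres E -> L} :=
  HB.pack phi (GRing.isLinear.Build k (pres E) L *:%R phi philin).
exists F; split=> [|x]; last exact: phiE.
by elim/pind=> s; elim/pind=> t; rewrite /= [amul _ _]pmulE !phiE.
Qed.

End PresLift.

Section Endomorphisms.
Variables (k : fieldType) (V : lmodType k).

Definition linear_pred : {pred V -> V} := fun f => `[< linear f >].

Lemma linear_predP f : f \in linear_pred <-> linear f.
Proof. by split=> [/asboolP|h] //; apply/asboolP. Qed.

Fact linear_pred_submod : subsemimod_closed linear_pred.
Proof.
split; [split|].
- by apply/linear_predP => a x y /=; rewrite scaler0 addr0.
- move=> f g /linear_predP lf /linear_predP lg; apply/linear_predP => a x y.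
  rewrite -[LHS]/(f _ + g _) -[RHS]/(a *: (f x + g x) + (f y + g y)) lf lg.
  by rewrite scalerDr addrACA.
- move=> c f /linear_predP lf; apply/linear_predP => a x y.
  rewrite -[LHS]/(c *: f _) -[RHS]/(a *: (c *: f x) + c *: f y) lf.
  by rewrite scalerDr !scalerA mulrC.
Qed.
HB.instance Definition _ :=
  GRing.isSubmodClosed.Build k (V -> V) linear_pred linear_pred_submod.

Record endo := Endo { endo_fun :> V -> V; endoP : endo_fun \in linear_pred }.
HB.instance Definition _ := [isSub for endo_fun].
HB.instance Definition _ := [Choice of endo by <:].
HB.instance Definition _ := [SubChoice_isSubLmodule of endo by <:].
Implicit Types f g h : endo.

Lemma endo_linear f : linear f. Proof. exact/linear_predP/endoP. Qed.
Lemma endo_ext f g : (forall x, f x = g x) -> f = g.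
Proof. by move=> fg; apply/val_inj/funext. Qed.

Lemma endo_sum (J : Type) (r : seq J) (Q : pred J) (F : J -> endo) x :
  (\sum_(j <- r | Q j) F j) x = \sum_(j <- r | Q j) F j x.
Proof. exact: (big_morph (fun f : endo => f x)). Qed.

Fact endo_comp_linear f g : (fun x => f (g x)) \in linear_pred.
Proof. by apply/linear_predP => a x y; rewrite !endo_linear. Qed.

Definition endo_comp f g : endo := Endo (endo_comp_linear f g).

Fact endo_comp_linl a f g h :
  endo_comp (a *: f + g) h = a *: endo_comp f h + endo_comp g h.
Proof. exact: endo_ext. Qed.

Fact endo_comp_linr a f g h :
  endo_comp h (a *: f + g) = a *: endo_comp h f + endo_comp h g.
Proof. by apply: endo_ext => x /=; exact: endo_linear. Qed.

HB.instance Definition _ := isNalgebra.Build k endo endo_comp_linl endo_comp_linr.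

End Endomorphisms.

Section Powers.
Variables (k : fieldType) (A : nalgType k) (one : A).
Hypothesis mulA : associative (@amul k A).
Hypothesis mul1 : left_id one (@amul k A).
Hypothesis mulr1 : right_id one (@amul k A).

Definition apow (x xV : A) (n : int) : A :=
  match n with
  | Posz m => iter m (amul x) one
  | Negz m => iter m.+1 (amul xV) one
  end.

Section Inverse.
Variables x xV : A.
Hypotheses (xxV : amul x xV = one) (xVx : amul xV x = one).

Lemma apowS (n : int) : amul x (apow x xV n) = apow x xV (n + 1).
Proof.
case: n => [m|[|m]]; first by rewrite -PoszD addn1.
  by rewrite /= mulr1 xxV.
have -> : Negz m.+1 + 1 = Negz m by lia.
by rewrite /= mulA xxV mul1.
Qed.

Lemma apowP (n : int) : amul xV (apow x xV n) = apow x xV (n - 1).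
Proof.
case: n => [[|m]|m]; first by [].
  have -> : m.+1%:Z - 1 = m by lia.
  by rewrite /= mulA xVx mul1.
by have -> : Negz m - 1 = Negz m.+1 by lia.
Qed.

Lemma apowD (m n : int) : amul (apow x xV m) (apow x xV n) = apow x xV (m + n).
Proof.
elim/int_rect: m => [|m ih|m ih]; first by rewrite add0r mul1.
  by rewrite intS addrC -apowS -mulA ih apowS addrAC.
have -> : - m.+1%:Z = - m%:Z - 1 by lia.
by rewrite -apowP -mulA ih apowP addrAC.
Qed.

Lemma apow_comm (a : A) (c : k) : c != 0 -> amul a x = c *: amul x a ->
  forall n, amul a (apow x xV n) = c ^ n *: amul (apow x xV n) a.
Proof.
move=> c0 ax; have axV : amul a xV = c^-1 *: amul xV a.
  have : amul (amul xV (amul a x)) xV = amul xV a by rewrite -!mulA xxV mulr1.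
  rewrite ax amulZr amulZl mulA xVx mul1 => <-.
  by rewrite scalerA mulVf // scale1r.
have step (y : A) d e m : amul a y = d *: amul y a ->
    amul a (apow x xV m) = e *: amul (apow x xV m) a ->
    amul a (amul y (apow x xV m)) = (d * e) *: amul (amul y (apow x xV m)) a.
  by move=> ay am; rewrite mulA ay amulZl -mulA am amulZr mulA scalerA.
elim/int_rect=> [|m ih|m ih]; first by rewrite /= mulr1 mul1 expr0z scale1r.
  by rewrite intS addrC -apowS (step _ _ _ _ ax ih) expfzDr // expr1z mulrC.
have -> : - m.+1%:Z = - m%:Z - 1 by lia.
by rewrite -apowP (step _ _ _ _ axV ih) expfzDr // -exprN1 mulrC.
Qed.

End Inverse.
End Powers.

Section QuantumTorusBasis.
Variables (k : fieldType) (theta : k).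
Hypothesis theta0 : theta != 0.
Local Notation Q := (qtorus theta).
Local Notation gen x := (pgen (assoc_rel (qt_rel theta)) x : Q).
Local Notation x1 := (gen (Some QX1)).
Local Notation x1V := (gen (Some QX1V)).
Local Notation x2 := (gen (Some QX2)).
Local Notation x2V := (gen (Some QX2V)).
Local Notation one := (gen None).
Local Notation qA := (@assoc_presA _ _ (@qt_rel k theta)).
Local Notation q1l := (@assoc_pres1l _ _ (@qt_rel k theta)).
Local Notation q1r := (@assoc_pres1r _ _ (@qt_rel k theta)).

Lemma qt_relE s t : qt_rel theta s t ->
  pclass (assoc_rel (qt_rel theta)) s = pclass (assoc_rel (qt_rel theta)) t.
Proof. by move=> st; apply/pclass_eq/cong_rel/assoc_base. Qed.

Lemma x1x1V : amul x1 x1V = one.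
Proof. by rewrite [LHS]pmulE; apply: qt_relE; constructor. Qed.
Lemma x1Vx1 : amul x1V x1 = one.
Proof. by rewrite [LHS]pmulE; apply: qt_relE; constructor. Qed.
Lemma x2x2V : amul x2 x2V = one.
Proof. by rewrite [LHS]pmulE; apply: qt_relE; constructor. Qed.
Lemma x2Vx2 : amul x2V x2 = one.
Proof. by rewrite [LHS]pmulE; apply: qt_relE; constructor. Qed.
Lemma x1x2 : amul x1 x2 = theta *: amul x2 x1.
Proof.
by rewrite [LHS]pmulE [amul x2 x1]pmulE [RHS]pscaleE; apply: qt_relE; constructor.
Qed.

Local Notation pow1 := (apow one x1 x1V).
Local Notation pow2 := (apow one x2 x2V).

Lemma pow1_pow2 (c b : int) :
  amul (pow1 c) (pow2 b) = theta ^ (c * b) *: amul (pow2 b) (pow1 c).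
Proof.
rewrite -exprz_exp.
apply: (apow_comm qA q1l q1r x2x2V x2Vx2); first by rewrite expfz_neq0.
have h : amul x2 x1 = theta^-1 *: amul x1 x2 by rewrite x1x2 scalerA mulVf // scale1r.
rewrite (apow_comm qA q1l q1r x1x1V x1Vx1 _ h) ?invr_eq0 //.
by rewrite scalerA exprz_inv -invr_expz mulfV ?scale1r // expfz_neq0.
Qed.

(** The first exponent belongs to [x2]: in the order x2^b x1^c, moving x1^c across x2^b' costs
    theta^(c b'). *)
Definition qmono (p : int * int) : Q := amul (pow2 p.1) (pow1 p.2).

Lemma qmonoM p q : amul (qmono p) (qmono q) = theta ^ (p.2 * q.1) *: qmono (p + q).
Proof.
rewrite /qmono -qA (qA (pow1 _)) pow1_pow2 amulZl amulZr -qA.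
by rewrite (apowD qA q1l q1r x1x1V x1Vx1) qA (apowD qA q1l q1r x2x2V x2Vx2).
Qed.

Let V := (int * int -> k^o)%type.
(** [x1] shifts the first coordinate; [x2] multiplies by theta to the power of the first coordinate
    and shifts the second. This last shift separates the monomials even if theta is a root of
    unity. *)
Definition qt_op (p : int * int) (v : V) : V :=
  fun i => theta ^ (i.1 * p.1) *: v (i.1 + p.2, i.2 + p.1).

Fact qt_op_linear p : qt_op p \in @linear_pred k V.
Proof.
apply/linear_predP => a v w; apply/funext => i; rewrite /qt_op.
rewrite -[LHS]/(_ *: (a *: v _ + w _)) -[RHS]/(a *: (_ *: v _) + _ *: w _).
by rewrite scalerDr !scalerA mulrC.
Qed.

Definition qt_endo p : endo V := Endo (qt_op_linear p).

Lemma qt_endoM p q : amul (qt_endo p) (qt_endo q) = theta ^ (p.2 * q.1) *: qt_endo (p + q).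
Proof.
apply: endo_ext => v; apply/funext => -[i j].
rewrite -[RHS]/(_ *: (_ *: v _)) -[LHS]/(_ *: (_ *: v _)) !scalerA /= !addrA.
by congr (_ *: _); rewrite -!expfzDr //; congr (_ ^ _); ring.
Qed.

Definition qt_model (x : option qt_gen) : endo V :=
  qt_endo (match x with
  | None => 0
  | Some QX1 => (0, 1)
  | Some QX1V => (0, -1)
  | Some QX2 => (1, 0)
  | Some QX2V => (-1, 0)
  end).

Lemma qt_rep : exists phi : {linear Q -> endo V},
  forall p, phi (qmono p) = qt_endo p.
Proof.
have op1 f : amul (qt_endo 0) f = f.
  apply: endo_ext => v; apply/funext => -[i j].
  by rewrite -[LHS]/(_ *: f v _) mulr0 expr0z scale1r !addr0.
have op1r f : amul f (qt_endo 0) = f.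
  apply: endo_ext => v; rewrite -[LHS]/(f (qt_op 0 v)); congr (f _).
  apply/funext => -[i j]; rewrite /qt_op mulr0 expr0z scale1r.
  by rewrite !addr0.
have [] := @pres_lift k _ (assoc_rel (qt_rel theta)) (endo V) qt_model.
  move=> s t; case=> {s t} [s t|s t u|s|s] /=; last by rewrite op1r.
  - case=> {s t} /=; rewrite /qt_model qt_endoM ?mul0r ?mulr0 ?expr0z ?scale1r //.
    by rewrite qt_endoM mul0r expr0z scale1r mul1r expr1z addrC.
  - exact: endo_ext.
  - by rewrite op1.
move=> phi [phiM phiG]; exists phi => p.
(* On either axis the cocycle is trivial, so powers of a generator correspond to multiples of its
   index. *)
have iterE (x : Q) (a : int * int) m : a.1 * a.2 = 0 -> phi x = qt_endo a ->
    phi (iter m (amul x) one) = qt_endo (a *+ m).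
  move=> a0 xa; elim: m => [|m ih]; first exact: phiG.
  rewrite iterS phiM xa ih qt_endoM mulrS.
  have -> : (a *+ m).1 = a.1 *+ m by exact: raddfMn.
  by rewrite mulrnAr [a.2 * _]mulrC a0 mul0rn expr0z scale1r.
have pairMn (i j : int) m : (i, j) *+ m = (i *+ m, j *+ m).
  by elim: m => [|m ih]; rewrite ?mulr0n // !mulrS ih.
have -> : qt_endo p = amul (qt_endo (p.1, 0)) (qt_endo (0, p.2)).
  rewrite qt_endoM mul0r expr0z scale1r; congr qt_endo; case: p => i j.
  by rewrite -[RHS]/(i + 0, 0 + j) addr0 add0r.
rewrite /qmono phiM.
congr (amul _ _).
- case: p.1 => m /=.
    by rewrite (@iterE _ (1, 0)) ?phiG ?mulr0 ?mul0r // pairMn mul0rn natz.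
  rewrite -iterS (@iterE _ (-1, 0)) ?phiG ?mulr0 //.
  by rewrite pairMn mul0rn mulNrn natz NegzE.
- case: p.2 => m /=.
    by rewrite (@iterE _ (0, 1)) ?phiG ?mulr0 ?mul0r // pairMn mul0rn natz.
  rewrite -iterS (@iterE _ (0, -1)) ?phiG ?mul0r //.
  by rewrite pairMn mul0rn mulNrn natz NegzE.
Qed.

(** Left multiplication by any term preserves the span of the monomials, which contains the unit.
    Independence follows by applying the operators of [qt_rep] to point masses and evaluating at the
    origin. *)
Lemma qmono_basis : is_basis predT qmono.
Proof.
split=> //.
- have step (x : Q) : (forall p, exists s, amul x (qmono p) = lincomb qmono s) ->
    forall y, (exists s, y = lincomb qmono s) -> exists s, amul x y = lincomb qmono s.
    move=> h _ [s ->]; rewrite /lincomb amul_sumr; apply: lincomb_sum => p _.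
    by have [t tE] := h p.2; exists (lscale p.1 t); rewrite lincomb_scale amulZr tE.
  suff h (x : Q) : forall y, (exists s, y = lincomb qmono s) ->
      exists s, amul x y = lincomb qmono s.
    move=> x; rewrite -[x]q1r; apply: h; exists [:: (1, 0)].
    by rewrite lincomb1 scale1r /qmono /= q1l.
  elim/pind: x => s; elim: s => [g||s ihs t iht|a s ihs|s ihs t iht] y [r rE].
  - apply: step; last by exists r.
    move=> p; have [i ->] : exists i, pclass (assoc_rel (qt_rel theta)) (TGen g) = qmono i.
      case: g => [[]|].
      - by exists (0, 1); rewrite /qmono /= q1r q1l.
      - by exists (0, -1); rewrite /qmono /= q1r q1l.
      - by exists (1, 0); rewrite /qmono /= !q1r.
      - by exists (-1, 0); rewrite /qmono /= !q1r.
      - by exists 0; rewrite /qmono /= q1r.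
    by rewrite qmonoM; exists [:: (theta ^ (i.2 * p.1), i + p)]; rewrite lincomb1.
  - by exists [::]; rewrite /lincomb big_nil [pclass _ _](_ : _ = 0) ?amul0l.
  - have [u uE] := ihs _ (ex_intro _ r rE); have [v vE] := iht _ (ex_intro _ r rE).
    exists (u ++ v); rewrite lincomb_cat -uE -vE -amulDl; congr (amul _ _).
    by rewrite [RHS]paddE.
  - have [u uE] := ihs _ (ex_intro _ r rE); exists (lscale a u).
    rewrite lincomb_scale -uE -amulZl; congr (amul _ _).
    by rewrite [RHS]pscaleE.
  - have -> : pclass (assoc_rel (qt_rel theta)) (TMul s t) =
      amul (pclass _ s : Q) (pclass _ t) by rewrite [RHS]pmulE.
    by rewrite -qA; apply/ihs/iht; exists r.
- move=> s s0 p _; have [phi phiE] := qt_rep.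
  pose v : V := fun i => (i == (p.2, p.1))%:R.
  have : phi (lincomb qmono s) v 0 = 0 by rewrite s0 linear0.
  rewrite linear_lincomb /lincomb endo_sum.
  have Vsum (F : k * (int * int) -> V) : (\sum_(q <- s) F q) 0 = \sum_(q <- s) F q 0.
    by elim/big_rec2: _ => // q _ y _ <-.
  rewrite Vsum => <-.
  rewrite /coef big_mkcond; apply: eq_bigr => q _.
  rewrite phiE -[RHS]/(q.1 * (theta ^ (0 * _) * (_ == _)%:R)) mul0r expr0z mul1r.
  rewrite !add0r xpair_eqE andbC -[_ && _]/(q.2 == p).
  by case: eqP; rewrite ?mulr1 ?mulr0.
Qed.

End QuantumTorusBasis.

(** * Matrices over the quantum torus *)

Section SlQuantumTorus.
Variables (k : fieldType) (n g d : nat) (z : k) (r i0 : int).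
Hypothesis zP : n.+1.-primitive_root z.
Hypothesis g0 : g.+1%:R != 0 :> k.
Hypothesis nE : n.+1 = (d * g.+1)%N.
Hypothesis ri0 : (r * i0 = 1 %[mod d])%Z.
Local Notation J := ('I_g.+1 * (int * int))%type.
Local Notation theta := (z ^ (i0 * g.+1)).

(** The first component solves b = i r modulo d for i: as r i0 = 1 modulo d, the residues i0 b + d
    a, with a modulo [g.+1], are all the solutions. *)
Definition torus_phi (x : J) : 'I_n.+1 * int :=
  (ordz n (d%:Z * x.1%:Z + i0 * x.2.2), x.2.1).

Lemma ordD_int (m : nat) (i j : 'I_m.+1) :
  exists q : int, (i + j)%R%:Z = i%:Z + j%:Z + q * m.+1.
Proof.
exists (- ((i%:Z + j%:Z) %/ m.+1)%Z).
by rewrite /= -modz_nat PoszD /modz mulNr.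
Qed.

Lemma prim_expzDM (e t : int) : z ^ (e + t * n.+1) = z ^ e.
Proof. by apply: (prim_expz_mod zP); rewrite addrC modzMDl. Qed.

Lemma nEz : n.+1%:Z = d%:Z * g.+1%:Z. Proof. by rewrite nE PoszM. Qed.

Lemma torus_phiD1 x y : (torus_phi (x + y)).1 = (torus_phi x).1 + (torus_phi y).1.
Proof.
rewrite /= -ordzD; apply/eqP; rewrite ordz_eq; apply/eqP.
have [q ->] := ordD_int x.1 y.1.
have -> : d%:Z * (x.1%:Z + y.1%:Z + q * g.+1) + i0 * (x.2.2 + y.2.2) =
    q * n.+1 + (d%:Z * x.1 + i0 * x.2.2 + (d%:Z * y.1 + i0 * y.2.2)).
  by rewrite nEz; ring.
by rewrite modzMDl.
Qed.

Lemma torus_phi_pull (i : 'I_n.+1) (j b : int) : (b = i%:Z * r %[mod d])%Z ->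
  exists a : 'I_g.+1, torus_phi (a, (j, b)) = (i, j).
Proof.
move=> bE; have : (d%:Z %| i%:Z - i0 * b)%Z.
  rewrite -eqz_mod_dvd -[(i0 * b %% _)%Z]modzMmr bE modzMmr mulrCA [i0 * r]mulrC.
  by rewrite -modzMmr ri0 modzMmr mulr1.
move=> /dvdzP[t tE]; exists (ordz g t); congr (_, _); rewrite /= -[RHS]ordzK.
apply/eqP; rewrite ordz_eq ordzE; apply/eqP.
have -> : d%:Z * (t %% g.+1)%Z + i0 * b = (- (t %/ g.+1)%Z) * n.+1 + i%:Z.
  rewrite nEz -[X in _ = _ + X](subrK (i0 * b)) tE /modz; ring.
by rewrite modzMDl.
Qed.

Lemma torus_phi_onto p : exists x, torus_phi x = p.
Proof.
by case: p => i j; have [a <-] := torus_phi_pull j (erefl (i%:Z * r %% d)%Z); eexists.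
Qed.

Lemma theta_neq0 : theta != 0.
Proof. by rewrite expfz_neq0 ?(prim_neq0 zP). Qed.

Lemma torus_prim : g.+1.-primitive_root (z ^+ d).
Proof.
have := dvdn_prim_root zP (m := g.+1); rewrite nE dvdn_mull // => /(_ isT).
by rewrite mulnK.
Qed.

Definition tgl_coef (u : 'I_g.+1) (o : int * int) : k := z ^ (i0 * o.2 * u%:Z).

(** [x1] counts the wraps of the shift and [x2] carries [b]. Over a full turn of [g.+1] rows the
    factor [tgl_coef] would change by z^(i0 b (g + 1)); moving [x1] across x2^b produces theta^b,
    and this match dictates theta. *)
Definition tgl_elt : J -> gl g.+1 (qtorus theta) :=
  gl_elt (z ^+ d) (fun u o => ordz g (u%:Z + o.1))
    (fun u o => tgl_coef u o *: qmono theta (o.2, ((u%:Z + o.1) %/ g.+1)%Z)).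

Lemma tgl_mul p q : mmul (tgl_elt p) (tgl_elt q) =
  rchar z (torus_phi q).1 (torus_phi p).2 *: tgl_elt (p + q).
Proof.
have tM (u : 'I_g.+1) (o o' : int * int) :
    ordz g ((ordz g (u%:Z + o.1))%:Z + o'.1) = ordz g (u%:Z + (o + o').1).
  by rewrite ordzDl /= addrA.
apply: (gl_eltM torus_prim tM
  (gamma := fun p q => rchar z (torus_phi q).1 (torus_phi p).2)) => {}p {}q u.
rewrite amulZl amulZr (qmonoM theta_neq0) !scalerA.
have -> : (p.2.2, ((u%:Z + p.2.1) %/ g.+1)%Z) +
    (q.2.2, (((ordz g (u%:Z + p.2.1))%:Z + q.2.1) %/ g.+1)%Z) =
    ((p.2 + q.2).2, ((u%:Z + (p.2 + q.2).1) %/ g.+1)%Z).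
  rewrite -[RHS]/(p.2.2 + q.2.2, ((u%:Z + (p.2.1 + q.2.1)) %/ g.+1)%Z).
  by rewrite addrA -[in RHS]ordz_divDl.
congr (_ *: _); rewrite rchar_ordz // /rchar /tgl_coef /= exprnP !exprz_exp.
rewrite invr_expz -!expfzDr ?(prim_neq0 zP) //.
set c := ((u%:Z + _) %/ _)%Z.
have cE : u%:Z + p.2.1 = c * g.+1 + (ordz g (u%:Z + p.2.1))%:Z.
  by rewrite ordzE -divz_eq.
(* The exponents differ by [q.1 * c] times N, because the row reached after the shift is reduced
   modulo [g.+1]. *)
rewrite -(prim_expzDM _ (q.1%:Z * c)); congr (_ ^ _).
move: cE; set w := (ordz g _)%:Z => cE.
have -> : p.2.1 = c * g.+1 + w - u%:Z by rewrite -cE addrC addKr.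
by rewrite nEz; ring.
Qed.

Lemma tgl_basis :
  graded_basis predT +%R (fun p q => heis_com z (torus_phi p) (torus_phi q)) tgl_elt.
Proof.
split; last first.
  move=> p q _ _; rewrite -[LHS]/(mmul _ _ - mmul _ _) !tgl_mul scalerBl.
  by rewrite [q + p]addrC.
apply: gl_elt_basis; [exact: torus_prim | exact: g0 | move=> u v].
apply: (basis_pull (phi := fun o : int * int => (o.2, ((u%:Z + o.1) %/ g.+1)%Z))
  (qmono_basis theta_neq0)).
- by move=> o; rewrite expfz_neq0 ?(prim_neq0 zP).
- move=> [j b] [j' b']; rewrite !ordz_ord => /eqP e /eqP e' [bb dd]; congr (_, _) => //.
  by apply: (addrI u%:Z); rewrite (divz_eq (_ + j) g.+1) dd -e e' -divz_eq.
- move=> [b c]; exists (v%:Z - u%:Z + c * g.+1%:Z, b); rewrite /= addrA.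
  rewrite [u%:Z + _]addrC subrK addrC; split.
    by rewrite ordz_ord modzMDl.
  by rewrite divzMDl // divz_small ?addr0 //= ltz_nat ltn_ord.
Qed.

Lemma sl_qtorus_basis : exists B : J -> sl g.+1 (qtorus theta),
  graded_basis (@heis_supp n \o torus_phi) +%R
    (fun p q => heis_com z (torus_phi p) (torus_phi q)) B.
Proof.
have [] := @heis_derived_basis k n z zP _ torus_phi torus_phiD1 _ _ _ _ tgl_basis => //.
- by move=> p; have [x <-] := torus_phi_onto p; exists x.
- by move=> B [BB _]; exists B.
Qed.

End SlQuantumTorus.

(** * The index group of the loop algebras *)

Section LoopRoots.
Variables (k : fieldType) (zeta : nat -> k).
Hypothesis zeta_prim : forall m, (0 < m)%N -> m.-primitive_root (zeta m).
Hypothesis zeta_compat : forall m n, (0 < m)%N -> (0 < n)%N ->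
  zeta (m * n)%N ^+ n = zeta m.

Lemma zeta_neq0 m : (0 < m)%N -> zeta m != 0.
Proof. by case: m => // m _; apply: (prim_neq0 (zeta_prim (ltn0Sn m))). Qed.

(** Compatibility of the family makes both roots powers of the single root of order N m. *)
Lemma zeta_expz_eq (N m : nat) (x y : int) : (0 < N)%N -> (0 < m)%N ->
  (zeta N ^ x == zeta m ^ y) = ((N * m)%N%:Z %| x * m - y * N)%Z.
Proof.
move=> N0 m0; have Nm0 : (0 < N * m)%N by rewrite muln_gt0 N0.
rewrite -(zeta_compat N0 m0) -{1}(zeta_compat m0 N0) [(m * N)%N]mulnC.
rewrite !exprnP !exprz_exp [m%:Z * x]mulrC [N%:Z * y]mulrC.
have := zeta_prim Nm0; case: (N * m)%N Nm0 => // M _ wP.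
by rewrite (prim_expz_eq wP) eqz_mod_dvd.
Qed.

(** Once the roots are compared, the common factor d g cancels. The integer [b] becomes a loop
    coordinate independent of the period. *)
Lemma zeta_loop_eq (d g m : nat) (r i l : int) : (0 < d)%N -> (0 < g)%N -> (0 < m)%N ->
  reflect (exists b : int, l = - (m%:Z * b) /\ (b = i * r %[mod d])%Z)
    (zeta (d * g) ^ (i * - (g%:Z * r)) == zeta (d * m) ^ l).
Proof.
move=> d0 g0 m0; rewrite zeta_expz_eq ?muln_gt0 ?d0 //.
have -> : i * - (g%:Z * r) * (d * m)%N - l * (d * g)%N =
    (d * g)%N%:Z * - (m%:Z * (i * r) + l) by rewrite !PoszM; ring.
rewrite (PoszM (d * g) (d * m)) dvdz_mul2l; last first.
  by rewrite eqz_nat -lt0n muln_gt0 d0.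
apply: (iffP dvdzP) => [[t tE]|[b [-> /eqP]]].
  exists (i * r + t * d); split; last by rewrite addrC modzMDl.
  have -> : l = - (m%:Z * (i * r)) - - (m%:Z * (i * r) + l) by ring.
  by rewrite tE PoszM; ring.
rewrite eqz_mod_dvd => /dvdzP[t tE]; exists t.
by rewrite -[b](subrK (i * r)) tE PoszM; ring.
Qed.

End LoopRoots.

Section LoopTorus.
Variables (k : fieldType) (zeta : nat -> k).
Hypothesis zeta_prim : forall m, (0 < m)%N -> m.-primitive_root (zeta m).
Hypothesis zeta_compat : forall m n, (0 < m)%N -> (0 < n)%N ->
  zeta (m * n)%N ^+ n = zeta m.
Variables (n g d : nat) (q r i0 : int).
Hypothesis n0 : (0 < n)%N.
Hypothesis nE : n.+1 = (d * g.+1)%N.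
Hypothesis qE : q = g.+1%:Z * r.
Hypothesis ri0 : (r * i0 = 1 %[mod d])%Z.
Local Notation J := ('I_g.+1 * (int * int))%type.
Local Notation z := (zeta n.+1).
Local Notation phi := (torus_phi n d i0).

Let zP : n.+1.-primitive_root z. Proof. exact: zeta_prim. Qed.

Let d0 : (0 < d)%N. Proof. by move: nE; case: d. Qed.

Let nEz : n.+1%:Z = d%:Z * g.+1%:Z. Proof. by rewrite nE PoszM. Qed.

Lemma torus_phi_mod (x : J) : (x.2.2 = (phi x).1%:Z * r %[mod d])%Z.
Proof.
rewrite /= ordzE nEz; apply/eqP; rewrite eq_sym.
have -> t : (t %% (d%:Z * g.+1%:Z))%Z = t + (- (t %/ (d%:Z * g.+1%:Z))%Z * g.+1) * d.
  by rewrite /modz; ring.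
set u := - _ * _; have -> : (d%:Z * x.1 + i0 * x.2.2 + u * d) * r =
  ((x.1%:Z + u) * r) * d + r * i0 * x.2.2 by ring.
by rewrite modzMDl -modzMml ri0 modzMml mul1r.
Qed.

(** [torus_phi] alone loses [b], of which it knows only the class modulo d; the loop exponent
    supplies [b], and then d a modulo d (g + 1) determines a. *)
Lemma torus_phi_inj (x y : J) : phi x = phi y -> x.2.2 = y.2.2 -> x = y.
Proof.
case: x y => a [j b] [a' [j' b']] /= [/eqP + ->] bb; rewrite bb ordz_eq.
rewrite eqz_mod_dvd opprD addrACA subrr addr0 -mulrBr nEz dvdz_mul2l -?lt0n // => e.
by rewrite -[a]ordzK -[a']ordzK; congr (_, _); apply/eqP; rewrite ordz_eq eqz_mod_dvd.
Qed.

Lemma autz_heis_eigen (S : nalgType k) (I : eqType) (b : I -> S) (f : I -> 'I_n.+1)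
    (s : aut S) :
  (forall p, s (b p) = rchar z (f p) (-1) *: b p) ->
  forall p, autz s q (b p) = rchar z (f p) (- q) *: b p.
Proof.
move=> sb p; rewrite (autz_eigen q _ (sb p)) ?(rchar_neq0 zP) //.
by congr (_ *: _); rewrite /rchar exprz_exp; congr (_ ^ _); ring.
Qed.

Lemma period_dvd (S : nalgType k) (I : eqType) (P : pred I) (b : I -> S)
    (s : aut S) (p : I) (x : int) (m : nat) :
  is_basis P b -> P p -> s (b p) = z ^ x *: b p -> has_period s m ->
  (n.+1%:Z %| x * m)%Z.
Proof.
move=> bP Pp sb [_ per]; rewrite -(prim_expz_eq1 zP) -exprz_exp.
have := per (b p); rewrite (autn_eigen _ sb) => e.
apply/eqP/subr0_eq; apply: contrapT => /eqP c0; apply: (basis_neq0 bP Pp).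
by rewrite -[b p](scalerK c0) scalerBl scale1r -exprnP e subrr scaler0.
Qed.

(** The vector with residue 1 has eigenvalue z^(-q), of order d because r is invertible modulo d. *)
Lemma autz_period_dvd (S : nalgType k) (I : eqType) (P : pred I) (b : I -> S)
    (f : I -> 'I_n.+1) (s : aut S) (p : I) (m : nat) :
  is_basis P b -> P p -> f p = ordz n 1 ->
  (forall p, s (b p) = rchar z (f p) (-1) *: b p) ->
  has_period (autz s q) m -> exists2 m', (0 < m')%N & m = (d * m')%N.
Proof.
move=> bP Pp fp sb per.
have := period_dvd bP Pp (autz_heis_eigen sb p) per.
have -> : (f p)%:Z = 1 by rewrite fp ordzE modz_small.
rewrite mul1r qE nEz mulNr -mulNr => /dvdzP[t tE].
have {}tE : r * m%:Z = - t * d%:Z.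
  by apply: (@mulfI _ g.+1%:Z) => //; rewrite mulrA; apply: oppr_inj; rewrite -mulNr tE; ring.
have /eqP := ri0; rewrite eqz_mod_dvd => /dvdzP[v vE].
have : (d%:Z %| m%:Z)%Z.
  apply/dvdzP; exists (- (t * i0) - v * m%:Z).
  rewrite mulrBl mulrAC -vE -[X in X - _](_ : r * m%:Z * i0 = _); last by rewrite tE; ring.
  by ring.
rewrite dvdzE /= => /dvdnP[m' mE]; exists m'; last by rewrite mulnC.
by case: per; rewrite mE muln_gt0 => /andP[].
Qed.

Local Notation torus_graded B :=
  (graded_basis (@heis_supp n \o phi) +%R (fun x y : J => heis_com z (phi x) (phi y)) B).

Lemma loop_torus_basis (S : nalgType k) (b : 'I_n.+1 * int -> S) (s : aut S) (m : nat) :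
  graded_basis (@heis_supp n) +%R (heis_com z) b ->
  (forall p, s (b p) = rchar z p.1 (-1) *: b p) ->
  has_period (autz s q) m ->
  exists B : J -> loop zeta (autz s q) m, torus_graded B.
Proof.
move=> bb sb per.
have supp1 : heis_supp (ordz n 1, 0).
  rewrite /heis_supp dvdz0 andbT -val_eqE /= -eqz_nat ordzE.
  by rewrite modz_small.
have [m' m'0 mE] := autz_period_dvd bb.1 supp1 erefl sb per.
have [m0 _] := per.
have chiM (p p' : 'I_n.+1 * int) :
    rchar z (p + p').1 (- q) = rchar z p.1 (- q) * rchar z p'.1 (- q).
  exact: (rcharDl zP).
have [b' bb'] := @loop_basis k zeta S _ _ _ _ _ bb (autz s q) m
  (fun p => rchar z p.1 (- q)) (zeta_neq0 zeta_prim m0)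
  (fun p _ => autz_heis_eigen sb p) chiM.
have chiP (i : 'I_n.+1) (l : int) :
    reflect (exists b : int, l = - (m'%:Z * b) /\ (b = i%:Z * r %[mod d])%Z)
      (rchar z i (- q) == zeta m ^ l).
  have := @zeta_loop_eq k zeta zeta_prim zeta_compat d g.+1 m' r i l d0 isT m'0.
  by rewrite -nE -qE -mE.
(* The loop exponent is expressed through [b], so the period disappears from the index set. *)
pose psi (x : J) := (phi x, - (m'%:Z * x.2.2)).
exists (b' \o psi).
apply: graded_basis_eq (graded_basis_reindex (phi := psi) (opJ := +%R)
  (PJ := fun x => heis_supp (phi x)) bb' _ _ _ _) _ _ => //.
- move=> x /=; case: chiP => [_|[]]; first by rewrite andbT.
  by exists x.2.2; split; last exact: torus_phi_mod.
- move=> x y _ [pe je /oppr_inj be]; apply: torus_phi_inj.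
    by rewrite /torus_phi pe je.
  by apply: mulfI be; rewrite eqz_nat -lt0n.
- move=> [[i j] l] /= /andP[_ /chiP[b0 [-> b0E]]].
  by have [a aE] := torus_phi_pull nE ri0 j b0E; exists (a, (j, b0)); rewrite /psi aE.
- move=> x y; congr (_, _); last by rewrite /= -opprD -mulrDr.
  by rewrite -[phi (x + y)]/(_, _); congr (_, _); exact: (torus_phiD1 _ nE).
Qed.

Lemma loop2_torus_basis (S : nalgType k) (b : 'I_n.+1 * 'I_n.+1 -> S) (s1 s2 : aut S)
    (m1 m2 : nat) :
  graded_basis (@heis_supp n \o @ord_pair n) +%R
    (fun p p' => heis_com z (ord_pair p) (ord_pair p')) b ->
  (forall p, s1 (b p) = z ^ (- p.2%:Z) *: b p) ->
  (forall p, s2 (b p) = rchar z p.1 (-1) *: b p) ->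
  has_period s1 m1 -> has_period (autz s2 q) m2 ->
  exists B : J -> loop2 zeta s1 (autz s2 q) m1 m2, torus_graded B.
Proof.
move=> bb sb1 sb2 per1 per2.
have supp1 : (@heis_supp n \o @ord_pair n) (ordz n 1, 0).
  rewrite /= /heis_supp dvdz0 andbT -val_eqE /= -eqz_nat ordzE.
  by rewrite modz_small.
have [m2' m2'0 m2E] := autz_period_dvd bb.1 supp1 erefl sb2 per2.
have [m10 _] := per1; have [m20 _] := per2.
(* The index (0, 1) is in the support as N > 1, and its eigenvalue z^(-1) has order N, so N divides
   [m1]. *)
have [m1' m1E] : exists m1', m1 = (n.+1 * m1')%N.
  have supp2 : (@heis_supp n \o @ord_pair n) (0, ordz n 1).
    rewrite /= /heis_supp eqxx /= dvdzE /= -[X in (_ %| X)%N]/(`|(ordz n 1)%:Z|%N).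
    by rewrite ordzE modz_small // dvdn1 /= eqSS -lt0n.
  have := period_dvd bb.1 supp2 (sb1 _) per1; rewrite /= ordzE modz_small //.
  by rewrite dvdzE abszM /= mul1n => /dvdnP[t ->]; exists t; rewrite mulnC.
have chi1P (j l : int) :
    reflect (exists b : int, l = - (m1'%:Z * b) /\ (b = j %[mod n.+1])%Z)
      (z ^ (- j) == zeta m1 ^ l).
  have := @zeta_loop_eq k zeta zeta_prim zeta_compat n.+1 1 m1' 1 j l.
  rewrite muln1 m1E !mulr1 mulrN1; apply=> //.
  by move: m10; rewrite m1E muln_gt0 => /andP[].
have chi2P (i : 'I_n.+1) (l : int) :
    reflect (exists b : int, l = - (m2'%:Z * b) /\ (b = i%:Z * r %[mod d])%Z)
      (rchar z i (- q) == zeta m2 ^ l).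
  have := @zeta_loop_eq k zeta zeta_prim zeta_compat d g.+1 m2' r i l d0 isT m2'0.
  by rewrite -nE -qE -m2E.
have m1'0 : m1'%:Z != 0.
  by rewrite eqz_nat -lt0n; move: m10; rewrite m1E muln_gt0 => /andP[].
have chi1M (p p' : 'I_n.+1 * 'I_n.+1) :
    z ^ (- (p + p').2%:Z) = z ^ (- p.2%:Z) * z ^ (- p'.2%:Z).
  rewrite -expfzDr ?(prim_neq0 zP) // -opprD.
  have [t ->] := ordD_int p.2 p'.2.
  have -> : - (p.2%:Z + p'.2%:Z + t * n.+1) = - (p.2%:Z + p'.2%:Z) + (- t) * n.+1 by ring.
  exact: (prim_expzDM zP).
have chi2M (p p' : 'I_n.+1 * 'I_n.+1) :
    rchar z (p + p').1 (- q) = rchar z p.1 (- q) * rchar z p'.1 (- q).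
  exact: (rcharDl zP).
have [b' bb'] := @loop2_basis k zeta S _ _ _ _ _ bb s1 (autz s2 q) m1 m2
  (fun p => z ^ (- p.2%:Z)) (fun p => rchar z p.1 (- q))
  (zeta_neq0 zeta_prim m10) (zeta_neq0 zeta_prim m20)
  (fun p _ => sb1 p) (fun p _ => autz_heis_eigen sb2 p) chi1M chi2M.
pose psi (x : J) := (((phi x).1, ordz n (phi x).2),
  (- (m1'%:Z * x.2.1), - (m2'%:Z * x.2.2))).
have ord_mod (j : int) : (j = ordz n j %[mod n.+1])%Z by rewrite ordzE modz_mod.
exists (b' \o psi).
apply: graded_basis_eq (graded_basis_reindex (phi := psi) (opJ := +%R)
  (PJ := fun x => heis_supp (phi x)) bb' _ _ _ _) _ _.
- move=> x; rewrite /= -[torus_phi _ _ _ x]/(_, _).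
  case: chi1P => [_|[]]; last by exists x.2.1; split; last exact: ord_mod.
  case: chi2P => [_|[]]; last by exists x.2.2; split; last exact: torus_phi_mod.
  rewrite /heis_supp /= andbT; congr (~~ (_ && _)).
  by rewrite -[in LHS](subr0 x.2.1) -[in RHS](subr0 (_%:Z)) -!eqz_mod_dvd ordzE modz_mod.
- move=> x y _ [pe _ /oppr_inj je /oppr_inj be]; apply: torus_phi_inj.
    by rewrite /torus_phi pe (mulfI m1'0 je).
  by apply: mulfI be; rewrite eqz_nat -lt0n.
- move=> [[i j] [l1 l2]] /= /andP[_ /andP[/chi1P[j0 [-> j0E]] /chi2P[b0 [-> b0E]]]].
  have [a aE] := torus_phi_pull nE ri0 j0 b0E; exists (a, (j0, b0)); rewrite /psi aE /=.
  by congr ((_, _), _); rewrite -[RHS]ordzK; apply/eqP; rewrite ordz_eq; apply/eqP.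
- move=> x y; congr ((_, _), (_, _)).
  + exact: (torus_phiD1 _ nE).
  + exact: ordzD.
  + by rewrite /= -opprD -mulrDr.
  + by rewrite /= -opprD -mulrDr.
- by [].
- move=> x y; rewrite /heis_com /=; congr (_ - _); apply: (rchar_mod zP);
    exact/esym/ord_mod.
Qed.

End LoopTorus.

(** * A representation of the affine Kac-Moody algebra *)

Section CommutatorAlgebra.
Variables (k : fieldType) (V : lmodType k).

(** A second copy of the operators, on which the product is the commutator instead of
    composition. *)
Definition lendo : Type := endo V.
HB.instance Definition _ := GRing.Lmodule.on lendo.
Implicit Types f g h : lendo.

Definition lendo_br f g : lendo := endo_comp f g - endo_comp g f.

Fact lendo_br_linl a f g h :
  lendo_br (a *: f + g) h = a *: lendo_br f h + lendo_br g h.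
Proof. by rewrite /lendo_br endo_comp_linl endo_comp_linr scalerBr opprD addrACA. Qed.

Fact lendo_br_linr a f g h :
  lendo_br h (a *: f + g) = a *: lendo_br h f + lendo_br h g.
Proof. by rewrite /lendo_br endo_comp_linl endo_comp_linr scalerBr opprD addrACA. Qed.

HB.instance Definition _ := isNalgebra.Build k lendo lendo_br_linl lendo_br_linr.

Fact lendo_brxx f : amul f f = 0 :> lendo.
Proof. exact: subrr. Qed.

Fact lendo_jacobi f g h :
  amul f (amul g h) + amul g (amul h f) + amul h (amul f g) = 0 :> lendo.
Proof.
have brE f' g' h' : amul f' (amul g' h') = endo_comp f' (endo_comp g' h') -
    endo_comp f' (endo_comp h' g') - (endo_comp g' (endo_comp h' f') -
    endo_comp h' (endo_comp g' f')) :> lendo.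
  rewrite -[LHS]/(amul (f' : endo V) (amul (g' : endo V) h' - amul (h' : endo V) g') -
    amul (amul (g' : endo V) h' - amul (h' : endo V) g') (f' : endo V)).
  by rewrite amulBr amulBl; congr (_ - _ - (_ - _)); exact: endo_ext.
rewrite !brE !opprB !addrA.
(* The twelve terms of the Jacobi identity cancel in pairs. *)
rewrite (ACl ((1*12)*(7*2)*(3*10)*(5*4)*(11*6)*(9*8)))/=.
by rewrite !subrr !addr0.
Qed.

End CommutatorAlgebra.

Section FreeFamilies.
Variables (k : fieldType) (U : vectType k) (n : nat).

(** Applied to the coroots, it supplies the initial value, at the integer 0, of the diagonal action
    of the Cartan subalgebra. *)
Lemma free_functional (x : 'I_n -> U) (c : 'I_n -> k) :
  free [seq x i | i : 'I_n] -> exists f : {linear U -> k^o}, forall i, f (x i) = c i.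
Proof.
move=> fx; pose X := [tuple x i | i < n].
have fX : free X by rewrite [X in free X](_ : _ = [seq x i | i : 'I_n]).
pose f (v : U) : k^o := \sum_i coord X i v * c i.
have flin : linear f.
  move=> a u v; rewrite /f scaler_sumr -big_split; apply: eq_bigr => i _ /=.
  by rewrite linearP mulrDl -[RHS]/(a * (_ * _) + _) mulrA.
pose F : {linear U -> k^o} := HB.pack f (GRing.isLinear.Build k U k^o *:%R f flin).
exists F => i; rewrite /= /f (bigD1 i) //= big1 => [|j ji].
  have -> : x i = X`_i by rewrite (nth_map i) ?size_enum_ord // nth_ord_enum.
  by rewrite coord_free // eqxx mul1r addr0.
have -> : x i = X`_i by rewrite (nth_map i) ?size_enum_ord // nth_ord_enum.
by rewrite coord_free // eq_sym (negPf ji) mul0r.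
Qed.

(** The matrix of independent forms in a basis has a right inverse. For the simple roots, the vector
    found is the element that induces the principal grading. *)
Lemma free_dual_vector (f : 'I_n -> 'Hom(U, k^o)) :
  free [seq f i | i : 'I_n] -> exists x : U, forall i, f i x = 1.
Proof.
move=> ff; pose D := \dim {: U}; pose e := vbasis {: U}.
pose M : 'M[k]_(n, D) := \matrix_(i, j) f i e`_j.
have fE v i : f i v = \sum_(j < D) coord e j v * f i e`_j.
  have {1}-> : v = \sum_(j < D) coord e j v *: e`_j.
    by apply: coord_vbasis; exact: memvf.
  by rewrite linear_sum; apply: eq_bigr => j _; rewrite linearZ.
have Mfree : row_free M.
  apply/inj_row_free => u uM.
  have : \sum_i u 0 i *: f i = 0.
    apply/lfunP => v; rewrite sum_lfunE lfunE /=.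
    under eq_bigr do rewrite lfunE /= fE scaler_sumr.
    rewrite exchange_big big1 //= => j _.
    transitivity (coord e j v * (u *m M) 0 j); last by rewrite uM mxE mulr0.
    rewrite mxE mulr_sumr; apply: eq_bigr => i _; rewrite mxE.
    by rewrite -[LHS]/(_ * (_ * _)) mulrCA.
  move=> u0; apply/rowP => i; rewrite mxE.
  pose X := [tuple f i | i < n].
  have fX : free X by rewrite [X in free X](_ : _ = [seq f i | i : 'I_n]).
  have /freeP h := fX; apply: (h (fun i => u 0 i)); rewrite -[RHS]u0; apply: eq_bigr => j _.
  by rewrite (nth_map j) ?size_enum_ord // nth_ord_enum.
pose w := pinvmx M *m const_mx 1 : 'cV[k]_D.
exists (\sum_(j < D) w j 0 *: e`_j) => i.
transitivity ((M *m w) i 0).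
  rewrite linear_sum mxE; apply: eq_bigr => j _.
  by rewrite linearZ [M i j]mxE mulrC.
by rewrite mulmxA mulmxVp // mul1mx mxE.
Qed.

End FreeFamilies.

(** * Operators supported on one diagonal *)

Section BandOperators.
Variable k : fieldType.
Let V := (int -> k^o)%type.
Implicit Types (j : int) (a : int -> k).

Definition band_fun j a (v : V) : V := fun p => a p *: v (p + j).

Fact band_linear j a : band_fun j a \in @linear_pred k V.
Proof.
apply/linear_predP => c v w; apply/funext => p; rewrite /band_fun.
rewrite -[LHS]/(_ *: (c *: v _ + w _)) -[RHS]/(c *: (_ *: v _) + _ *: w _).
by rewrite scalerDr !scalerA mulrC.
Qed.

Definition band j a : lendo V := Endo (band_linear j a).

Lemma band_ext j a a' : a =1 a' -> band j a = band j a'.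
Proof. by move=> /funext ->. Qed.

Lemma bandZ j c a : c *: band j a = band j (fun p => c * a p).
Proof.
apply: endo_ext => v; apply/funext => p.
by rewrite -[LHS]/(c *: (_ *: _)) scalerA.
Qed.

Lemma bandD j a a' : band j a + band j a' = band j (fun p => a p + a' p).
Proof.
apply: endo_ext => v; apply/funext => p.
by rewrite -[LHS]/(_ *: _ + _ *: _) -scalerDl.
Qed.

Lemma band0 j : band j (fun=> 0) = 0.
Proof. by apply: endo_ext => v; apply/funext => p; rewrite -[LHS]/(0 *: _) scale0r. Qed.

Lemma band_sum (I : Type) (r : seq I) (F : I -> int -> k) j :
  \sum_(i <- r) band j (F i) = band j (fun p => \sum_(i <- r) F i p).
Proof.
elim: r => [|i r ih]; last first.
  by rewrite big_cons ih bandD; apply: band_ext => p; rewrite big_cons.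
by rewrite big_nil -(band0 j); apply: band_ext => p; rewrite big_nil.
Qed.

Lemma band_inj j a a' : band j a = band j a' -> a =1 a'.
Proof.
move=> e p; have := congr1 (fun f : endo V => f (fun=> 1) p) e.
by rewrite -[X in X = _]/(a p * 1) -[X in _ = X]/(a' p * 1) !mulr1.
Qed.

Lemma band_br j a j' a' : amul (band j a) (band j' a') =
  band (j + j') (fun p => a p * a' (p + j) - a' p * a (p + j')).
Proof.
apply: endo_ext => v; apply/funext => p.
rewrite -[LHS]/(a p * (a' (p + j) * v (p + j + j')) - a' p * (a (p + j') * v (p + j' + j))).
rewrite -[RHS]/((_ - _) * v (p + (j + j'))) -!addrA [j' + j]addrC; ring.
Qed.

Variables (n : nat) (z : k).
Hypothesis zP : n.+1.-primitive_root z.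
Hypothesis n0 : n.+1%:R != 0 :> k.
Local Notation I := ('I_n.+1 * int)%type.

Definition bchar (p : I) : lendo V := band p.2 (rchar z p.1).

Lemma bcharM p q : amul (bchar p) (bchar q) = heis_com z p q *: bchar (p + q).
Proof.
rewrite band_br bandZ; apply: band_ext => x.
by rewrite !(rcharDr zP) /= (rcharDl zP) /heis_com; ring.
Qed.

(** Applied to the point mass at u + j and evaluated at u, the combination keeps only the terms of
    shift j; letting u run over the residues, [rchar_free] separates the characters. *)
Lemma bchar_free s : lincomb bchar s = 0 -> forall p, coef s p = 0.
Proof.
move=> s0 [i j]; apply: (rchar_free zP n0 (f := fun i => coef s (i, j))) => u.
pose v : V := fun l => (l == u%:Z + j)%:R.
have : (lincomb bchar s : endo V) v u%:Z = 0 by rewrite s0.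
rewrite /lincomb endo_sum.
have Vsum (F : k * I -> V) l : (\sum_(q <- s) F q) l = \sum_(q <- s) F q l.
  by elim/big_rec2: _ => // q _ y _ <-.
rewrite Vsum => tc; rewrite -[RHS]tc.
under eq_bigr do rewrite /coef mulr_suml.
rewrite (exchange_big_dep (fun p => p.2.2 == j)) /=; last by move=> l p _ /eqP ->.
rewrite big_mkcond; apply: eq_bigr => -[a [l j']] _ /=.
rewrite -[RHS]/(a * (rchar z l u * (u%:Z + j' == u%:Z + j)%:R)).
rewrite (inj_eq (addrI _)); case: eqP => [->|_]; last by rewrite !mulr0.
rewrite mulr1 (bigD1 l) //= big1 ?addr0 // => h /andP[].
by rewrite xpair_eqE => /andP[/eqP -> _] /eqP.
Qed.

Lemma rchar_sum_dual (p q : int) :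
  \sum_(l < n.+1) rchar z l p * rchar z l (- q) = (ordz n p == ordz n q)%:R * n.+1%:R.
Proof.
rewrite -(rchar_sum zP); apply: eq_bigr => l _.
have pE : (p = ordz n p %[mod n.+1])%Z by rewrite ordzE modz_mod.
have qE : (- q = - (ordz n q)%:Z %[mod n.+1])%Z.
  by apply/eqP; rewrite eqz_mod_dvd opprK addrC -eqz_mod_dvd ordzE modz_mod.
rewrite (rchar_mod zP l pE) (rchar_mod zP l qE) /rchar !mulrN.
by rewrite [l%:Z * _]mulrC ![l%:Z * _]mulrC.
Qed.

(** Fourier expansion of the N-periodic delta function, used to write the Chevalley generators in
    the basis [bchar]. *)
Lemma rchar_sum_delta (p q : int) :
  \sum_(l < n.+1) (n.+1%:R^-1 * rchar z l (- q)) * rchar z l p = (ordz n p == ordz n q)%:R.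
Proof.
rewrite -[RHS](mulfK n0) -rchar_sum_dual mulrC mulr_sumr.
by apply: eq_bigr => l _; rewrite -mulrA [rchar z l p * _]mulrC.
Qed.

End BandOperators.

Section KacMoodyRep.
Variables (k : fieldType) (n : nat) (R : realization k (affA n)).
Local Notation h := (cartan R).
Local Notation V := (int -> k^o)%type.
Local Notation T := (km_tilde R).
Local Notation H x := (kmt_gen R (KH x)).
Local Notation e i := (kmt_gen R (KE i)).
Local Notation f i := (kmt_gen R (KF i)).

Definition delta (i : 'I_n.+1) (p : int) : k := (ordz n p == i)%:R.

Definition band_e i : lendo V := band 1 (delta i).
Definition band_f i : lendo V := band (-1) (fun p => delta i (p - 1)).

(** The Cartan matrix is a second difference of the periodic delta function; this form is uniform in
    [n] and covers N = 2, where the two neighbours coincide. *)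
Lemma affA_delta (i : 'I_n.+1) (p : int) :
  (affA n i (ordz n p))%:~R =
    (delta i p - delta i (p - 1)) - (delta i (p + 1) - delta i p) :> k.
Proof.
rewrite mxE /delta.
have eS : ordS i = ordz n (i%:Z + 1).
  by apply/val_inj/eqP; rewrite -eqz_nat ordzE -modz_nat -addn1 PoszD.
have eS' : ordS (ordz n p) = ordz n (p + 1).
  apply/val_inj/eqP; rewrite -eqz_nat ordzE -[X in X == _]modz_nat.
  by rewrite -addn1 PoszD ordzE modzDml.
have -> : (ordz n p == ordS i) = (ordz n (p - 1) == i).
  rewrite eS -[i in RHS]ordzK !ordz_eq !eqz_mod_dvd; congr (_ %| _)%Z; ring.
rewrite eS' ![i == _]eq_sym !rmorphB /= -mul2n PoszM rmorphM /= -!pmulrn.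
ring.
Qed.

(** The bracket of [h] with [e_i] forces the recursion in p, so only the value at 0 is free. It is
    chosen on the coroots to match the bracket of [e_i] and [f_i], and [affA_delta] carries the
    agreement to every p. *)
Lemma cartan_diag : exists lam : h -> int -> k,
  [/\ forall a x y p, lam (a *: x + y) p = a * lam x p + lam y p,
      forall x p, lam x (p + 1) = lam x p - Defs.root R (ordz n p) x &
      forall i p, lam (coroot R i) p = delta i p - delta i (p - 1)].
Proof.
have [nu nuE] := free_functional (fun i => delta i 0 - delta i (0 - 1)) (coroot_free R).
pose lam (x : h) (p : int) : k := match p with
  | Posz m => nu x - \sum_(l < m) (Defs.root R (ordz n l) x : k)
  | Negz m => nu x + \sum_(l < m.+1) (Defs.root R (ordz n (- l.+1%:Z)) x : k)
  end.
have lamS x p : lam x (p + 1) = lam x p - Defs.root R (ordz n p) x.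
  case: p => [m|[|m]].
  - by rewrite -PoszD addn1 /= big_ord_recr /= opprD addrA.
  - by rewrite /= big_ord0 subr0 big_ord1 addrK.
  - have -> : Negz m.+1 + 1 = Negz m by lia.
    by rewrite /= [in RHS]big_ord_recr /= addrA NegzE addrK.
exists lam; split=> //.
- move=> a x y; have rootL i : (Defs.root R i (a *: x + y) : k) =
    a * (Defs.root R i x : k) + (Defs.root R i y : k) by rewrite linearP.
  elim/int_rect=> [|m ih|m ih].
  + by rewrite /= !big_ord0 !subr0 linearP.
  + have eqp : m.+1%:Z = m%:Z + 1 by lia.
    by rewrite eqp !lamS ih rootL; ring.
  + have eqm : - m%:Z = - m.+1%:Z + 1 by lia.
    have := ih; rewrite eqm !lamS rootL => ih'.
    apply: (addIr (- (a * (Defs.root R (ordz n (- m.+1%:Z)) x : k) +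
      (Defs.root R (ordz n (- m.+1%:Z)) y : k)))).
    by rewrite ih'; ring.
- move=> i; elim/int_rect=> [|m ih|m ih].
  + by rewrite /= big_ord0 subr0 nuE.
  + have eqp : m.+1%:Z = m%:Z + 1 by lia.
    by rewrite eqp lamS ih root_coroot affA_delta addrK; ring.
  + have eqm : - m%:Z = - m.+1%:Z + 1 by lia.
    apply: (addIr (- (Defs.root R (ordz n (- m.+1%:Z)) (coroot R i) : k))).
    have eqp : - m%:Z - 1 = - m.+1%:Z by lia.
    by rewrite -lamS -eqm ih root_coroot affA_delta -eqm eqp; ring.
Qed.

End KacMoodyRep.

Section KacMoodyTilde.
Variables (k : fieldType) (n : nat) (A : 'M[int]_n) (R : realization k A).
Local Notation h := (cartan R).
Local Notation T := (km_tilde R).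
Local Notation KR := (@km_rel k n A R).
Local Notation H x := (@kmt_gen k n A R (KH x)).
Local Notation e i := (@kmt_gen k n A R (KE i)).
Local Notation f i := (@kmt_gen k n A R (KF i)).
Implicit Types (x y : T) (w : h) (i j : 'I_n).

Lemma km_relE s t : KR s t ->
  pclass (lie_rel KR) s = pclass (lie_rel KR) t.
Proof. by move=> st; apply/pclass_eq/cong_rel/lie_base. Qed.

Lemma kmt_lin (a : k) (v w : h) : H (a *: v + w) = a *: H v + H w.
Proof. by rewrite [a *: H v]pscaleE [RHS]paddE; apply: km_relE; constructor. Qed.

Lemma kmt0 : H 0 = 0.
Proof. by have := kmt_lin (-1) 0 0; rewrite scaler0 addr0 scaleN1r addNr. Qed.

Lemma kmtZ (a : k) (v : h) : H (a *: v) = a *: H v.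
Proof. by have := kmt_lin a v 0; rewrite kmt0 !addr0. Qed.

Lemma kmtD (v w : h) : H (v + w) = H v + H w.
Proof. by have := kmt_lin 1 v w; rewrite !scale1r. Qed.

Lemma kmt_hh v w : amul (H v) (H w) = 0.
Proof. by rewrite [LHS]pmulE; apply: km_relE; constructor. Qed.

Lemma kmt_ef i j : amul (e i) (f j) = if i == j then H (coroot R i) else 0.
Proof.
rewrite [LHS]pmulE (km_relE (@km_ef _ _ _ R i j)).
by case: eqP.
Qed.

Lemma kmt_he w i : amul (H w) (e i) = (Defs.root R i w : k) *: e i.
Proof. by rewrite [LHS]pmulE [RHS]pscaleE; apply: km_relE; constructor. Qed.

Lemma kmt_hf w i : amul (H w) (f i) = - (Defs.root R i w : k) *: f i.
Proof. by rewrite [LHS]pmulE [RHS]pscaleE; apply: km_relE; constructor. Qed.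

Lemma km_ind (P : T -> Prop) :
  (forall w, P (H w)) -> (forall i, P (e i)) -> (forall i, P (f i)) ->
  P 0 -> (forall x y, P x -> P y -> P (x + y)) ->
  (forall a x, P x -> P (a *: x)) ->
  (forall x y, P x -> P y -> P (amul x y)) -> forall x, P x.
Proof.
move=> PH Pe Pf P0 PD PZ PM; elim/pind; elim=> [[w|i|i]||s Ps t Pt|a s Ps|s Ps t Pt].
- exact: PH.
- exact: Pe.
- exact: Pf.
- exact: P0.
- by rewrite -paddE; apply: PD.
- by rewrite -pscaleE; apply: PZ.
- by rewrite -pmulE; apply: PM.
Qed.

Lemma km_tilde_lift (L : nalgType k) (g : km_gen h n -> L) :
  (forall x : L, amul x x = 0) ->
  (forall x y z : L, amul x (amul y z) + amul y (amul z x) + amul z (amul x y) = 0) ->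
  (forall a v w, g (KH (a *: v + w)) = a *: g (KH v) + g (KH w)) ->
  (forall v w, amul (g (KH v)) (g (KH w)) = 0) ->
  (forall i j, amul (g (KE i)) (g (KF j)) = if i == j then g (KH (coroot R i)) else 0) ->
  (forall w i, amul (g (KH w)) (g (KE i)) = (Defs.root R i w : k) *: g (KE i)) ->
  (forall w i, amul (g (KH w)) (g (KF i)) = - (Defs.root R i w : k) *: g (KF i)) ->
  exists phi : {linear T -> L},
    (forall x y, phi (amul x y) = amul (phi x) (phi y)) /\
    forall u, phi (@kmt_gen k n A R u) = g u.
Proof.
move=> Lxx Ljac gl ghh gef ghe ghf.
apply: (@pres_lift k _ (lie_rel KR) L g) => s t; case=> {s t} /=.
- move=> s t; case=> {s t} /=; rewrite //.
  by move=> i j; rewrite gef; case: eqP.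
- by move=> s; exact: Lxx.
- by move=> s t u; exact: Ljac.
Qed.

End KacMoodyTilde.

Lemma lie_leibniz (k : fieldType) (L : lieAlgType k) (x y z : L) :
  amul x (amul y z) = amul (amul x y) z + amul y (amul x z).
Proof.
have := amul_jacobi x y z; rewrite [amul z (amul x y)]lieC [amul z x]lieC amulNr.
by move/eqP; rewrite subr_eq0 subr_eq => /eqP.
Qed.

(** Applying D minus the first eigenvalue removes one term, and induction extracts the others up to
    nonzero factors; the first term is the sum minus the rest. *)
Lemma eigen_components (k : fieldType) (V : lmodType k) (P : V -> Prop)
    (D : V -> V) (a : int -> k) (r : seq int) (c : int -> V) :
  linear D -> injective a -> (forall x y, P x -> P y -> P (x - y)) ->
  (forall b x, P x -> P (b *: x)) -> (forall x, P x -> P (D x)) ->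
  (forall j, D (c j) = a j *: c j) -> uniq r ->
  P (\sum_(j <- r) c j) -> forall j, j \in r -> P (c j).
Proof.
move=> Dl a_inj PB PZ PD; elim: r c => // l r ih c Dc /= /andP[lr ur] Pc.
have D0 : D 0 = 0 by have := Dl (-1) 0 0; rewrite scaler0 addr0 scaleN1r addNr.
have DD x y : D (x + y) = D x + D y by have := Dl 1 x y; rewrite !scale1r.
have DZ b x : D (b *: x) = b *: D x by have := Dl b x 0; rewrite D0 !addr0.
have Dsum s : D (\sum_(j <- s) c j) = \sum_(j <- s) a j *: c j.
  elim: s => [|j s ihs]; first by rewrite !big_nil.
  by rewrite !big_cons DD ihs Dc.
have Pr j : j \in r -> P (c j).
  move=> jr; have ajl : a j - a l != 0.
    by rewrite subr_eq0 (inj_eq a_inj); apply: contraNneq lr => <-.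
  rewrite -[c j]scale1r -(mulVf ajl) -scalerA; apply: (PZ).
  apply: (ih (fun j => (a j - a l) *: c j)) => //.
    by move=> j'; rewrite DZ Dc !scalerA mulrC.
  have -> : \sum_(j <- r) (a j - a l) *: c j =
    D (\sum_(j <- l :: r) c j) - a l *: \sum_(j <- l :: r) c j.
    rewrite Dsum !big_cons scalerDr opprD addrACA subrr add0r scaler_sumr -sumrB.
    by apply: eq_bigr => j' _; rewrite scalerBl.
  by apply: PB; [apply: PD | apply: PZ].
have P0 : P 0 by rewrite -(subrr (\sum_(j <- l :: r) c j)); apply: PB.
have Psum (s : seq int) : {subset s <= r} -> P (\sum_(j <- s) c j).
  elim: s => [|j s ihs] sr; first by rewrite big_nil.
  rewrite big_cons -[c j]opprK addrC -[- - _]scaleN1r scaleN1r; apply: PB.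
    by apply: ihs => x xs; apply: sr; rewrite inE xs orbT.
  by rewrite -scaleN1r; apply: PZ; apply: Pr; apply: sr; rewrite inE eqxx.
move=> j; rewrite inE => /orP[/eqP ->|]; last exact: Pr.
rewrite -[c l](addrK (\sum_(j <- r) c j)).
by apply: PB; [rewrite big_cons in Pc | exact: Psum].
Qed.

(** * Lie algebras generated by a commutative part and two opposite families *)

Section HalfGrading.
Variables (k : fieldType) (L : lieAlgType k) (I : Type) (h : Type).
(** The families are exchangeable, so each statement serves both signs of the degree. *)
Variables (H : h -> L) (a b : I -> L) (al be : I -> h -> k).
Hypothesis HD : forall v w, exists u, H v + H w = H u.
Hypothesis HZ : forall c w, exists u, c *: H w = H u.
Hypothesis H0 : exists u, 0 = H u.
Hypothesis hh : forall v w, amul (H v) (H w) = 0.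
Hypothesis ha : forall w i, amul (H w) (a i) = al i w *: a i.
Hypothesis hb : forall w i, amul (H w) (b i) = be i w *: b i.
Hypothesis ba : forall i j, exists u, amul (b i) (a j) = H u.

(* The degree [m] part of the subalgebra generated by the image of [H] and the
   [g i], each [g i] having degree 1. *)
Inductive hdeg (g : I -> L) : nat -> L -> Prop :=
  | hdeg_H w : hdeg g 0 (H w)
  | hdeg_0 m : hdeg g m 0
  | hdeg_D m x y of hdeg g m x & hdeg g m y : hdeg g m (x + y)
  | hdeg_Z m c x of hdeg g m x : hdeg g m (c *: x)
  | hdeg_step m i x of hdeg g m x : hdeg g m.+1 (amul (g i) x).

Lemma hdeg_0E g x : hdeg g 0 x -> exists w, x = H w.
Proof.
suff hm m y : hdeg g m y -> m = 0%N -> exists w, y = H w.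
  by move=> gx; exact: hm gx erefl.
elim=> {x m y} //.
- by move=> w _; exists w.
- move=> m x y _ ihx _ ihy m0; have [v ->] := ihx m0; have [w ->] := ihy m0.
  exact: HD.
- by move=> m c x _ ihx m0; have [v ->] := ihx m0; exact: HZ.
Qed.

Lemma hdeg_bracketH m x w : hdeg a m x -> hdeg a m (amul (H w) x).
Proof.
elim=> {m x}.
- by move=> v; rewrite hh; exact: hdeg_0.
- by move=> m; rewrite amul0r; exact: hdeg_0.
- by move=> m x y _ ? _ ?; rewrite amulDr; exact: hdeg_D.
- by move=> m c x _ ?; rewrite amulZr; exact: hdeg_Z.
- move=> m i x gx ih; rewrite lie_leibniz ha amulZl.
  by apply: hdeg_D; [apply: hdeg_Z; exact: hdeg_step | exact: hdeg_step].
Qed.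

(** An opposite generator lowers the degree, and from degree 0 it crosses to the other half, whence
    the case distinction. *)
Lemma hdeg_bracket_opp m i x : hdeg a m x ->
  if m is m'.+1 then hdeg a m' (amul (b i) x) else hdeg b 1 (amul (b i) x).
Proof.
elim=> {m x}.
- by move=> w; apply: hdeg_step; exact: hdeg_H.
- by case=> [|m]; rewrite amul0r; exact: hdeg_0.
- by case=> [|m] x y _ ? _ ?; rewrite amulDr; exact: hdeg_D.
- by case=> [|m] c x _ ?; rewrite amulZr; exact: hdeg_Z.
- move=> m l x gx ih; rewrite lie_leibniz; have [u ->] := ba i l.
  apply: hdeg_D; first exact: hdeg_bracketH.
  (* In degree 0 the inner bracket is a multiple of [b i], and bracketing with [a l] returns to the
     image of [H]. *)
  case: m gx ih => [gx _|m gx ih]; last exact: hdeg_step.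
  have [w ->] := hdeg_0E gx; rewrite [amul (b i) _]lieC hb amulNr amulZr lieC.
  have [v ->] := ba i l; rewrite scalerN opprK.
  by have [v' ->] := HZ (be i w) v; exact: hdeg_H.
Qed.

(** The excess r > 0 keeps every intermediate bracket in the half generated by [a]. *)
Lemma hdeg_bracket_low m r x y :
  hdeg a (m + r) x -> hdeg b m y -> (0 < r)%N -> hdeg a r (amul x y).
Proof.
move=> gx gy; elim: gy r x gx => {m y}.
- by move=> w r x gx _; rewrite lieC -scaleN1r; apply: hdeg_Z; exact: hdeg_bracketH.
- by move=> m r x _ _; rewrite amul0r; exact: hdeg_0.
- by move=> m y z _ ihy _ ihz r x gx r0; rewrite amulDr; apply: hdeg_D; auto.
- by move=> m c y _ ihy r x gx r0; rewrite amulZr; apply: hdeg_Z; auto.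
- move=> m i y gy ih r x gx r0; rewrite lie_leibniz; apply: hdeg_D.
    apply: ih => //; rewrite lieC -scaleN1r; apply: hdeg_Z.
    by rewrite addSn in gx; exact: (hdeg_bracket_opp i gx).
  have : hdeg a r.+1 (amul x y) by apply: ih => //; rewrite addnS -addSn.
  exact: (hdeg_bracket_opp i).
Qed.

Lemma hdeg1E x : hdeg a 1 x -> exists s : seq (k * I), x = \sum_(p <- s) p.1 *: a p.2.
Proof.
suff hm m y : hdeg a m y -> m = 1%N ->
    exists s : seq (k * I), y = \sum_(p <- s) p.1 *: a p.2.
  by move=> gx; exact: hm gx erefl.
elim=> {x m y} //.
- by move=> m _; exists [::]; rewrite big_nil.
- move=> m x y _ ihx _ ihy m1; have [s ->] := ihx m1; have [t ->] := ihy m1.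
  by exists (s ++ t); rewrite big_cat.
- move=> m c x _ ihx m1; have [s ->] := ihx m1.
  exists [seq (c * p.1, p.2) | p <- s]; rewrite big_map scaler_sumr.
  by apply: eq_bigr => p _; rewrite scalerA.
- move=> m i x gx _ [m0]; rewrite m0 in gx; have [w ->] := hdeg_0E gx.
  by exists [:: (- al i w, i)]; rewrite big_seq1 lieC ha scaleNr.
Qed.

(* Induction on the degree [m.+1]: for [y = [b i, y']], both [[x, b i], y'] and
   [b i, [x, y']] vanish, the latter because [[x, y']] has degree 1. *)
Lemma hdeg_ker_orth (Z : L -> Prop) :
  (forall x y, Z x -> Z (amul x y)) -> (forall x, hdeg a 1 x -> Z x -> x = 0) ->
  forall m x y, hdeg a m.+1 x -> Z x -> hdeg b m.+1 y -> amul x y = 0.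
Proof.
move=> Zbr Z1 m x y gx Zx gy.
suff : forall m' y, hdeg b m' y -> m' = m.+1 -> amul x y = 0.
  by move=> orth; exact: orth gy erefl.
elim: m x gx Zx {y gy} => [|m ih] x gx Zx m' y.
  by move=> gy _; rewrite (Z1 x gx Zx) amul0l.
elim=> {m' y} //.
- by move=> m' _; rewrite amul0r.
- by move=> m' y z _ ihy _ ihz mE; rewrite amulDr ihy ?ihz ?addr0.
- by move=> m' c y _ ihy mE; rewrite amulZr ihy ?scaler0.
- move=> m' i y gy _ [mE]; rewrite mE in gy; rewrite lie_leibniz.
  rewrite (ih (amul x (b i)) _ _ _ _ gy erefl) ?add0r.
  + rewrite (Z1 (amul x y)) ?amul0r //; last exact: Zbr.
    by apply: hdeg_bracket_low gy _; rewrite ?addn1.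
  + rewrite lieC -scaleN1r; apply: hdeg_Z; exact: (hdeg_bracket_opp i gx).
  + exact: Zbr.
Qed.

End HalfGrading.

(** * The principal grading *)

Section KacMoodyGrading.
Variables (k : fieldType) (n : nat) (A : 'M[int]_n) (R : realization k A).
Hypothesis k_char0 : [pchar k] =i pred0.
Hypothesis A_diag : forall i, A i i = 2.
Local Notation h := (cartan R).
Local Notation T := (km_tilde R).
Local Notation H := (fun w => @kmt_gen k n A R (KH w)).
Local Notation e := (fun i => @kmt_gen k n A R (KE i)).
Local Notation f := (fun i => @kmt_gen k n A R (KF i)).
Implicit Types (x y : T) (w : h).

Let rt (i : 'I_n) w : k := Defs.root R i w.
Let nrt (i : 'I_n) w : k := - rt i w.

Let HD v w : exists u, H v + H w = H u.
Proof. by exists (v + w); rewrite kmtD. Qed.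
Let HZ (c : k) w : exists u, c *: H w = H u.
Proof. by exists (c *: w); rewrite kmtZ. Qed.
Let H0 : exists u, 0 = H u.
Proof. by exists 0; rewrite kmt0. Qed.
Let hh v w : amul (H v) (H w) = 0. Proof. exact: kmt_hh. Qed.
Let he w i : amul (H w) (e i) = rt i w *: e i. Proof. exact: kmt_he. Qed.
Let hf w i : amul (H w) (f i) = nrt i w *: f i. Proof. exact: kmt_hf. Qed.
Let ef i j : exists u, amul (e i) (f j) = H u.
Proof. by rewrite kmt_ef; case: eqP => _; [exists (coroot R i) | exact: H0]. Qed.
Let fe i j : exists u, amul (f i) (e j) = H u.
Proof.
have [u uE] := ef j i; rewrite lieC uE -scaleN1r; exact: HZ.
Qed.

Local Notation up := (hdeg H e).
Local Notation dn := (hdeg H f).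

(** Both halves have the image of [H] in degree 0 ([up0_dn0]), so the negative branch starts in
    degree 1. *)
Definition kmt_deg (j : int) (x : T) : Prop :=
  match j with Posz m => up m x | Negz m => dn m.+1 x end.

Lemma up0_dn0 x : up 0 x <-> dn 0 x.
Proof.
by split=> gx; have [w ->] := hdeg_0E HD HZ H0 gx; exact: hdeg_H.
Qed.

Lemma deg_opp m x : kmt_deg (- m%:Z) x <-> dn m x.
Proof. by case: m => [|m]; [exact: up0_dn0 | rewrite -NegzE]. Qed.

Lemma deg_0 j : kmt_deg j 0. Proof. by case: j => m; exact: hdeg_0. Qed.

Lemma deg_D j x y : kmt_deg j x -> kmt_deg j y -> kmt_deg j (x + y).
Proof. by case: j => m; exact: hdeg_D. Qed.

Lemma deg_Z j c x : kmt_deg j x -> kmt_deg j (c *: x).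
Proof. by case: j => m; exact: hdeg_Z. Qed.

Lemma deg_sum j (J : Type) (r : seq J) (Q : pred J) (F : J -> T) :
  (forall l, Q l -> kmt_deg j (F l)) -> kmt_deg j (\sum_(l <- r | Q l) F l).
Proof. by move=> hF; apply: big_ind => //; [exact: deg_0 | exact: deg_D]. Qed.

Lemma deg_0E x : kmt_deg 0 x -> exists w, x = H w.
Proof. by move=> gx; exact: (hdeg_0E HD HZ H0 (gx : up 0 x)). Qed.

Lemma deg_H w : kmt_deg 0 (H w). Proof. exact: (hdeg_H H e w). Qed.

Lemma deg_brH j w x : kmt_deg j x -> kmt_deg j (amul (H w) x).
Proof.
case: j => m gx; first exact: (hdeg_bracketH hh he w gx).
exact: (hdeg_bracketH hh hf w gx).
Qed.

Lemma deg_bre j i x : kmt_deg j x -> kmt_deg (j + 1) (amul (e i) x).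
Proof.
case: j => m; first by move=> gx; rewrite -PoszD addn1; exact: hdeg_step.
have -> : Negz m + 1 = - m%:Z by lia.
move=> gx; apply/deg_opp.
exact: (hdeg_bracket_opp HD HZ H0 hh hf he ef i gx).
Qed.

Lemma deg_brf j i x : kmt_deg j x -> kmt_deg (j - 1) (amul (f i) x).
Proof.
case: j => [[|m]|m] gx.
- have -> : 0%:Z - 1 = - 1%:Z by lia.
  by apply/deg_opp; apply: hdeg_step; apply/up0_dn0.
- have -> : m.+1%:Z - 1 = m by lia.
  exact: (hdeg_bracket_opp HD HZ H0 hh he hf fe i gx).
- have -> : Negz m - 1 = Negz m.+1 by lia.
  exact: hdeg_step.
Qed.

(** Each half is generated by left brackets, so the Jacobi identity reduces the claim to generators,
    for which [deg_bre] and [deg_brf] allow every degree of the second argument. *)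
Lemma deg_br a b x y : kmt_deg a x -> kmt_deg b y -> kmt_deg (a + b) (amul x y).
Proof.
have half m (g : 'I_n -> T) (s : int) :
    (forall i j x, kmt_deg j x -> kmt_deg (j + s) (amul (g i) x)) ->
    forall x, hdeg H g m x -> forall b y, kmt_deg b y -> kmt_deg (s * m + b) (amul x y).
  move=> gs; move=> {}x; elim=> {m x}.
  - by move=> w {}b {}y gy; rewrite mulr0 add0r; exact: deg_brH.
  - by move=> m {}b {}y _; rewrite amul0l; exact: deg_0.
  - by move=> m u v _ ihu _ ihv {}b {}y gy; rewrite amulDl; apply: deg_D; auto.
  - by move=> m c u _ ihu {}b {}y gy; rewrite amulZl; apply: deg_Z; auto.
  - move=> m i u _ ih {}b {}y gy.
    have -> : amul (amul (g i) u) y = amul (g i) (amul u y) - amul u (amul (g i) y).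
      by rewrite lie_leibniz addrK.
    rewrite -scaleN1r; apply: deg_D; last apply: deg_Z.
      have -> : s * m.+1 + b = s * m + b + s by rewrite intS; ring.
      exact/gs/ih.
    have -> : s * m.+1 + b = s * m + (b + s) by rewrite intS; ring.
    exact/ih/gs.
case: a => m gx gy.
  by rewrite -[m%:Z]mul1r; apply: (half _ _ _ _ _ gx _ _ gy) => i j u; exact: deg_bre.
rewrite NegzE -mulN1r; apply: (half _ _ _ _ _ gx _ _ gy) => i j u; exact: deg_brf.
Qed.

Lemma two_neq0 : 2 != 0 :> k.
Proof. by move/pcharf0P: k_char0 => ->. Qed.

Lemma deg_e i : kmt_deg 1 (e i).
Proof.
(* [hdeg] starts from the image of [H], so [e i] must be produced as a bracket; the coroot does it
   because the diagonal entry 2 is invertible in [k]. *)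
have -> : e i = - 2^-1 *: amul (e i) (H (coroot R i)).
  rewrite lieC kmt_he root_coroot A_diag scalerN scaleNr opprK scalerA mulVf ?scale1r //.
  exact: two_neq0.
by apply: deg_Z; exact: deg_bre (deg_H _).
Qed.

Lemma deg_f i : kmt_deg (-1) (f i).
Proof.
have -> : f i = 2^-1 *: amul (f i) (H (coroot R i)).
  rewrite lieC kmt_hf root_coroot A_diag scaleNr opprK scalerA mulVf ?scale1r //.
  exact: two_neq0.
by apply: deg_Z; exact: deg_brf (deg_H _).
Qed.

Lemma deg_span x : exists s : seq (int * T),
  (forall p, p \in s -> kmt_deg p.1 p.2) /\ x = \sum_(p <- s) p.2.
Proof.
pose sp y := exists s : seq (int * T),
  (forall p, p \in s -> kmt_deg p.1 p.2) /\ y = \sum_(p <- s) p.2.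
have spG j y : kmt_deg j y -> sp y.
  by exists [:: (j, y)]; split; [move=> p; rewrite inE => /eqP -> | rewrite big_seq1].
have spD y z : sp y -> sp z -> sp (y + z).
  move=> [s [sG ->]] [t [tG ->]]; exists (s ++ t); rewrite big_cat; split=> // p.
  by rewrite mem_cat => /orP[/sG|/tG].
have sp0 : sp 0 by apply: (spG 0); exact: deg_0.
have spZ c y : sp y -> sp (c *: y).
  move=> [s [sG ->]]; exists [seq (p.1, c *: p.2) | p <- s]; split.
    by move=> _ /mapP[p /sG pG ->]; exact: deg_Z.
  by rewrite big_map scaler_sumr.
apply: (km_ind (P := sp)) => //.
- by move=> w; apply: spG (deg_H w).
- by move=> i; apply: spG (deg_e i).
- by move=> i; apply: spG (deg_f i).
- move=> y z [s [sG ->]] [t [tG ->]].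
  exists [seq (p.1 + q.1, amul p.2 q.2) | p <- s, q <- t]; split.
    by move=> _ /allpairsP[[p q] [/sG pG /tG qG ->]]; exact: deg_br.
  rewrite big_allpairs_dep amul_suml; apply: eq_bigr => p _.
  by rewrite amul_sumr.
Qed.

Lemma deg_family x : exists (r : seq int) (c : int -> T),
  [/\ uniq r, forall j, kmt_deg j (c j) & x = \sum_(j <- r) c j].
Proof.
have [s [sG ->]] := deg_span x.
(* The test [p \in s] makes the degree hypothesis available for each summand. *)
exists (undup [seq p.1 | p <- s]), (fun j => \sum_(p <- s | (p.1 == j) && (p \in s)) p.2).
split; first exact: undup_uniq.
  by move=> j; apply: deg_sum => p /andP[/eqP <- /sG].
rewrite (exchange_big_dep predT) //=; apply: eq_big_seq => p ps.
rewrite big_mkcond (bigD1_seq p.1) ?undup_uniq ?mem_undup ?map_f //= eqxx ps /=.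
by rewrite big1 ?addr0 // => j /negPf jp; rewrite eq_sym jp.
Qed.

Variable d : h.
Hypothesis d1 : forall i, Defs.root R i d = 1.

Lemma deg_eigen j x : kmt_deg j x -> amul (H d) x = (j%:~R : k) *: x.
Proof.
have halves (g : 'I_n -> T) (s : k) m : (forall i, amul (H d) (g i) = s *: g i) ->
    hdeg H g m x -> amul (H d) x = (s * m%:R) *: x.
  move=> gs; elim=> {m x}.
  - by move=> w; rewrite kmt_hh mulr0 scale0r.
  - by move=> m; rewrite amul0r scaler0.
  - by move=> m y z _ ihy _ ihz; rewrite amulDr ihy ihz scalerDr.
  - by move=> m c y _ ih; rewrite amulZr ih !scalerA mulrC.
  - move=> m i y _ ih; rewrite lie_leibniz gs ih amulZl amulZr -scalerDl.
    by rewrite -{1}[s]mulr1 -mulrDr addrC -natr1.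
case: j => m gx.
  rewrite -pmulrn -[m%:R]mul1r; apply: halves gx => i.
  by rewrite kmt_he d1.
rewrite NegzE mulrNz -mulN1r -pmulrn; apply: halves gx => i.
by rewrite kmt_hf d1.
Qed.

(** The adjoint action of [d] has eigenvalue j in degree j, and characteristic 0 keeps these
    eigenvalues distinct. *)
Lemma deg_components (P : T -> Prop) (r : seq int) (c : int -> T) :
  (forall x y, P x -> P y -> P (x - y)) -> (forall b x, P x -> P (b *: x)) ->
  (forall x, P x -> P (amul (H d) x)) -> uniq r -> (forall j, kmt_deg j (c j)) ->
  P (\sum_(j <- r) c j) -> forall j, j \in r -> P (c j).
Proof.
move=> PB PZ PM ur cG; apply: (eigen_components (a := fun j : int => j%:~R : k)
  (D := amul (H d)) _ _ PB PZ PM _ ur).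
- by move=> a x y; rewrite amul_linr.
- move=> i j /eqP; rewrite -subr_eq0 -rmorphB /=.
  have k0 (m : nat) : (m%:R == 0 :> k) = (m == 0%N) by move/pcharf0P: k_char0 => ->.
  rewrite [i - j]intEsign rmorphM /= rmorph_sign mulf_eq0 signr_eq0 /= -pmulrn k0.
  by rewrite absz_eq0 subr_eq0 => /eqP.
- by move=> j; exact: deg_eigen.
Qed.

End KacMoodyGrading.

(** * Generation and nondegeneracy of the Heisenberg bracket *)

Section HeisenbergGeneration.
Variables (k : fieldType) (n : nat) (z : k).
Hypothesis zP : n.+1.-primitive_root z.
Hypothesis n_gt0 : (0 < n)%N.
Local Notation I := ('I_n.+1 * int)%type.

Lemma ordz1_neq0 : ordz n 1 != 0.
Proof. by rewrite -val_eqE /= -eqz_nat ordzE modz_small. Qed.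

Lemma heis_supp_unit (i : 'I_n.+1) (j : int) : `|j|%N = 1%N -> heis_supp (i, j).
Proof. by move=> j1; rewrite /heis_supp dvdzE /= j1 dvdn1 eqSS eqn0Ngt n_gt0 andbF. Qed.

Lemma rchar_eq1 (i : 'I_n.+1) (j : int) : `|j|%N = 1%N -> (rchar z i j == 1) = (i == 0).
Proof.
move=> j1; rewrite (prim_expz_eq1 zP) dvdzE abszM j1 muln1 /=.
by rewrite /dvdn modn_small // -val_eqE.
Qed.

Lemma rchar_ordz1 (j : int) : rchar z (ordz n 1) j = z ^ j.
Proof. by rewrite (rchar_ordz zP) mul1r. Qed.

Lemma heis_com_supp_lr (p q : I) :
  heis_com z p q != 0 -> heis_supp p /\ heis_supp q.
Proof.
have supp_l (p' q' : I) : ~~ heis_supp p' -> heis_com z p' q' = 0.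
  rewrite negbK => /andP[/eqP p0 pN]; apply/eqP; rewrite /heis_com p0 rchar0l.
  by rewrite subr_eq0 (prim_expz_eq1 zP) dvdz_mull.
move=> pq; split; apply: contraNT pq => /supp_l h; first by rewrite h.
by rewrite -oppr_eq0 /heis_com opprB -/(heis_com z q p) h.
Qed.

(* The elements of degree [±1] generate the rest: peel off one factor of
   degree [±1], chosen among two so as not to commute with what remains. *)
Lemma heis_generation (W : I -> Prop) :
  (forall i, W (i, 1)) -> (forall i, W (i, -1)) ->
  (forall p q, W p -> W q -> heis_com z p q != 0 -> W (p + q)) ->
  forall p, heis_supp p -> W p.
Proof.
move=> W1 WN1 WM.
have step (s : int) : `|s|%N = 1%N -> (forall i, W (i, s)) ->
    forall m i, heis_supp (i, s * m.+1%:Z) -> W (i, s * m.+1%:Z).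
  move=> s1 Ws; elim=> [|m ih] i; first by rewrite mulr1.
  have eS : s * m.+2%:Z = s * m.+1%:Z + s by rewrite [m.+2%:Z]intS; ring.
  have [->|i0] := eqVneq i 0 => isupp.
    have -> : (0, s * m.+2%:Z) = (- ordz n 1, s * m.+1%:Z) + (ordz n 1, s) :> I.
      by rewrite -[RHS]/(_ + _, _ + _) addNr eS.
    apply: WM; [apply: ih | exact: Ws |].
      by rewrite /heis_supp negb_and oppr_eq0 ordz1_neq0.
    rewrite /heis_com /= rchar_ordz1 (rcharNl zP) rchar_ordz1 subr_eq0.
    move: isupp; rewrite /heis_supp eqxx /= -(prim_expz_eq1 zP) eS.
    by apply: contra => /eqP e; rewrite expfzDr ?(prim_neq0 zP) // e
      mulVf ?expfz_neq0 ?(prim_neq0 zP).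
  have -> : (i, s * m.+2%:Z) = (i, s * m.+1%:Z) + (0, s) :> I.
    by rewrite -[RHS]/(_ + _, _ + _) addr0 eS.
  apply: WM; [apply: ih | exact: Ws |]; first by rewrite /heis_supp negb_and i0.
  by rewrite /heis_com /= rchar0l subr_eq0 eq_sym rchar_eq1.
move=> [i j]; case: j => [[|m]|m] jsupp.
- have i0 : i != 0 by move: jsupp; rewrite /heis_supp dvdz0 andbT.
  have -> : (i, 0%:Z) = (i, 1) + (0, -1) :> I.
    by rewrite -[RHS]/(_ + _, _ + _) addr0 subrr.
  apply: WM => //; rewrite /heis_com /= rchar0l subr_eq0 eq_sym.
  by rewrite rchar_eq1.
- by move: jsupp; rewrite -[m.+1%:Z]mul1r; exact: step.
- by move: jsupp; rewrite NegzE -mulN1r; exact: step.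
Qed.

End HeisenbergGeneration.

Section HeisenbergComponents.
Variables (k : fieldType) (n : nat) (z : k).
Hypothesis zP : n.+1.-primitive_root z.
Hypothesis n0 : n.+1%:R != 0 :> k.
Local Notation V := (int -> k^o)%type.
Local Notation u := (@bchar k n z).
Implicit Types (X Y : lendo V) (a b j : int).

Definition heis_part j X : Prop := exists c : 'I_n.+1 -> k,
  X = \sum_i c i *: u (i, j) /\ forall i, ~~ heis_supp (i, j) -> c i = 0.

Lemma heis_part_0 j : heis_part j 0.
Proof. by exists (fun=> 0); rewrite big1 // => i _; rewrite scale0r. Qed.

Lemma heis_part_D j X Y : heis_part j X -> heis_part j Y -> heis_part j (X + Y).
Proof.
move=> [c [-> c0]] [c' [-> c0']]; exists (fun i => c i + c' i); split.
  by rewrite -big_split; apply: eq_bigr => i _; rewrite scalerDl.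
by move=> i ni; rewrite c0 ?c0' ?addr0.
Qed.

Lemma heis_part_Z j (c : k) X : heis_part j X -> heis_part j (c *: X).
Proof.
move=> [c' [-> c0]]; exists (fun i => c * c' i); split.
  by rewrite scaler_sumr; apply: eq_bigr => i _; rewrite scalerA.
by move=> i ni; rewrite c0 ?mulr0.
Qed.

Lemma heis_part_sum j (J : Type) (r : seq J) (Q : pred J) (F : J -> lendo V) :
  (forall l, Q l -> heis_part j (F l)) -> heis_part j (\sum_(l <- r | Q l) F l).
Proof.
by move=> hF; apply: big_ind => //; [exact: heis_part_0 | exact: heis_part_D].
Qed.

Lemma heis_part_u (p : 'I_n.+1 * int) : heis_supp p -> heis_part p.2 (u p).
Proof.
move=> ps; exists (fun i => (i == p.1)%:R); split.
  rewrite (bigD1 p.1) //= eqxx scale1r big1 ?addr0; first by case: p ps.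
  by move=> i /negPf ->; rewrite scale0r.
by move=> i; case: eqP => // ->; rewrite -surjective_pairing ps.
Qed.

Lemma heis_part_br a b X Y :
  heis_part a X -> heis_part b Y -> heis_part (a + b) (amul X Y).
Proof.
move=> [c [-> c0]] [c' [-> c0']]; rewrite amul_suml; apply: heis_part_sum => i _.
rewrite amul_sumr; apply: heis_part_sum => i' _.
rewrite amulZl amulZr (bcharM zP) !scalerA.
have [->|/(@heis_com_supp _ _ _ zP _ id _ _ (i, a) (i', b)) si] :=
    eqVneq (heis_com z (i, a) (i', b)) 0.
  by rewrite mulr0 scale0r; exact: heis_part_0.
by apply: heis_part_Z; apply: (heis_part_u (p := (i, a) + (i', b))); apply: si.
Qed.

Lemma bchar_sum_free j (s : 'I_n.+1 -> 'I_n.+1) (c : 'I_n.+1 -> k) : injective s ->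
  \sum_i c i *: u (s i, j) = 0 -> forall i, c i = 0.
Proof.
move=> sI c0 i; have := bchar_free zP n0
  (s := [seq (c i, (s i, j)) | i <- enum 'I_n.+1]).
rewrite /lincomb big_map big_enum /= => /(_ c0 (s i, j)).
rewrite /coef big_map big_enum_cond /= => <-.
rewrite (bigD1 i) ?eqxx //= big1 ?addr0 // => l /andP[].
by rewrite xpair_eqE eqxx andbT => /eqP/sI -> /eqP.
Qed.

(** If p = x1 + x2 and x1 does not commute with x2, neither does p: since x2 commutes with itself,
    the two constants differ by an invertible factor. *)
Lemma heis_com_regular (p : 'I_n.+1 * int) : heis_supp p ->
  exists q, heis_supp q /\ heis_com z p q != 0.
Proof.
move=> ps; have [] := @heis_supp_com _ _ _ zP _ id _ _ _ p ps => //.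
  by move=> q; exists q.
move=> x1 [x2 [c0 e]].
exists x2; have cE : heis_com z p x2 = heis_com z x1 x2 * rchar z x2.1 x2.2.
  rewrite -e /heis_com /= (rcharDr zP) (rcharDl zP); ring.
split; last by rewrite cE mulf_neq0 // (rchar_neq0 zP).
apply: contraNT c0; rewrite negbK => /andP[/eqP x20 x2N].
rewrite /heis_com x20 rchar0l subr_eq0 eq_sym (prim_expz_eq1 zP).
by rewrite dvdz_mull.
Qed.

(** The bracket with [u q] translates all indices by q, so distinct terms cannot cancel and one
    suitable q for each p is enough. *)
Lemma lincomb_bchar_central (s : seq (k * ('I_n.+1 * int))) :
  (forall q, heis_supp q -> amul (lincomb u s) (u q) = 0) ->
  forall p, heis_supp p -> coef s p = 0.
Proof.
move=> sc p /heis_com_regular[q [qs pq]].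
pose t := [seq (x.1 * heis_com z x.2 q, x.2 + q) | x <- s].
have t0 : lincomb u t = 0.
  rewrite -(sc q qs) /lincomb big_map amul_suml; apply: eq_bigr => x _ /=.
  by rewrite amulZl (bcharM zP) scalerA.
apply: (mulIf pq); rewrite mul0r -(bchar_free zP n0 t0 (p + q)) /coef big_map /=.
rewrite mulr_suml; apply: eq_big => [x|x /eqP ->//].
by rewrite (inj_eq (addIr q)).
Qed.

End HeisenbergComponents.

(** * The radical and the center *)

Section AffineRep.
Variables (k : fieldType) (n : nat) (z : k) (R : realization k (affA n)).
Hypothesis k_char0 : [pchar k] =i pred0.
Hypothesis n_gt0 : (0 < n)%N.
Hypothesis zP : n.+1.-primitive_root z.
Local Notation h := (cartan R).
Local Notation T := (km_tilde R).
Local Notation V := (int -> k^o)%type.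
Local Notation I := ('I_n.+1 * int)%type.
Local Notation H := (fun w => @kmt_gen k n.+1 (affA n) R (KH w)).
Local Notation e := (fun i => @kmt_gen k n.+1 (affA n) R (KE i)).
Local Notation f := (fun i => @kmt_gen k n.+1 (affA n) R (KF i)).
Local Notation u := (@bchar k n z).
Local Notation part := (@heis_part k n z).
Local Notation deg := (@kmt_deg k n.+1 (affA n) R).

Let n0 : n.+1%:R != 0 :> k.
Proof. by move/pcharf0P: k_char0 => ->. Qed.

Lemma affA_diag i : affA n i i = 2.
Proof.
have iS : (i == ordS i) = false.
  apply/negbTE; have -> : ordS i = ordz n (i%:Z + 1).
    by apply/val_inj/eqP; rewrite -eqz_nat ordzE -modz_nat -addn1 PoszD.
  rewrite -[i in X in X == _]ordzK ordz_eq eqz_mod_dvd opprD addNKr dvdzE /=.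
  by rewrite dvdn1 eqSS -lt0n.
by rewrite mxE eqxx iS.
Qed.

Lemma affine_rep : exists (phi : {linear T -> lendo V}) (lam : h -> int -> k),
  [/\ forall x y, phi (amul x y) = amul (phi x) (phi y),
      forall w, phi (H w) = band 0 (lam w),
      forall i, phi (e i) = band_e k i, forall i, phi (f i) = band_f k i &
      forall x p, lam x (p + 1) = lam x p - Defs.root R (ordz n p) x].
Proof.
have [lam [lamL lamS lam_coroot]] := cartan_diag R.
pose g (x : km_gen h n.+1) : lendo V := match x with
  | KH w => band 0 (lam w) | KE i => band_e k i | KF i => band_f k i end.
have lamP x p : lam x (p - 1) = lam x p + Defs.root R (ordz n (p - 1)) x.
  by rewrite -[in RHS](subrK 1 p) lamS subrK subrK.
have [] := @km_tilde_lift k n.+1 (affA n) R _ g; rewrite /g.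
- exact: lendo_brxx.
- exact: lendo_jacobi.
- by move=> a v w; rewrite bandZ bandD; apply: band_ext => p; rewrite lamL.
- move=> v w; rewrite band_br -(band0 k 0); apply: band_ext => p.
  by rewrite !addr0 mulrC subrr.
- move=> i j; rewrite band_br subrr.
  have [->|ij] := eqVneq i j.
    apply: band_ext => p; rewrite lam_coroot addrK /delta.
    by case: eqP => _; case: eqP => _; rewrite ?mulr1 ?mulr0.
  rewrite -(band0 k 0); apply: band_ext => p; rewrite addrK /delta.
  have dd (x : int) : (ordz n x == i)%:R * (ordz n x == j)%:R = 0 :> k.
    by case: eqP => [->|_]; rewrite ?mul0r // (negPf ij) mulr0.
  by rewrite dd mulrC dd subrr.
- move=> w i; rewrite band_br bandZ add0r; apply: band_ext => p.
  rewrite addr0 lamS /delta; case: eqP => [->|_]; last by rewrite !(mulr0, mul0r) subrr.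
  by rewrite !mulr1 mul1r opprB addrC subrK.
- move=> w i; rewrite band_br bandZ add0r; apply: band_ext => p.
  rewrite addr0 lamP /delta; case: eqP => [->|_]; last by rewrite !(mulr0, mul0r) subrr.
  by rewrite !mulr1 mul1r opprD addrA subrr add0r.
move=> phi [phiM phig]; exists phi, lam; split=> // [w|i|i]; exact: phig.
Qed.

Variables (phi : {linear T -> lendo V}) (lam : h -> int -> k).
Hypothesis phiM : forall x y, phi (amul x y) = amul (phi x) (phi y).
Hypothesis phiH : forall w, phi (H w) = band 0 (lam w).
Hypothesis phie : forall i, phi (e i) = band_e k i.
Hypothesis phif : forall i, phi (f i) = band_f k i.
Hypothesis lamS : forall x p, lam x (p + 1) = lam x p - Defs.root R (ordz n p) x.
Implicit Types (x y : T).

Lemma bchar_sum j (c : 'I_n.+1 -> k) :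
  \sum_l c l *: u (l, j) = band j (fun p => \sum_l c l * rchar z l p).
Proof. by rewrite -band_sum; apply: eq_bigr => l _; rewrite bandZ. Qed.

Lemma phi_e_bchar i :
  phi (e i) = \sum_l (n.+1%:R^-1 * rchar z l (- i%:Z)) *: u (l, 1).
Proof.
rewrite phie bchar_sum; apply: band_ext => p.
by rewrite (rchar_sum_delta zP n0) ordzK.
Qed.

Lemma phi_f_bchar i :
  phi (f i) = \sum_l (n.+1%:R^-1 * rchar z l (- (i%:Z + 1))) *: u (l, -1).
Proof.
rewrite phif bchar_sum; apply: band_ext => p.
rewrite (rchar_sum_delta zP n0) /delta -[i in LHS]ordzK !ordz_eq !eqz_mod_dvd.
by rewrite opprD [- i%:Z - 1]addrC addrA.
Qed.

Lemma bchar_phi_e l : u (l, 1) = phi (\sum_(i < n.+1) rchar z l i *: e i).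
Proof.
rewrite linear_sum; under eq_bigr do rewrite linearZ /= phie /band_e bandZ.
rewrite band_sum; apply: band_ext => p; rewrite (bigD1 (ordz n p)) //= big1 => [|i ip].
  by rewrite /delta eqxx mulr1 addr0; apply: (rchar_mod zP); rewrite ordzE modz_mod.
by rewrite /delta eq_sym (negPf ip) mulr0.
Qed.

Lemma bchar_phi_f l : u (l, -1) = phi (\sum_(i < n.+1) rchar z l (i%:Z + 1) *: f i).
Proof.
rewrite linear_sum; under eq_bigr do rewrite linearZ /= phif /band_f bandZ.
rewrite band_sum; apply: band_ext => p.
rewrite (bigD1 (ordz n (p - 1))) //= big1 => [|i ip].
  rewrite /delta eqxx mulr1 addr0; apply: (rchar_mod zP).
  by rewrite ordzE modzDml subrK.
by rewrite /delta eq_sym (negPf ip) mulr0.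
Qed.

(** Degree 0 is excluded because the Cartan subalgebra acts by functions that need not be
    combinations of characters. The generators land in the support since N > 1, and brackets
    preserve it. *)
Lemma phi_deg j x : j != 0 -> deg j x -> part j (phi x).
Proof.
have halves (g : 'I_n.+1 -> T) (s : int) m y : `|s|%N = 1%N ->
    (forall i, part s (phi (g i))) ->
    (forall w i, exists c : k, amul (H w) (g i) = c *: g i) ->
    hdeg H g m y -> (0 < m)%N -> part (s * m%:Z) (phi y).
  move=> s1 gs Hg; elim=> {m y} //.
  - by move=> m _; rewrite linear0; exact: heis_part_0.
  - by move=> m v w _ ihv _ ihw m0; rewrite linearD; apply: heis_part_D; auto.
  - by move=> m c v _ ihv m0; rewrite linearZ; apply: heis_part_Z; auto.
  - move=> [|m] i v gv ih _.
      have [||| w ->] := hdeg_0E _ _ _ gv.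
      + by move=> v' w'; exists (v' + w'); rewrite kmtD.
      + by move=> c w'; exists (c *: w'); rewrite kmtZ.
      + by exists 0; rewrite kmt0.
      have [c wg] := Hg w i; rewrite lieC wg -scaleNr linearZ mulr1.
      exact: heis_part_Z.
    have -> : s * m.+2 = s + s * m.+1 by rewrite [m.+2%:Z]intS; ring.
    by rewrite phiM; apply: heis_part_br => //; exact: ih.
case: j => m j0 gx.
  rewrite -[m%:Z]mul1r; apply: halves gx _ => //.
  - move=> i; rewrite phi_e_bchar; apply: heis_part_sum => l _; apply: heis_part_Z.
    by apply: (@heis_part_u k n z (l, 1)); exact: heis_supp_unit.
  - by move=> w i; exists (Defs.root R i w); rewrite kmt_he.
  - by rewrite lt0n.
rewrite NegzE -mulN1r; apply: halves gx _ => //.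
- move=> i; rewrite phi_f_bchar; apply: heis_part_sum => l _; apply: heis_part_Z.
  by apply: (@heis_part_u k n z (l, -1)); exact: heis_supp_unit.
- by move=> w i; exists (- (Defs.root R i w : k)); rewrite kmt_hf.
Qed.

(** [Q] is carried through the generation of the Heisenberg basis, so that lifts can be taken
    homogeneous and in the derived algebra at once. *)
Lemma bchar_lift (Q : int -> T -> Prop) :
  (forall j c x, Q j x -> Q j (c *: x)) -> (forall j x y, Q j x -> Q j y -> Q j (x + y)) ->
  (forall j, Q j 0) -> (forall a b x y, Q a x -> Q b y -> Q (a + b) (amul x y)) ->
  (forall i, Q 1 (e i)) -> (forall i, Q (-1) (f i)) ->
  forall p, heis_supp p -> exists x, Q p.2 x /\ phi x = u p.
Proof.
move=> QZ QD Q0 QM Qe Qf.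
have Qsum j (F : 'I_n.+1 -> T) : (forall i, Q j (F i)) -> Q j (\sum_i F i).
  by move=> QF; apply: big_ind => //; exact: QD.
apply: (heis_generation zP n_gt0).
- move=> l; exists (\sum_(i < n.+1) rchar z l i *: e i); rewrite bchar_phi_e; split=> //.
  by apply: Qsum => i; apply: QZ.
- move=> l; exists (\sum_(i < n.+1) rchar z l (i%:Z + 1) *: f i); rewrite bchar_phi_f; split=> //.
  by apply: Qsum => i; apply: QZ.
- move=> p q [x [Qx xp]] [y [Qy yq]] pq; exists ((heis_com z p q)^-1 *: amul x y).
  split; first by apply: QZ; exact: QM.
  by rewrite linearZ /= phiM xp yq (bcharM zP) scalerA mulVf // scale1r.
Qed.

Lemma e_derived i : e i \in derived_pred T.
Proof.
have -> : e i = 2^-1 *: amul (H (coroot R i)) (e i).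
  rewrite kmt_he root_coroot affA_diag scalerA mulVf ?scale1r //.
  exact: (two_neq0 k_char0).
by apply: rpredZ; exact: amul_derived.
Qed.

Lemma f_derived i : f i \in derived_pred T.
Proof.
have -> : f i = - 2^-1 *: amul (H (coroot R i)) (f i).
  rewrite kmt_hf root_coroot affA_diag scalerA mulrNN mulVf ?scale1r //.
  exact: (two_neq0 k_char0).
by apply: rpredZ; exact: amul_derived.
Qed.

Lemma deg_derived_lift p : heis_supp p ->
  exists x, [/\ x \in derived_pred T, deg p.2 x & phi x = u p].
Proof.
move=> ps; pose Q j x := x \in derived_pred T /\ deg j x.
have [] := @bchar_lift Q _ _ _ _ _ _ p ps; last by move=> x [[]]; exists x.
- by move=> j c x [xd xj]; split; [exact: rpredZ | exact: deg_Z].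
- by move=> j x y [xd xj] [yd yj]; split; [exact: rpredD | exact: deg_D].
- by move=> j; split; [exact: rpred0 | exact: deg_0].
- by move=> a b x y [xd xj] [yd yj]; split; [exact: amul_derived | exact: deg_br].
- by move=> i; split; [exact: e_derived | exact: (deg_e R k_char0 affA_diag)].
- by move=> i; split; [exact: f_derived | exact: (deg_f R k_char0 affA_diag)].
Qed.

Lemma phi_ideal (P : T -> Prop) :
  (forall x y, P x -> P y -> P (x - y)) -> (forall b x, P x -> P (b *: x)) ->
  (forall x y, P x -> P (amul x y)) -> (forall w, P (H w) -> H w = 0) ->
  forall x, P x -> phi x = 0.
Proof.
move=> PB PZ PM PH.
have P_coprime j x : ~~ (n.+1%:Z %| j)%Z -> deg j x -> P x -> phi x = 0.
  move=> jN gx Px; have j0 : j != 0 by apply: contraNneq jN => ->; exact: dvdz0.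
  have [c [cE csupp]] := phi_deg j0 gx.
  suff c0 i : c i = 0 by rewrite cE big1 // => i _; rewrite c0 scale0r.
  (* The partner is chosen so that its bracket with [u (i, j)] has index (1, 0) and constant (z^j -
     1) z^(-ij), nonzero as N does not divide j. *)
  have qs : heis_supp (ordz n 1 - i, - j).
    rewrite /heis_supp /= negb_and; apply/orP; right.
    by rewrite dvdzE abszN -dvdzE.
  have [y [_ gy yE]] := deg_derived_lift qs.
  have gxy : deg 0 (amul x y) by rewrite -(subrr j); exact: deg_br gx gy.
  have [w wE] := deg_0E gxy.
  have : phi (amul x y) = 0.
    by rewrite wE PH ?linear0 // -wE; exact: PM.
  rewrite phiM cE yE amul_suml => s0.
  have := bchar_sum_free (z := z) zP n0 (j := 0) (s := fun l => l + (ordz n 1 - i))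
    (c := fun l => c l * heis_com z (l, j) (ordz n 1 - i, - j)) (@addIr _ _).
  have -> : \sum_l (c l * heis_com z (l, j) (ordz n 1 - i, - j)) *:
      u (l + (ordz n 1 - i), 0) = 0.
    rewrite -[RHS]s0; apply: eq_bigr => l _; rewrite amulZl (bcharM zP) scalerA.
    by congr (_ *: u _); rewrite -[RHS]/(_ + _, _ + _) subrr.
  move=> /(_ erefl i) /eqP; rewrite mulf_eq0 => /orP[/eqP //|].
  rewrite /heis_com /= (rcharDl zP) (rcharNl zP) (rchar_ordz1 zP) rcharNr.
  rewrite subr_eq0 -[X in _ == X]mul1r (inj_eq (mulIf _)) ?invr_eq0 ?(rchar_neq0 zP) //.
  by rewrite (prim_expz_eq1 zP) (negPf jN).
have P_deg j x : deg j x -> P x -> phi x = 0.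
  move=> gx Px; have [j0|j0] := eqVneq j 0.
    rewrite j0 in gx; have [w wE] := deg_0E gx.
    by rewrite wE PH ?linear0 // -wE.
  have [jN|] := boolP (n.+1%:Z %| j)%Z; last by move=> jN; exact: P_coprime gx Px.
  have [c [cE csupp]] := phi_deg j0 gx.
  (* When N divides j that constant vanishes. The bracket with [u (0, 1)] moves to degree j + 1, not
     divisible by N, with constants 1 - z^l that vanish only for l = 0, an index outside the
     support. *)
  have [y [_ gy yE]] := deg_derived_lift (heis_supp_unit n_gt0 0 (j := 1) erefl).
  have : phi (amul x y) = 0.
    apply: (P_coprime (j + 1)); [|exact: deg_br gx gy|exact: PM].
    by rewrite (rpredDl _ jN) dvdzE /= dvdn1 eqSS eqn0Ngt n_gt0.
  rewrite phiM cE yE amul_suml => s0.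
  have := bchar_sum_free (z := z) zP n0 (j := j + 1) (s := id)
    (c := fun l => c l * heis_com z (l, j) (0, 1)) (fun _ _ e => e).
  have -> : \sum_l (c l * heis_com z (l, j) (0, 1)) *: u (l, j + 1) = 0.
    rewrite -[RHS]s0; apply: eq_bigr => l _; rewrite amulZl (bcharM zP) scalerA.
    by congr (_ *: u _); rewrite -[RHS]/(_ + _, _ + _) addr0.
  move=> /(_ erefl) c0; rewrite big1 // => i _.
  have [i0|i0] := eqVneq i 0.
    by rewrite csupp ?scale0r // i0 /heis_supp eqxx jN.
  have /eqP := c0 i; rewrite mulf_eq0 => /orP[/eqP ->|]; first by rewrite scale0r.
  by rewrite /heis_com /= rchar0l subr_eq0 eq_sym (rchar_eq1 zP) ?(negPf i0).
have [d d1] := free_dual_vector (root_free R).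
move=> x Px; have [r [c [ur cG xE]]] := deg_family k_char0 affA_diag x.
rewrite xE linear_sum big_seq big1 // => j jr.
apply: (P_deg j) => //; move: j jr.
apply: (deg_components k_char0 d1 PB PZ _ ur cG); last by rewrite -xE.
by move=> y Py; rewrite lieC -scaleN1r; apply: PZ; apply: PM.
Qed.

(** Successive values of [lam] differ by the simple roots, so all of these vanish on [w]. *)
Lemma cartan_ker w : phi (H w) = 0 -> forall x, amul (H w) x = 0.
Proof.
rewrite phiH -(band0 k 0) => /band_inj lam0.
have rt0 i : Defs.root R i w = 0.
  have := lamS w i%:Z; rewrite !lam0 ordzK => /esym/eqP.
  by rewrite add0r oppr_eq0 => /eqP.
apply: (km_ind (P := fun x => amul (H w) x = 0)).
- by move=> v; exact: kmt_hh.
- by move=> i; rewrite kmt_he rt0 scale0r.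
- by move=> i; rewrite kmt_hf rt0 oppr0 scale0r.
- exact: amul0r.
- by move=> x y hx hy; rewrite amulDr hx hy addr0.
- by move=> a x hx; rewrite amulZr hx scaler0.
- by move=> x y hx hy; rewrite lie_leibniz hx hy amul0l amul0r addr0.
Qed.

Lemma deg_ker_orth j x y : j != 0 -> deg j x -> phi x = 0 -> deg (- j) y ->
  amul x y = 0.
Proof.
have HD v w : exists t, H v + H w = H t by exists (v + w); rewrite kmtD.
have HZ (c : k) w : exists t, c *: H w = H t by exists (c *: w); rewrite kmtZ.
have H0 : exists t, 0 = H t by exists 0; rewrite kmt0.
have hh v w : amul (H v) (H w) = 0 by exact: kmt_hh.
pose rt i w : k := Defs.root R i w.
have he w i : amul (H w) (e i) = rt i w *: e i by exact: kmt_he.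
have hf w i : amul (H w) (f i) = (- rt i w) *: f i by exact: kmt_hf.
have ef i l : exists t, amul (e i) (f l) = H t.
  by rewrite kmt_ef; case: eqP => _; [exists (coroot R i) | exact: H0].
have fe i l : exists t, amul (f i) (e l) = H t.
  by have [t tE] := ef l i; rewrite lieC tE -scaleN1r; exact: HZ.
have Zbr (x' y' : T) : phi x' = 0 -> phi (amul x' y') = 0.
  by move=> h0; rewrite phiM h0 amul0l.
(* The representation is faithful in degrees 1 and -1: the functions by which the generators act are
   separated by test points, and the point [a i] reads off the coefficient of index [i]. *)
have free1 (s : seq (k * 'I_n.+1)) (g : 'I_n.+1 -> T) (l : int) (F : 'I_n.+1 -> int -> k)
    (a : 'I_n.+1 -> int) :
    (forall i, phi (g i) = band l (F i)) ->
    (forall i i', F i' (a i) = (i' == i)%:R) -> phi (lincomb g s) = 0 -> lincomb g s = 0.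
  move=> gF Fa; rewrite linear_lincomb => s0; rewrite lincomb_coef big1 // => i _.
  rewrite (_ : coef s i = 0) ?scale0r //.
  have : lincomb (fun i => phi (g i)) s = band l (fun p => \sum_(q <- s) q.1 * F q.2 p).
    by rewrite -band_sum; apply: eq_bigr => q _; rewrite gF bandZ.
  rewrite s0 -(band0 k l) => /esym/band_inj/(_ (a i)) => <-.
  rewrite /coef big_mkcond; apply: eq_bigr => q _; rewrite Fa.
  by case: eqP; rewrite ?mulr1 ?mulr0.
have e1 x' : hdeg H e 1 x' -> phi x' = 0 -> x' = 0.
  move=> /(hdeg1E HD HZ H0 he)[s ->].
  have F0 (i i' : 'I_n.+1) : delta k i' i%:Z = (i' == i)%:R.
    by rewrite /delta ordzK eq_sym.
  exact: (free1 s (fun i => e i) 1 (@delta k n) (fun i => i%:Z) phie F0).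
have f1 x' : hdeg H f 1 x' -> phi x' = 0 -> x' = 0.
  move=> /(hdeg1E HD HZ H0 hf)[s ->].
  have F0 (i i' : 'I_n.+1) : delta k i' (i%:Z + 1 - 1) = (i' == i)%:R.
    by rewrite /delta addrK ordzK eq_sym.
  exact: (free1 s (fun i => f i) (-1) (fun i p => delta k i (p - 1))
    (fun i => i%:Z + 1) phif F0).
case: j => [[|m]|m] // _ gx px gy.
  exact: (hdeg_ker_orth HD HZ H0 hh he hf fe Zbr e1 gx px gy).
by apply: (hdeg_ker_orth HD HZ H0 hh hf he ef Zbr f1 gx px gy).
Qed.

(** Degree 0 is left out so that the span meets the Cartan subalgebra trivially. It is an ideal
    because, by [deg_ker_orth], the brackets that would land in degree 0 vanish. *)
Definition ker_nonzero_deg : {pred T} := fun x => `[< exists s : seq (int * T),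
  (forall p, p \in s -> [/\ p.1 != 0, deg p.1 p.2 & phi p.2 = 0]) /\
  x = \sum_(p <- s) p.2 >].

Fact ker_nonzero_deg_submod : subsemimod_closed ker_nonzero_deg.
Proof.
split; [split|].
- by apply/asboolP; exists [::]; rewrite big_nil.
- move=> x y /asboolP[s [sP ->]] /asboolP[t [tP ->]]; apply/asboolP.
  exists (s ++ t); rewrite big_cat; split=> // p.
  by rewrite mem_cat => /orP[/sP|/tP].
- move=> a x /asboolP[s [sP ->]]; apply/asboolP.
  exists [seq (p.1, a *: p.2) | p <- s]; rewrite big_map scaler_sumr; split=> //.
  move=> _ /mapP[p /sP[p1 pG p0] ->]; split=> //=; first exact: deg_Z.
  by rewrite linearZ /= p0 scaler0.
Qed.

Fact ker_nonzero_deg_mulr x y : x \in ker_nonzero_deg -> amul x y \in ker_nonzero_deg.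
Proof.
move=> /asboolP[s [sP ->]]; have [r [c [ur cG ->]]] := deg_family k_char0 affA_diag y.
apply/asboolP.
exists [seq p <- [seq (p.1 + j, amul p.2 (c j)) | p <- s, j <- r] | p.1 != 0]; split.
  move=> q; rewrite mem_filter => /andP[q1 /allpairsP[[p j] [/= /sP[p1 pG p0] jr qE]]].
  by split=> //; rewrite qE /=; [exact: deg_br | rewrite phiM p0 amul0l].
rewrite big_filter [RHS]big_mkcond big_allpairs_dep amul_suml.
apply: eq_big_seq => p /sP[p1 pG p0]; rewrite amul_sumr; apply: eq_bigr => j _ /=.
case: eqP => // /eqP; rewrite addrC addr_eq0 => /eqP jp.
by apply: (deg_ker_orth p1 pG p0); rewrite -jp.
Qed.

Fact ker_nonzero_deg_mull x y : y \in ker_nonzero_deg -> amul x y \in ker_nonzero_deg.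
Proof.
move=> yI; have [[_ _] sZ] := ker_nonzero_deg_submod.
by rewrite lieC -scaleN1r; apply: sZ; exact: ker_nonzero_deg_mulr.
Qed.

Definition ker_ideal : idealClosed T := HB.pack_for (idealClosed T) ker_nonzero_deg
  (GRing.isSubmodClosed.Build k T ker_nonzero_deg ker_nonzero_deg_submod)
  (isIdealClosed.Build k T ker_nonzero_deg ker_nonzero_deg_mull ker_nonzero_deg_mulr).

Lemma ker_ideal_cartan w : H w \in ker_ideal -> H w = 0.
Proof.
move=> /asboolP[s [sP wE]]; have [d d1] := free_dual_vector (root_free R).
(* Moving everything to one side gives a vanishing sum of homogeneous elements with [H w] in degree
   0, and the components of 0 are 0. *)
pose c j := if j == 0 then H w else - \sum_(p <- s | (p.1 == j) && (p \in s)) p.2.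
pose r := 0 :: undup [seq p.1 | p <- s].
have ur : uniq r.
  rewrite /r /= undup_uniq andbT mem_undup; apply/mapP => -[p /sP[p0 _ _] p1].
  by rewrite -p1 eqxx in p0.
have cG j : deg j (c j).
  rewrite /c; case: eqP => [->|_]; first exact: deg_H.
  rewrite -scaleN1r; apply: deg_Z; apply: deg_sum => p /andP[/eqP <- /sP[]] //.
have := deg_components k_char0 d1 (P := fun x => x = 0) (r := r) (c := c) _ _ _ ur cG.
rewrite /r big_cons {1}/c eqxx => /(_ _ _ _ _ 0 (mem_head _ _)); rewrite /c eqxx.
apply.
- by move=> x y -> ->; rewrite subr0.
- by move=> b x ->; rewrite scaler0.
- by move=> x ->; rewrite amul0r.
rewrite wE; apply/eqP; rewrite addr_eq0 -sumrN; apply/eqP.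
transitivity (\sum_(j <- undup [seq p.1 | p <- s])
   \sum_(p <- s | (p.1 == j) && (p \in s)) p.2).
  rewrite (exchange_big_dep predT) //=; apply: eq_big_seq => p ps.
  rewrite big_mkcond (bigD1_seq p.1) ?undup_uniq ?mem_undup ?map_f //= eqxx ps /=.
  by rewrite big1 ?addr0 // => j /negPf jp; rewrite eq_sym jp.
apply: eq_big_seq => j; rewrite mem_undup => /mapP[p /sP[p0 _ _] ->].
by rewrite (negPf p0) opprK.
Qed.

(** The components of [x] of nonzero degree lie in [ker_ideal], hence in the radical; the one of
    degree 0 is central by [cartan_ker]. *)
Lemma phi_ker_rad x y : phi x = 0 -> amul x y \in @km_rad k _ _ R.
Proof.
move=> px; have [d d1] := free_dual_vector (root_free R).
have [r [c [ur cG xE]]] := deg_family k_char0 affA_diag x.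
have c0 : forall j, j \in r -> phi (c j) = 0.
  apply: (deg_components k_char0 d1 (P := fun x => phi x = 0)) => //.
  - by move=> x' y' hx hy; rewrite linearB /= hx hy subr0.
  - by move=> b x' hx; rewrite linearZ /= hx scaler0.
  - by move=> x' hx; rewrite phiM hx amul0r.
  - by rewrite -xE.
rewrite xE amul_suml big_seq; apply: rpred_sum => j jr.
have [j0|j0] := eqVneq j 0.
  have := cG j; have := c0 j jr; rewrite j0 => p0 /deg_0E[w wE].
  by rewrite wE in p0 *; rewrite cartan_ker // rpred0.
apply: km_rad_mulr; apply/asboolP; exists [:: c j]; first by rewrite big_seq1.
move=> y'; rewrite mem_seq1 => /eqP ->; exists ker_ideal; last exact: ker_ideal_cartan.
apply/asboolP; exists [:: (j, c j)]; rewrite big_seq1; split=> // p.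
by rewrite mem_seq1 => /eqP ->; split=> //; exact: c0.
Qed.

Lemma rad_phi x : x \in @km_rad k _ _ R -> phi x = 0.
Proof.
move=> /asboolP[s -> sI]; rewrite linear_sum big_seq big1 // => y /sI[J yJ JH].
apply: (phi_ideal (P := fun x => x \in J)) => //.
- by move=> x' y' x'J y'J; rewrite -scaleN1r rpredD // rpredZ.
- by move=> b x' x'J; rewrite rpredZ.
- by move=> x' y' x'J; exact: ideal_mulr.
Qed.

(** * The derived algebra modulo its center *)

Local Notation g' := (derived (km_alg R)).
Local Notation rad := (@km_rad k n.+1 (affA n) R).

Lemma qproj_derived x : x \in derived_pred T -> qproj rad x \in derived_pred (km_alg R).
Proof.
move=> /derivedP[s ->].
rewrite (big_morph (qproj rad) (@qprojD _ _ rad) (@qproj0 _ _ rad)).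
by apply: rpred_sum => p _; rewrite qprojM amul_derived.
Qed.

(** The same corestriction as in [bar_e], so that [bar_e] and [bar_f] are images of generators by
    conversion. *)
Definition to_derived x : g' := insubd (0 : g') (qproj rad x).
Definition to_bar x : km_bar R := qproj (center g') (to_derived x).

Lemma to_derivedE x : x \in derived_pred T -> derived_val (to_derived x) = qproj rad x.
Proof. by move=> xd; rewrite -[LHS]/(val _) insubdK //; exact: qproj_derived. Qed.

Lemma to_bar_linear a x y : x \in derived_pred T -> y \in derived_pred T ->
  to_bar (a *: x + y) = a *: to_bar x + to_bar y.
Proof.
move=> xd yd; rewrite /to_bar -qprojZ -qprojD; congr qproj; apply: val_inj.
rewrite /= !to_derivedE ?qprojD ?qprojZ //.
by rewrite rpredD // rpredZ.
Qed.

Lemma to_bar0 : to_bar 0 = 0.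
Proof.
by have := to_bar_linear (-1) (rpred0 _) (rpred0 _); rewrite scaler0 addr0 scaleN1r addNr.
Qed.

Lemma to_bar_sum (J : Type) (s : seq J) (c : J -> k) (F : J -> T) :
  (forall j, F j \in derived_pred T) ->
  to_bar (\sum_(j <- s) c j *: F j) = \sum_(j <- s) c j *: to_bar (F j).
Proof.
move=> Fd; elim: s => [|j s ih]; first by rewrite !big_nil to_bar0.
rewrite !big_cons to_bar_linear // ?ih //.
by apply: rpred_sum => i _; exact: rpredZ.
Qed.

Lemma to_barM x y : x \in derived_pred T -> y \in derived_pred T ->
  to_bar (amul x y) = amul (to_bar x) (to_bar y).
Proof.
move=> xd yd; rewrite /to_bar -qprojM; congr qproj; apply: val_inj.
rewrite -[RHS]/(amul (derived_val (to_derived x)) (derived_val (to_derived y))).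
by rewrite /= !to_derivedE ?qprojM // amul_derived.
Qed.

(** Brackets are lifted factor by factor, which puts the lift in the derived algebra of [km_tilde];
    an arbitrary representative need not lie there. *)
Lemma to_bar_onto (X : km_bar R) : exists2 x, x \in derived_pred T & X = to_bar x.
Proof.
elim/qind: X => X; have /derivedP[s sE] := valP X.
exists (\sum_(p <- s) amul (repr p.1) (repr p.2)).
  by apply: rpred_sum => p _; exact: amul_derived.
congr qproj; apply: val_inj; rewrite /= to_derivedE; last first.
  by apply: rpred_sum => p _; exact: amul_derived.
rewrite (big_morph (qproj rad) (@qprojD _ _ rad) (@qproj0 _ _ rad)) -[LHS]/(val X) sE.
by apply: eq_bigr => p _; rewrite qprojM !qproj_repr.
Qed.

(** After expansion into homogeneous components, [phi_deg] and [heis_part_br] cover every bracket,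
    including those of opposite nonzero degrees, except that of two Cartan elements, which is 0. *)
Lemma phi_derived x : x \in derived_pred T ->
  exists s, phi x = lincomb u s /\ all (fun p => heis_supp p.2) s.
Proof.
pose sp (X : lendo V) := exists s, X = lincomb u s /\ all (fun p => heis_supp p.2) s.
have sp0 : sp 0 by exists [::]; rewrite /lincomb big_nil.
have spD X Y : sp X -> sp Y -> sp (X + Y).
  move=> [s [-> sP]] [t [-> tP]]; exists (s ++ t).
  by rewrite lincomb_cat all_cat sP tP.
have sp_part j X : part j X -> sp X.
  move=> [c [-> c0]]; apply: big_ind => // i _.
  have [si|/c0 ->] := boolP (heis_supp (i, j)); last by rewrite scale0r.
  by exists [:: (c i, (i, j))]; rewrite lincomb1 /= si.
move=> /derivedP[s ->]; rewrite linear_sum; apply: (big_ind sp) => // p _.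
have [r [c [_ cG ->]]] := deg_family k_char0 affA_diag p.1.
have [r' [c' [_ cG' ->]]] := deg_family k_char0 affA_diag p.2.
rewrite amul_suml linear_sum; apply: (big_ind sp) => // j _ /=.
rewrite amul_sumr linear_sum; apply: (big_ind sp) => // j' _ /=.
have [j0|j0] := eqVneq j 0.
  have := cG j; rewrite {1}j0 => /deg_0E[w ->].
  have [j0'|j0'] := eqVneq j' 0.
    by have := cG' j'; rewrite {1}j0' => /deg_0E[w' ->]; rewrite kmt_hh linear0.
  by apply: (sp_part j'); apply: phi_deg => //; exact: deg_brH.
have [j0'|j0'] := eqVneq j' 0.
  have := cG' j'; rewrite {1}j0' => /deg_0E[w ->].
  apply: (sp_part j); apply: phi_deg => //.
  by rewrite lieC -scaleN1r; apply: deg_Z; exact: deg_brH.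
by rewrite phiM; apply: (sp_part (j + j')); apply: heis_part_br; rewrite //; apply: phi_deg.
Qed.

(** A central class commutes with lifts of every supported [u p], so [lincomb_bchar_central]
    annihilates its image; the converse is [phi_ker_rad]. *)
Lemma to_bar_eq0 x : x \in derived_pred T -> to_bar x = 0 <-> phi x = 0.
Proof.
move=> xd; split=> [|px].
  rewrite -(qproj0 (center g')) => /qproj_eq; rewrite subr0 => /centerP xc.
  have xq y : y \in derived_pred T -> amul (phi x) (phi y) = 0.
    move=> yd; rewrite -phiM; apply: rad_phi; rewrite -[amul x y]subr0; apply/qproj_eq.
    rewrite qprojM qproj0 -(to_derivedE xd) -(to_derivedE yd).
    by rewrite -[RHS](congr1 val (xc (to_derived y))).
  have [s [sE /allP sP]] := phi_derived xd.
  rewrite sE lincomb_coef big_seq big1 // => i; rewrite mem_undup => /mapP[p ps ->].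
  rewrite (lincomb_bchar_central zP n0) ?scale0r //; last exact: sP.
  move=> q /deg_derived_lift[y [yd _ <-]].
  by rewrite -sE; exact: xq.
rewrite -(qproj0 (center g')); apply/qproj_eq; rewrite subr0; apply/centerP => Y.
apply: val_inj; rewrite -[LHS]/(amul (derived_val (to_derived x)) (derived_val Y)).
rewrite to_derivedE // -(qproj_repr (derived_val Y)) -qprojM -[RHS](qproj0 rad).
by apply/qproj_eq; rewrite subr0; exact: phi_ker_rad.
Qed.

Lemma to_bar_eq x y : x \in derived_pred T -> y \in derived_pred T -> phi x = phi y ->
  to_bar x = to_bar y.
Proof.
move=> xd yd e; apply/eqP; rewrite -subr_eq0 addrC -scaleN1r -to_bar_linear //.
apply/eqP/to_bar_eq0; first by rewrite rpredD // rpredZ.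
by rewrite linearD linearZ /= e scaleN1r addNr.
Qed.

(** The last four clauses, Fourier transforms of each other, tie the basis to the Chevalley
    generators, on which [diag_aut] is specified. *)
Lemma bar_basis : exists b : I -> km_bar R,
  [/\ graded_basis (@heis_supp n) +%R (heis_com z) b,
      forall i, bar_e R i = \sum_l (n.+1%:R^-1 * rchar z l (- i%:Z)) *: b (l, 1),
      forall i, bar_f R i = \sum_l (n.+1%:R^-1 * rchar z l (- (i%:Z + 1))) *: b (l, -1),
      forall l, b (l, 1) = \sum_(i < n.+1) rchar z l i *: bar_e R i &
      forall l, b (l, -1) = \sum_(i < n.+1) rchar z l (i%:Z + 1) *: bar_f R i].
Proof.
have liftP p : exists x, x \in derived_pred T /\ (heis_supp p -> phi x = u p).
  have [/deg_derived_lift[x [xd _ xp]]|_] := boolP (heis_supp p); first by exists x.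
  by exists 0; split; first exact: rpred0.
have [Z ZP] := choice liftP.
have Zd p : Z p \in derived_pred T by have [] := ZP p.
have Zphi p : heis_supp p -> phi (Z p) = u p by have [] := ZP p.
pose b p := if heis_supp p then to_bar (Z p) else 0.
have bE p : heis_supp p -> b p = to_bar (Z p) by rewrite /b => ->.
have s1 l : heis_supp (l, 1 : int) := heis_supp_unit n_gt0 l (j := 1) erefl.
have sN1 l : heis_supp (l, - 1 : int) := heis_supp_unit n_gt0 l (j := - 1) erefl.
have barE i : bar_e R i = to_bar (e i) by [].
have barF i : bar_f R i = to_bar (f i) by [].
exists b; split.
- split; first split.
  + by move=> p /negPf ps; rewrite /b ps.
  + move=> X; have [x xd ->] := to_bar_onto X.
    have [s [sE /allP sP]] := phi_derived xd; exists s.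
    transitivity (to_bar (\sum_(p <- s) p.1 *: Z p.2)).
      apply: to_bar_eq => //; first by apply: rpred_sum => p _; exact: rpredZ.
      rewrite sE linear_sum; apply: eq_big_seq => p /sP ps.
      by rewrite linearZ /= Zphi.
    rewrite to_bar_sum //; apply: eq_big_seq => p /sP ps.
    by rewrite bE.
  + move=> s s0 p ps; pose t := [seq q <- s | heis_supp q.2].
    have td : \sum_(q <- t) q.1 *: Z q.2 \in derived_pred T.
      by apply: rpred_sum => q _; exact: rpredZ.
    have : phi (\sum_(q <- t) q.1 *: Z q.2) = 0.
      apply/to_bar_eq0 => //; rewrite to_bar_sum // -[RHS]s0 big_filter big_mkcond.
      apply: eq_bigr => q _; rewrite /b.
      by case: ifP; rewrite ?scaler0.
    rewrite linear_sum => t0.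
    have {}t0 : lincomb u t = 0.
      rewrite -[RHS]t0; apply: eq_big_seq => q; rewrite mem_filter => /andP[qs _].
      by rewrite linearZ /= Zphi.
    rewrite -(bchar_free zP n0 t0 p) /coef big_filter_cond; apply: eq_bigl => q.
    by case: eqP => [->|]; rewrite ?ps ?andbF.
  + move=> p q ps qs; rewrite (bE p ps) (bE q qs) -to_barM //.
    have [pq0|pq] := eqVneq (heis_com z p q) 0.
      rewrite pq0 scale0r; apply/to_bar_eq0; first exact: amul_derived.
      by rewrite phiM !Zphi // (bcharM zP) pq0 scale0r.
    have pqs : heis_supp (p + q).
      by apply: (@heis_com_supp _ _ _ zP _ id _ _ p q).
    rewrite bE // -[RHS]addr0 -to_bar0 -to_bar_linear ?rpred0 // addr0.
    apply: to_bar_eq; [exact: amul_derived | exact: rpredZ |].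
    by rewrite linearZ /= phiM !Zphi // (bcharM zP).
- move=> i; rewrite barE; under eq_bigr do rewrite bE //.
  rewrite -to_bar_sum //; apply: to_bar_eq; first exact: e_derived.
    by apply: rpred_sum => l _; exact: rpredZ.
  rewrite phi_e_bchar linear_sum; apply: eq_bigr => l _.
  by rewrite linearZ /= Zphi.
- move=> i; rewrite barF; under eq_bigr do rewrite bE //.
  rewrite -to_bar_sum //; apply: to_bar_eq; first exact: f_derived.
    by apply: rpred_sum => l _; exact: rpredZ.
  rewrite phi_f_bchar linear_sum; apply: eq_bigr => l _.
  by rewrite linearZ /= Zphi.
- move=> l; rewrite bE //; under eq_bigr do rewrite barE.
  rewrite -to_bar_sum => [|i]; last exact: e_derived.
  apply: to_bar_eq => //; last by rewrite Zphi // bchar_phi_e.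
  by apply: rpred_sum => i _; apply: rpredZ; exact: e_derived.
- move=> l; rewrite bE //; under eq_bigr do rewrite barF.
  rewrite -to_bar_sum => [|i]; last exact: f_derived.
  apply: to_bar_eq => //; last by rewrite Zphi // bchar_phi_f.
  by apply: rpred_sum => i _; apply: rpredZ; exact: f_derived.
Qed.

End AffineRep.

(** * The diagram automorphism on the Heisenberg basis *)

Section DiagramAutomorphism.
Variables (k : fieldType) (n : nat) (z : k) (R : realization k (affA n)).
Hypothesis k_char0 : [pchar k] =i pred0.
Hypothesis n_gt0 : (0 < n)%N.
Hypothesis zP : n.+1.-primitive_root z.

Lemma km_bar_basis : exists b : 'I_n.+1 * int -> km_bar R,
  graded_basis (@heis_supp n) +%R (heis_com z) b /\
  forall p, diag_aut R (rho n) (b p) = rchar z p.1 (-1) *: b p.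
Proof.
have [phi [lam [phiM phiH phie phif lamS]]] := affine_rep R.
have [b [bb bar_eE bar_fE b1 bN1]] :=
  bar_basis k_char0 n_gt0 zP phiM phiH phie phif lamS.
exists b; split=> //.
pose chi (p : 'I_n.+1 * int) := rchar z p.1 (-1).
(* [diag_aut] is defined by choice, so a candidate must be exhibited; in Fourier coordinates the
   rotation from i to i + 1 is multiplication by z^(-l). *)
have [t tb] : exists t : aut (km_bar R), forall p, t (b p) = chi p *: b p.
  apply: (graded_basis_aut bb) => [p|p q]; first exact: (rchar_neq0 zP).
  exact: (rcharDl zP).
have rhoE (i : 'I_n.+1) : ((rho n i)%:Z = i%:Z + 1 %[mod n.+1])%Z.
  by rewrite /rho permE /= -modz_nat modz_mod -addn1 PoszD.
have te i : t (bar_e R i) = bar_e R (rho n i).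
  rewrite !bar_eE linear_sum; apply: eq_bigr => l _; rewrite linearZ /= tb scalerA.
  congr (_ *: _); rewrite -mulrA -(rcharDr zP) -opprD.
  by congr (_ * _); rewrite !rcharNr (rchar_mod zP _ (rhoE i)).
have tf i : t (bar_f R i) = bar_f R (rho n i).
  rewrite !bar_fE linear_sum; apply: eq_bigr => l _; rewrite linearZ /= tb scalerA.
  congr (_ *: _); rewrite -mulrA -(rcharDr zP) -opprD.
  by congr (_ * _); rewrite !rcharNr !(rcharDr zP) (rchar_mod zP _ (rhoE i)) !(rcharDr zP).
have [s0e s0f] : (forall i, diag_aut R (rho n) (bar_e R i) = bar_e R (rho n i)) /\
    (forall i, diag_aut R (rho n) (bar_f R i) = bar_f R (rho n i)).
  have := xgetPex (aut_id (km_bar R)) (P := [set t : aut (km_bar R) |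
    forall i, t (bar_e R i) = bar_e R (rho n i) /\
              t (bar_f R i) = bar_f R (rho n i)]%classic).
  move=> /(_ (ex_intro _ t (fun i => conj (te i) (tf i)))) sP.
  by split=> i; have [] := sP i.
set s0 := diag_aut R (rho n) in s0e s0f *.
move=> p; have [ps|/(basis_out bb.1) ->] := boolP (heis_supp p); last first.
  by rewrite linear0 scaler0.
(* The chosen automorphism agrees with [t] in shift degrees 1 and -1, and these generate all
   supported indices. *)
elim/(heis_generation zP n_gt0): ps => {p}.
- move=> l; rewrite -[RHS]tb b1 !linear_sum; apply: eq_bigr => i _.
  by rewrite !linearZ /= s0e te.
- move=> l; rewrite -[RHS]tb bN1 !linear_sum; apply: eq_bigr => i _.
  by rewrite !linearZ /= s0f tf.
- move=> p q sp sq pq; have [ps qs] := heis_com_supp_lr zP pq.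
  have -> : b (p + q) = (heis_com z p q)^-1 *: amul (b p) (b q).
    by rewrite bb.2 // scalerA mulVf // scale1r.
  rewrite linearZ /= aut_mul sp sq amulZl amulZr !scalerA; congr (_ *: _).
  by rewrite /chi /= (rcharDl zP); ring.
Qed.

End DiagramAutomorphism.

Theorem theorem8p3p1 (k : closedFieldType) (k_char0 : [pchar k] =i pred0)
    (zeta : nat -> k)
    (zeta_prim : forall m, (0 < m)%N -> m.-primitive_root (zeta m))
    (zeta_compat : forall m n, (0 < m)%N -> (0 < n)%N ->
       zeta (m * n)%N ^+ n = zeta m)
    (ell : nat) (ell_gt0 : (0 < ell)%N) (R : realization k (affA ell)) (q : int)
    (m : nat) (m_period : has_period (autz (diag_aut R (rho ell)) q) m) :
  let Lrho := loop zeta (autz (diag_aut R (rho ell)) q) m in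
  [/\ forall m1, has_period (autz (aut_P ell.+1 (t1 k)) q) m1 ->
        Lrho ≃ loop zeta (autz (aut_P ell.+1 (t1 k)) q) m1,
      forall m1 m2,
        has_period (aut_D ell.+1 (zeta ell.+1 : k^o)) m1 ->
        has_period (autz (aut_P ell.+1 (1 : k^o)) q) m2 ->
        Lrho ≃ loop2 zeta (aut_D ell.+1 (zeta ell.+1 : k^o))
                          (autz (aut_P ell.+1 (1 : k^o)) q) m1 m2
    & Lrho ≃ sl (gcdn `|q| ell.+1) (qtorus (zeta ell.+1 ^ iota_rep ell.+1 q))].
Proof.
have zP : ell.+1.-primitive_root (zeta ell.+1) by exact: zeta_prim.
have nat0 (i : nat) : i.+1%:R != 0 :> k by move/pcharf0P: k_char0 => ->.
have [g gE] : exists g, gcdn `|q| ell.+1 = g.+1.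
  by exists (gcdn `|q| ell.+1).-1; rewrite prednK // gcdn_gt0 orbT.
pose r := (q %/ gcdn `|q| ell.+1)%Z; pose d := (ell.+1 %/ gcdn `|q| ell.+1)%N.
have nE : ell.+1 = (d * g.+1)%N by rewrite -gE divnK // dvdn_gcdr.
have qE : q = (gcdn `|q| ell.+1)%:Z * r.
  by rewrite mulrC divzK // dvdzE /= dvdn_gcdl.
(* The same [i0] is the inverse of [r] in every index map and the cofactor in [iota_rep]; this
   identifies the parameter of the quantum torus. *)
have [i0 ri0 iotaE] := iota_rep_spec (ltn0Sn ell) qE.
rewrite gE in qE.
have [b [bb bs]] := km_bar_basis R k_char0 ell_gt0 zP.
have [B BB] := loop_torus_basis zeta_prim zeta_compat ell_gt0 nE qE ri0 bb bs m_period.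
split.
- move=> m1 per1; have [b1 [bb1 bs1]] := sl_laurent_basis zP (nat0 ell).
  have [B1 BB1] := loop_torus_basis zeta_prim zeta_compat ell_gt0 nE qE ri0 bb1 bs1 per1.
  exact: graded_basis_isoalg BB BB1.
- move=> m1 m2 per1 per2; have [b2 [bb2 bP bD]] := sl_scalar_basis zP (nat0 ell).
  have [B2 BB2] := loop2_torus_basis zeta_prim zeta_compat ell_gt0 nE qE ri0 bb2 bD bP
    per1 per2.
  exact: graded_basis_isoalg BB BB2.
- rewrite iotaE mulrC gE.
  have [B3 BB3] := sl_qtorus_basis zP (nat0 g) nE ri0.
  exact: graded_basis_isoalg BB BB3.
Qed.
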